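(* Let $k$ be a field, let $\Lambda$ be a finite dimensional self-injective $k$-algebra, and suppose $V$ is a finitely generated $\Lambda$-module whose stable endomorphism ring $\underline{\mathrm{End}}_{\Lambda}(V)$ is isomorphic to $k$. (i) The deformation functor $\hat F_V$ is naturally isomorphic to the weak deformation functor $\hat F^w_V$. (ii) The module $V$ has a universal deformation ring $R(\Lambda,V)$. (iii) If $P$ is a finitely generated projective $\Lambda$-module, then $\underline{\mathrm{End}}_{\Lambda}(V\oplus P)\cong k$ and $R(\Lambda,V)\cong R(\Lambda,V\oplus P)$. (iv) If $\Lambda$ is also a Frobenius algebra, then $\underline{\mathrm{End}}_{\Lambda}(\Omega(V))\cong k$ and $R(\Lambda,V)\cong R(\Lambda,\Omega(V))$.
   Context: $k$ is a field of arbitrary characteristic; modules are left modules. A Frobenius algebra is a finite dimensional $k$-algebra $\Lambda$ admitting a non-degenerate associative bilinear form $\Lambda\times\Lambda\to k$; equivalently, $\Lambda_\Lambda\cong\mathrm{Hom}_k({}_\Lambda\Lambda,k)$ as right $\Lambda$-modules. The stable endomorphism ring $\underline{\mathrm{End}}_\Lambda(V)$ is $\mathrm{End}_\Lambda(V)$ modulo the ideal of endomorphisms factoring through projective modules. $\Omega(V)$ is the first syzygy, i.e. the kernel of a projective cover $P_V\to V$. Deformations. Let $\hat{\mathcal{C}}$ be the category of all complete local commutative Noetherian $k$-algebras with residue field $k$, with morphisms the continuous $k$-algebra homomorphisms inducing the identity on $k$. For $R\in\hat{\mathcal{C}}$, a lift of $V$ over $R$ is a pair $(M,\phi)$, where $M$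 is a finitely generated $R\otimes_k\Lambda$-module which is free over $R$ and $\phi:k\otimes_R M\to V$ is a $\Lambda$-module isomorphism. Two lifts $(M,\phi)$, $(M',\phi')$ over $R$ are isomorphic if there is an $R\otimes_k\Lambda$-module isomorphism $f:M\to M'$ with $\phi'\circ(k\otimes_R f)=\phi$. The isomorphism class $[M,\phi]$ of a lift is called a deformation of $V$ over $R$. The deformation functor $\hat F_V:\hat{\mathcal{C}}\to\mathrm{Sets}$ sends $R$ to the set of deformations of $V$ over $R$, and a morphism $\alpha:R\to R'$ to $[M,\phi]\mapsto[R'\otimes_{R,\alpha}M,\phi_\alpha]$, where $\phi_\alpha$ is the composition $k\otimes_{R'}(R'\otimes_{R,\alpha}M)\cong k\otimes_R M\xrightarrow{\phi}V$. If $(M,\phi)$ is a lift of $V$ over $R$, the isomorphism class $[M]$ of $M$ as an $R\otimes_k\Lambda$-module is called a weak deformation of $V$ over $R$. The weak deformation functor $\hat F^w_V:\hat{\mathcal{C}}\to\mathrm{Sets}$ sends $R$ to the set of weak deformations of $V$ over $R$ and $\alpha:R\to R'$ to $[M]\mapsto[R'\otimes_{R,\alpha}M]$. A universal deformation ring of $V$ is an object $R(\Lambda,V)$ of $\hat{\mathcal{C}}$ representing $\hat F_V$, i.e. $\hat F_V\cong\mathrm{Hom}_{\hat{\mathcal{C}}}(R(\Lambda,V),-)$. Isomorphisms of deformation rings are isomorphisms in $\hat{\mathcal{C}}$. *)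

(* Defs.v *)
From HB Require Import structures.
From mathcomp Require Import all_boot all_algebra all_field.
From mathcomp Require Import boolp.

Set Implicit Arguments.
Unset Strict Implicit.
Unset Printing Implicit Defensive.

Import GRing.Theory.

Local Open Scope ring_scope.
Local Open Scope quotient_scope.

Definition surjective (A B : Type) (f : A -> B) : Prop :=
  forall y, exists x, f x = y.

Section MakeLinear.
Variables (A : pzRingType) (U V : lmodType A) (f : U -> V).
Hypothesis f_lin : linear f.
HB.instance Definition _ := GRing.isLinear.Build A U V *:%R f f_lin.
Definition make_linear : {linear U -> V} := f.
End MakeLinear.

Section Modules.
Variable A : pzRingType.

Definition is_submodule (M : lmodType A) (N : M -> Prop) : Prop :=
  [/\ N 0, forall x y, N x -> N y -> N (x + y) & forall a x, N x -> N (a *: x)].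

Definition finitely_generated (M : lmodType A) : Prop :=
  exists n (g : 'I_n -> M), forall x : M,
    exists c : 'I_n -> A, x = \sum_(i < n) c i *: g i.

Definition projective (P : lmodType A) : Prop :=
  forall (M N : lmodType A) (g : {linear M -> N}) (f : {linear P -> N}),
    surjective g -> exists h : {linear P -> M}, forall x, g (h x) = f x.

Definition injective_module (E : lmodType A) : Prop :=
  forall (M N : lmodType A) (i : {linear M -> N}) (f : {linear M -> E}),
    injective i -> exists h : {linear N -> E}, forall x, h (i x) = f x.

(* The last condition says that the kernel of [p] is superfluous:
   [N + ker p = P] forces [N = P]. *)
Definition projective_cover (P V : lmodType A) (p : {linear P -> V}) : Prop :=
  [/\ projective P, surjective p
    & forall N : P -> Prop, is_submodule N ->
        (forall x, exists2 y, N y & p (x - y) = 0) -> forall x, N x].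

Definition is_syzygy (V W : lmodType A) : Prop :=
  exists (P : lmodType A) (p : {linear P -> V}) (i : {linear W -> P}),
    [/\ projective_cover p, injective i
      & forall x, p x = 0 <-> exists w, i w = x].

Definition free_module (M : lmodType A) : Prop :=
  exists (I : eqType) (b : I -> M),
    (forall x, exists s : seq (A * I), x = \sum_(p <- s) p.1 *: b p.2) /\
    (forall (s : seq I) (c : I -> A), uniq s ->
       \sum_(i <- s) c i *: b i = 0 -> forall i, i \in s -> c i = 0).

End Modules.

Section Algebras.
Variables (k : fieldType) (L : falgType k).

(* Left self-injective; for finite dimensional algebras this is left-right
   symmetric. *)
Definition self_injective : Prop := @injective_module L L^o.

Definition frobenius : Prop :=
  exists B : L -> L -> k,
    [/\ (forall c x y z, B (c *: x + y) z = c * B x z + B y z)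
          /\ (forall c x y z, B z (c *: x + y) = c * B z x + B z y),
        forall x y z, B (x * y) z = B x (y * z),
        forall x, (forall y, B x y = 0) -> x = 0
      & forall y, (forall x, B x y = 0) -> y = 0].

End Algebras.

Section StableEndomorphisms.
Variables (k : fieldType) (L : falgType k) (V : lmodType L).

Definition endo : Type := {linear V -> V}.

HB.instance Definition _ := gen_eqMixin endo.
HB.instance Definition _ := gen_choiceMixin endo.

Definition endo_fun (f : endo) : V -> V := (f : {linear V -> V}).
Coercion endo_fun : endo >-> Funclass.

Lemma endo_linear (f : endo) a x y : f (a *: x + y) = a *: f x + f y.
Proof. exact: (@linearP _ _ _ _ (f : {linear V -> V})). Qed.

Lemma endoP (f g : endo) : (forall x, f x = g x) -> f = g.
Proof.
case: f g => f [[fa] [fs]] [g [[ga] [gs]]] /= /funext fg.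
rewrite /endo_fun /= in fg; case: _ / fg ga gs => ga gs.
by rewrite (Prop_irrelevance fa ga) (Prop_irrelevance fs gs).
Qed.

Local Notation lin f := (linear (f : V -> V)).

Lemma zero_lin : lin (fun=> 0).
Proof. by move=> a x y; rewrite scaler0 addr0. Qed.
Lemma one_lin : lin (fun x => x).
Proof. by []. Qed.
Lemma opp_lin (f : endo) : lin (fun x => - f x).
Proof. by move=> a x y; rewrite endo_linear opprD scalerN. Qed.
Lemma add_lin (f g : endo) : lin (fun x => f x + g x).
Proof. by move=> a x y; rewrite !endo_linear scalerDr addrACA. Qed.
Lemma mul_lin (f g : endo) : lin (fun x => f (g x)).
Proof. by move=> a x y; rewrite !endo_linear. Qed.
Lemma scale_lin (c : k) (f : endo) : lin (fun x => (c%:A : L) *: f x).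
Proof.
by move=> a x y; rewrite endo_linear scalerDr !scalerA mulr_algl mulr_algr.
Qed.

Definition endo_zero : endo := make_linear zero_lin.
Definition endo_one : endo := make_linear one_lin.
Definition endo_opp (f : endo) : endo := make_linear (opp_lin f).
Definition endo_add (f g : endo) : endo := make_linear (add_lin f g).
Definition endo_mul (f g : endo) : endo := make_linear (mul_lin f g).
Definition endo_scale (c : k) (f : endo) : endo := make_linear (scale_lin c f).

Lemma endo_addA : associative endo_add.
Proof. by move=> f g h; apply: endoP => x; rewrite /endo_fun /= addrA. Qed.
Lemma endo_addC : commutative endo_add.
Proof. by move=> f g; apply: endoP => x; rewrite /endo_fun /= addrC. Qed.
Lemma endo_add0 : left_id endo_zero endo_add.
Proof. by move=> f; apply: endoP => x; rewrite /endo_fun /= add0r. Qed.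
Lemma endo_addN : left_inverse endo_zero endo_opp endo_add.
Proof. by move=> f; apply: endoP => x; rewrite /endo_fun /= addNr. Qed.

HB.instance Definition _ :=
  GRing.isZmodule.Build endo endo_addA endo_addC endo_add0 endo_addN.

Lemma endo_mulA : associative endo_mul.
Proof. by move=> f g h; apply: endoP => x. Qed.
Lemma endo_mul1 : left_id endo_one endo_mul.
Proof. by move=> f; apply: endoP => x. Qed.
Lemma endo_1mul : right_id endo_one endo_mul.
Proof. by move=> f; apply: endoP => x. Qed.
Lemma endo_mulDl : left_distributive endo_mul endo_add.
Proof. by move=> f g h; apply: endoP => x. Qed.
Lemma endo_mulDr : right_distributive endo_mul endo_add.
Proof.
by move=> f g h; apply: endoP => x; apply: (raddfD (f : {linear V -> V})).
Qed.

HB.instance Definition _ := GRing.Zmodule_isPzRing.Build endo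
  endo_mulA endo_mul1 endo_1mul endo_mulDl endo_mulDr.

Lemma endo_scaleA a b f : endo_scale a (endo_scale b f) = endo_scale (a * b) f.
Proof.
by apply: endoP => x; rewrite /endo_fun /= scalerA -scalerAl mul1r scalerA.
Qed.
Lemma endo_scale1 : left_id 1 endo_scale.
Proof. by move=> f; apply: endoP => x; rewrite /endo_fun /= !scale1r. Qed.
Lemma endo_scaleDr : right_distributive endo_scale +%R.
Proof. by move=> c f g; apply: endoP => x; rewrite /endo_fun /= scalerDr. Qed.
Lemma endo_scaleDl f : {morph endo_scale^~ f : a b / a + b}.
Proof. by move=> a b; apply: endoP => x; rewrite /endo_fun /= !scalerDl. Qed.

HB.instance Definition _ := GRing.Zmodule_isLmodule.Build k endo
  endo_scaleA endo_scale1 endo_scaleDr endo_scaleDl.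

Lemma endoD (f g : endo) x : (f + g : endo) x = f x + g x. Proof. by []. Qed.
Lemma endoN (f : endo) x : (- f : endo) x = - f x. Proof. by []. Qed.
Lemma endoM (f g : endo) x : (f * g : endo) x = f (g x). Proof. by []. Qed.
Lemma endo1 x : (1 : endo) x = x. Proof. by []. Qed.
Lemma endo0 x : (0 : endo) x = 0. Proof. by []. Qed.
Lemma endoZ c (f : endo) x : (c *: f : endo) x = (c%:A : L) *: f x. Proof. by []. Qed.

Definition factors_through_projective (f : endo) : Prop :=
  exists (P : lmodType L) (g : {linear V -> P}) (h : {linear P -> V}),
    projective P /\ forall x, f x = h (g x).

Local Notation fproj := factors_through_projective.

Lemma fproj0 : fproj 0.
Proof.
exists 'rV[L]_0, \0, \0; split=> // M N g f _; exists \0 => x /=.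
by rewrite thinmx0 !raddf0.
Qed.

Lemma fprojMl (u f : endo) : fproj f -> fproj (u * f).
Proof.
move=> [P [g [h [pP fE]]]].
exists P, g, ((u : {linear V -> V}) \o h); split=> // x.
by rewrite endoM fE.
Qed.

Lemma fprojMr (u f : endo) : fproj f -> fproj (f * u).
Proof.
move=> [P [g [h [pP fE]]]].
exists P, (g \o (u : {linear V -> V})), h; split=> // x.
by rewrite endoM fE.
Qed.

Lemma fprojD (f1 f2 : endo) : fproj f1 -> fproj f2 -> fproj (f1 + f2).
Proof.
move=> [P1 [g1 [h1 [pP1 f1E]]]] [P2 [g2 [h2 [pP2 f2E]]]].
have glin : linear (fun x => (g1 x, g2 x) : P1 * P2).
  by move=> a x y; rewrite !linearP.
have hlin : linear (fun x : P1 * P2 => h1 x.1 + h2 x.2).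
  by move=> a x y /=; rewrite !linearP /= scalerDr addrACA.
exists (P1 * P2)%type, (make_linear glin), (make_linear hlin).
split=> [M N g f g_surj|x]; last by rewrite endoD f1E f2E.
have i1lin : linear (fun x : P1 => (x, 0) : P1 * P2).
  by move=> a x y; congr pair; rewrite /= scaler0 addr0.
have i2lin : linear (fun x : P2 => (0, x) : P1 * P2).
  by move=> a x y; congr pair; rewrite /= scaler0 addr0.
have [u1 u1E] := pP1 M N g (f \o make_linear i1lin) g_surj.
have [u2 u2E] := pP2 M N g (f \o make_linear i2lin) g_surj.
have ulin : linear (fun x : P1 * P2 => u1 x.1 + u2 x.2).
  by move=> a x y /=; rewrite !linearP /= scalerDr addrACA.
exists (make_linear ulin) => -[x1 x2] /=.
rewrite linearD u1E u2E /= -linearD; congr (f _).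
by congr pair; rewrite /= ?addr0 ?add0r.
Qed.

Lemma fprojN (f : endo) : fproj f -> fproj (- f).
Proof. by move=> /(fprojMl (- 1)); rewrite mulN1r. Qed.

Lemma fprojZ c (f : endo) : fproj f -> fproj (c *: f).
Proof.
move=> /(fprojMl (c *: (1 : endo))); congr (fproj _).
by apply: endoP => x; rewrite endoM !endoZ endo1.
Qed.

Definition stable_eq (f g : endo) : bool := `[< fproj (f - g) >].

Lemma stable_eq_refl : reflexive stable_eq.
Proof. by move=> f; apply/asboolP; rewrite subrr; apply: fproj0. Qed.
Lemma stable_eq_sym : symmetric stable_eq.
Proof.
by move=> f g; apply/asboolP/asboolP => /fprojN; rewrite opprB.
Qed.
Lemma stable_eq_trans : transitive stable_eq.
Proof.
move=> g f h /asboolP fg /asboolP gh; apply/asboolP.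
by have := fprojD fg gh; rewrite addrA subrK.
Qed.

Canonical stable_equiv :=
  EquivRel stable_eq stable_eq_refl stable_eq_sym stable_eq_trans.

(* The stable endomorphism ring: endomorphisms modulo the ideal of those
   factoring through a projective module.  It may be the zero ring, so it is
   a [pzRingType] (and an [lmodType k]) but not an [algType k]. *)
Definition stable_endo : Type := {eq_quot stable_equiv}.
HB.instance Definition _ := Choice.on stable_endo.

Definition stable_class (f : endo) : stable_endo := \pi_({eq_quot stable_equiv}) f.

Lemma stable_classP f g : stable_class f = stable_class g <-> fproj (f - g).
Proof.
split=> [/eqmodP /asboolP //|fg]; apply/eqmodP; exact/asboolP.
Qed.

Lemma stable_ind (Q : stable_endo -> Prop) :
  (forall f, Q (stable_class f)) -> forall u, Q u.
Proof. by move=> Qf u; rewrite -[u]reprK; apply: Qf. Qed.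

Lemma stable_repr f : fproj (repr (stable_class f) - f).
Proof. by apply/stable_classP; rewrite /stable_class reprK. Qed.

Definition stable_add (u v : stable_endo) := stable_class (repr u + repr v).
Definition stable_opp (u : stable_endo) := stable_class (- repr u).
Definition stable_mul (u v : stable_endo) := stable_class (repr u * repr v).
Definition stable_scale c (u : stable_endo) := stable_class (c *: repr u).

Lemma stable_addE f g :
  stable_add (stable_class f) (stable_class g) = stable_class (f + g).
Proof.
apply/stable_classP; rewrite opprD addrACA.
exact: fprojD (stable_repr f) (stable_repr g).
Qed.
Lemma stable_oppE f : stable_opp (stable_class f) = stable_class (- f).
Proof. by apply/stable_classP; rewrite -opprD; apply: fprojN (stable_repr f). Qed.
Lemma stable_mulE f g :
  stable_mul (stable_class f) (stable_class g) = stable_class (f * g).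
Proof.
apply/stable_classP; set f' := repr _; set g' := repr _.
have -> : f' * g' - f * g = f' * (g' - g) + (f' - f) * g.
  by rewrite mulrBr mulrBl addrA subrK.
by apply: fprojD; [apply/fprojMl/stable_repr | apply/fprojMr/stable_repr].
Qed.
Lemma stable_scaleE c f :
  stable_scale c (stable_class f) = stable_class (c *: f).
Proof.
by apply/stable_classP; rewrite -scalerBr; apply: fprojZ (stable_repr f).
Qed.

Lemma stable_addA : associative stable_add.
Proof. elim/stable_ind=> f; elim/stable_ind=> g; elim/stable_ind=> h.
by rewrite !stable_addE addrA. Qed.
Lemma stable_addC : commutative stable_add.
Proof. by elim/stable_ind=> f; elim/stable_ind=> g; rewrite !stable_addE addrC. Qed.
Lemma stable_add0 : left_id (stable_class 0) stable_add.
Proof. by elim/stable_ind=> f; rewrite stable_addE add0r. Qed.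
Lemma stable_addN : left_inverse (stable_class 0) stable_opp stable_add.
Proof. by elim/stable_ind=> f; rewrite stable_oppE stable_addE addNr. Qed.

HB.instance Definition _ :=
  GRing.isZmodule.Build stable_endo stable_addA stable_addC stable_add0 stable_addN.

Lemma stable_classD f g : stable_class (f + g) = stable_class f + stable_class g.
Proof. by rewrite -stable_addE. Qed.

Lemma stable_mulA : associative stable_mul.
Proof. elim/stable_ind=> f; elim/stable_ind=> g; elim/stable_ind=> h.
by rewrite !stable_mulE mulrA. Qed.
Lemma stable_mul1 : left_id (stable_class 1) stable_mul.
Proof. by elim/stable_ind=> f; rewrite stable_mulE mul1r. Qed.
Lemma stable_1mul : right_id (stable_class 1) stable_mul.
Proof. by elim/stable_ind=> f; rewrite stable_mulE mulr1. Qed.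
Lemma stable_mulDl : left_distributive stable_mul stable_add.
Proof.
elim/stable_ind=> f; elim/stable_ind=> g; elim/stable_ind=> h.
by rewrite !(stable_mulE, stable_addE) mulrDl.
Qed.
Lemma stable_mulDr : right_distributive stable_mul stable_add.
Proof.
elim/stable_ind=> f; elim/stable_ind=> g; elim/stable_ind=> h.
by rewrite !(stable_mulE, stable_addE) mulrDr.
Qed.

HB.instance Definition _ := GRing.Zmodule_isPzRing.Build stable_endo
  stable_mulA stable_mul1 stable_1mul stable_mulDl stable_mulDr.

Lemma stable_scaleA a b u : stable_scale a (stable_scale b u) = stable_scale (a * b) u.
Proof. by elim/stable_ind: u => ?; rewrite !stable_scaleE scalerA. Qed.
Lemma stable_scale1 : left_id 1 stable_scale.
Proof. by elim/stable_ind=> f; rewrite stable_scaleE scale1r. Qed.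
Lemma stable_scaleDr : right_distributive stable_scale +%R.
Proof.
move=> c; elim/stable_ind=> f; elim/stable_ind=> g.
rewrite [in LHS]/GRing.add [in RHS]/GRing.add /=.
by rewrite !(stable_scaleE, stable_addE) scalerDr.
Qed.
Lemma stable_scaleDl u : {morph stable_scale^~ u : a b / a + b}.
Proof.
move=> a b; elim/stable_ind: u => f; rewrite [in RHS]/GRing.add /=.
by rewrite !(stable_scaleE, stable_addE) scalerDl.
Qed.

HB.instance Definition _ := GRing.Zmodule_isLmodule.Build k stable_endo
  stable_scaleA stable_scale1 stable_scaleDr stable_scaleDl.

(* Isomorphic to [k] as a [k]-algebra, not merely as a ring. *)
Definition stable_endo_is_scalar : Prop :=
  exists f : {rmorphism stable_endo -> k},
    bijective f /\ forall c u, f (c *: u) = c * f u.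

End StableEndomorphisms.

Section Ideals.
Variable R : comNzRingType.

Definition is_ideal (I : R -> Prop) : Prop := @is_submodule R R^o I.

Definition maximal_ideal (I : R -> Prop) : Prop :=
  [/\ is_ideal I, ~ I 1
    & forall J : R -> Prop, is_ideal J -> (forall x, I x -> J x) -> ~ J 1 ->
        forall x, J x -> I x].

Definition unique_maximal_ideal (I : R -> Prop) : Prop :=
  maximal_ideal I /\
  forall J, maximal_ideal J -> forall x, J x <-> I x.

Definition noetherian : Prop :=
  forall I : R -> Prop, is_ideal I ->
    exists n (g : 'I_n -> R), forall x,
      I x <-> exists c : 'I_n -> R, x = \sum_(i < n) c i * g i.

Definition ideal_pow (I : R -> Prop) (n : nat) (x : R) : Prop :=
  exists m (c : 'I_m -> R) (y : 'I_m -> 'I_n -> R),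
    (forall i j, I (y i j)) /\ x = \sum_(i < m) c i * \prod_(j < n) y i j.

(* [R -> lim R / I^n] is injective and surjective. *)
Definition adically_complete (I : R -> Prop) : Prop :=
  (forall x, (forall n, ideal_pow I n x) -> x = 0) /\
  (forall u : nat -> R, (forall n, ideal_pow I n (u n.+1 - u n)) ->
     exists x, forall n, ideal_pow I n (x - u n)).

End Ideals.

(* Complete local commutative noetherian [k]-algebras with residue field [k].
   The [k]-algebra map [residue] to [k] has the maximal ideal as its kernel;
   as such it is surjective and uniquely determined. *)
Record clnAlg (k : fieldType) := ClnAlg {
  cln_sort :> comAlgType k;
  residue : {lrmorphism cln_sort -> k^o};
  cln_local : unique_maximal_ideal (fun x => residue x = 0);
  cln_noetherian : noetherian cln_sort;
  cln_complete : adically_complete (fun x => residue x = 0) }.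

Definition max_ideal (k : fieldType) (R : clnAlg k) : R -> Prop :=
  fun x => residue R x = 0.

Section ClnHom.
Variable k : fieldType.
Implicit Types R S T : clnAlg k.

Record clnHom R S := ClnHom {
  hom_fun :> {lrmorphism R -> S};
  hom_residue : forall x, residue S (hom_fun x) = residue R x;
  hom_continuous : forall n, exists m, forall x,
    ideal_pow (@max_ideal k R) m x -> ideal_pow (@max_ideal k S) n (hom_fun x) }.

Lemma clnHomP R S (f g : clnHom R S) : (forall x, f x = g x) -> f = g.
Proof.
case: f g => [f fr fc] [g gr gc] /= fg.
have {fg} E : f = g.
  case: f g fg {fr fc gr gc} => f [[fa] [fm] [fs]] [g [[ga] [gm] [gs]]] /= /funext E.
  case: _ / E ga gm gs => ga gm gs.
  by rewrite (Prop_irrelevance fa ga) (Prop_irrelevance fm gm) (Prop_irrelevance fs gs).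
case: _ / E gr gc => gr gc.
by rewrite (Prop_irrelevance fr gr) (Prop_irrelevance fc gc).
Qed.

Lemma id_continuous R n : exists m, forall x,
  ideal_pow (@max_ideal k R) m x -> ideal_pow (@max_ideal k R) n (idfun x).
Proof. by exists n. Qed.

Definition cln_id R : clnHom R R :=
  ClnHom (hom_fun := idfun) (fun=> erefl) (@id_continuous R).

Section Comp.
Variables (R S T : clnAlg k) (g : clnHom S T) (f : clnHom R S).

Lemma comp_residue x : residue T ((g \o f) x) = residue R x.
Proof. by rewrite /= !hom_residue. Qed.

Lemma comp_continuous n : exists m, forall x,
  ideal_pow (@max_ideal k R) m x -> ideal_pow (@max_ideal k T) n ((g \o f) x).
Proof.
have [m gm] := hom_continuous g n; have [l fl] := hom_continuous f m.
by exists l => x /fl /gm.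
Qed.

Definition cln_comp : clnHom R T :=
  ClnHom (hom_fun := g \o f) comp_residue comp_continuous.
End Comp.

Definition cln_iso R S : Prop :=
  exists (f : clnHom R S) (g : clnHom S R),
    cln_comp g f = cln_id R /\ cln_comp f g = cln_id S.

Record functor := Functor {
  fobj :> clnAlg k -> Type;
  fmap : forall R S, clnHom R S -> fobj R -> fobj S;
  fmap_id : forall R x, fmap (cln_id R) x = x;
  fmap_comp : forall R S T (f : clnHom R S) (g : clnHom S T) x,
    fmap (cln_comp g f) x = fmap g (fmap f x) }.

Definition naturally_isomorphic (F G : functor) : Prop :=
  exists eta : forall R, F R -> G R,
    (forall R, bijective (eta R)) /\
    (forall R S (f : clnHom R S) x, eta S (fmap f x) = fmap f (eta R x)).

Section HomFunctor.
Variable R : clnAlg k.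

Lemma hom_functor_id S (x : clnHom R S) : cln_comp (cln_id S) x = x.
Proof. exact: clnHomP. Qed.

Lemma hom_functor_comp S T U (f : clnHom S T) (g : clnHom T U) (x : clnHom R S) :
  cln_comp (cln_comp g f) x = cln_comp g (cln_comp f x).
Proof. exact: clnHomP. Qed.

Definition hom_functor : functor :=
  @Functor (clnHom R) (fun S T f x => cln_comp f x) hom_functor_id hom_functor_comp.
End HomFunctor.

End ClnHom.

(* The tensor product [S (x)_R M] along [f : R -> S]: formal sums of pairs
   [(s, m)], two of them being identified when every [f]-semilinear map from
   [M] to an [S]-module takes the same value on them.  Its universal property
   is [base_change_lift], [base_change_liftE] and [base_change_ind]. *)
Section BaseChange.
Variables (R S : comNzRingType) (f : {rmorphism R -> S}) (M : lmodType R).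

Definition semilinear (N : lmodType S) (g : M -> N) : Prop :=
  forall a x y, g (a *: x + y) = f a *: g x + g y.

Definition formal_value (N : lmodType S) (g : M -> N) (s : seq (S * M)) : N :=
  \sum_(p <- s) p.1 *: g p.2.

Definition formal_eq (s t : seq (S * M)) : bool :=
  `[< forall (N : lmodType S) (g : M -> N),
        semilinear g -> formal_value g s = formal_value g t >].

Lemma formal_eq_refl : reflexive formal_eq.
Proof. by move=> s; apply/asboolP. Qed.
Lemma formal_eq_sym : symmetric formal_eq.
Proof. by move=> s t; apply/asboolP/asboolP => st N g /st. Qed.
Lemma formal_eq_trans : transitive formal_eq.
Proof.
move=> t s u /asboolP st /asboolP tu; apply/asboolP => N g gl.
by rewrite st // tu.
Qed.

Canonical formal_equiv :=
  EquivRel formal_eq formal_eq_refl formal_eq_sym formal_eq_trans.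

Definition base_change : Type := {eq_quot formal_equiv}.
HB.instance Definition _ := Choice.on base_change.

Definition formal_class (s : seq (S * M)) : base_change :=
  \pi_({eq_quot formal_equiv}) s.

Definition tensor (s : S) (m : M) : base_change := formal_class [:: (s, m)].

Lemma formal_classP s t :
  formal_class s = formal_class t <->
  forall (N : lmodType S) (g : M -> N),
    semilinear g -> formal_value g s = formal_value g t.
Proof.
split=> [/eqmodP /asboolP //|st]; apply/eqmodP; exact/asboolP.
Qed.

Lemma formal_ind (Q : base_change -> Prop) :
  (forall s, Q (formal_class s)) -> forall u, Q u.
Proof. by move=> Qf u; rewrite -[u]reprK; apply: Qf. Qed.

Lemma formal_repr s (N : lmodType S) (g : M -> N) : semilinear g ->
  formal_value g (repr (formal_class s)) = formal_value g s.
Proof.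
by move: N g; apply/formal_classP; rewrite /formal_class reprK.
Qed.

Definition formal_scale a (s : seq (S * M)) := [seq (a * p.1, p.2) | p <- s].

Lemma value_cat (N : lmodType S) (g : M -> N) s t :
  formal_value g (s ++ t) = formal_value g s + formal_value g t.
Proof. exact: big_cat. Qed.

Lemma value_scale (N : lmodType S) (g : M -> N) a s :
  formal_value g (formal_scale a s) = a *: formal_value g s.
Proof.
rewrite /formal_value big_map scaler_sumr.
by apply: eq_bigr => p _; rewrite scalerA.
Qed.

Definition bc_add (u v : base_change) := formal_class (repr u ++ repr v).
Definition bc_scale a (u : base_change) := formal_class (formal_scale a (repr u)).
Definition bc_zero := formal_class [::].

Lemma bc_addE s t :
  bc_add (formal_class s) (formal_class t) = formal_class (s ++ t).
Proof. by apply/formal_classP => N g gl; rewrite !value_cat !formal_repr. Qed.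
Lemma bc_scaleE a s :
  bc_scale a (formal_class s) = formal_class (formal_scale a s).
Proof. by apply/formal_classP => N g gl; rewrite !value_scale !formal_repr. Qed.

Lemma bc_addA : associative bc_add.
Proof.
elim/formal_ind=> s; elim/formal_ind=> t; elim/formal_ind=> u.
by rewrite !bc_addE catA.
Qed.
Lemma bc_addC : commutative bc_add.
Proof.
elim/formal_ind=> s; elim/formal_ind=> t; rewrite !bc_addE.
by apply/formal_classP => N g gl; rewrite !value_cat addrC.
Qed.
Lemma bc_add0 : left_id bc_zero bc_add.
Proof. by elim/formal_ind=> s; rewrite bc_addE. Qed.
Lemma bc_addN : left_inverse bc_zero (bc_scale (-1)) bc_add.
Proof.
elim/formal_ind=> s; rewrite bc_scaleE bc_addE; apply/formal_classP => N g gl.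
by rewrite value_cat value_scale scaleN1r addNr /formal_value big_nil.
Qed.

HB.instance Definition _ :=
  GRing.isZmodule.Build base_change bc_addA bc_addC bc_add0 bc_addN.

Lemma formal_class_cat s t : formal_class (s ++ t) = formal_class s + formal_class t.
Proof. by rewrite -bc_addE. Qed.

Lemma bc_scaleA a b u : bc_scale a (bc_scale b u) = bc_scale (a * b) u.
Proof.
elim/formal_ind: u => s; rewrite !bc_scaleE; apply/formal_classP => N g gl.
by rewrite !value_scale scalerA.
Qed.
Lemma bc_scale1 : left_id 1 bc_scale.
Proof.
elim/formal_ind=> s; rewrite bc_scaleE; apply/formal_classP => N g gl.
by rewrite value_scale scale1r.
Qed.
Lemma bc_scaleDr : right_distributive bc_scale +%R.
Proof.
move=> a; elim/formal_ind=> s; elim/formal_ind=> t.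
rewrite -formal_class_cat !bc_scaleE -formal_class_cat.
by congr formal_class; apply: map_cat.
Qed.
Lemma bc_scaleDl u : {morph bc_scale^~ u : a b / a + b}.
Proof.
elim/formal_ind: u => s a b; rewrite !bc_scaleE -formal_class_cat.
by apply/formal_classP => N g gl; rewrite value_cat !value_scale scalerDl.
Qed.

HB.instance Definition _ := GRing.Zmodule_isLmodule.Build S base_change
  bc_scaleA bc_scale1 bc_scaleDr bc_scaleDl.

Lemma formal_class_scale a s : formal_class (formal_scale a s) = a *: formal_class s.
Proof. by rewrite -bc_scaleE. Qed.

Lemma formal_classE s : formal_class s = \sum_(p <- s) p.1 *: tensor 1 p.2.
Proof.
elim: s => [|[a m] s IHs]; first by rewrite big_nil.
rewrite big_cons -cat1s formal_class_cat IHs; congr (_ + _).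
by rewrite -formal_class_scale /= mulr1.
Qed.

Lemma tensorZ a s m : a *: tensor s m = tensor (a * s) m.
Proof. by rewrite -formal_class_scale. Qed.

Lemma tensor_semilinear : semilinear (tensor 1).
Proof.
move=> a x y; rewrite tensorZ mulr1 -formal_class_cat.
apply/formal_classP => N g gl.
by rewrite /formal_value !big_cons !big_nil /= !scale1r gl !addr0.
Qed.

Lemma base_change_ind (N : lmodType S) (g h : {linear base_change -> N}) :
  (forall m, g (tensor 1 m) = h (tensor 1 m)) -> forall u, g u = h u.
Proof.
move=> gh; elim/formal_ind=> s; rewrite formal_classE !linear_sum.
by apply: eq_bigr => p _; rewrite !linearZ /= gh.
Qed.

Lemma tensorE s m : tensor s m = s *: tensor 1 m.
Proof. by rewrite tensorZ mulr1. Qed.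

Lemma tensorDr s m n : tensor s (m + n) = tensor s m + tensor s n.
Proof.
rewrite tensorE -[m]scale1r tensor_semilinear rmorph1 !scale1r scalerDr.
by rewrite -!tensorE.
Qed.

Lemma tensor0r s : tensor s 0 = 0.
Proof. by apply: (addrI (tensor s 0)); rewrite -tensorDr !addr0. Qed.

Lemma tensorZr s a m : tensor s (a *: m) = tensor (s * f a) m.
Proof.
rewrite tensorE -[a *: m]addr0 tensor_semilinear tensor0r addr0 scalerA.
by rewrite -tensorE.
Qed.

Lemma tensor_ind (Q : base_change -> Prop) :
  Q 0 -> (forall s m, Q (tensor s m)) ->
  (forall u v, Q u -> Q v -> Q (u + v)) -> forall u, Q u.
Proof.
move=> Q0 Qt QD; elim/formal_ind=> s; rewrite formal_classE.
by apply: big_ind => // p _; rewrite -tensorE.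
Qed.

Section Lift.
Variables (N : lmodType S) (g : M -> N) (g_lin : semilinear g).

Lemma lift_subproof : linear (fun u : base_change => formal_value g (repr u)).
Proof.
move=> a; elim/formal_ind=> s; elim/formal_ind=> t.
rewrite -formal_class_scale -formal_class_cat !formal_repr //.
by rewrite value_cat value_scale.
Qed.

Definition base_change_lift : {linear base_change -> N} := make_linear lift_subproof.

Lemma base_change_liftE s m : base_change_lift (tensor s m) = s *: g m.
Proof.
by rewrite /base_change_lift /= formal_repr // /formal_value big_cons big_nil addr0.
Qed.
End Lift.

End BaseChange.

Definition restrict_scalars (S T : comNzRingType) (g : {rmorphism S -> T})
  (N : lmodType T) : Type := N.

Section RestrictScalars.
Variables (S T : comNzRingType) (g : {rmorphism S -> T}) (N : lmodType T).
Local Notation restrict_scalars := (restrict_scalars g N).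

HB.instance Definition _ := GRing.Zmodule.copy restrict_scalars N.

Definition rs_scale (a : S) (x : restrict_scalars) : restrict_scalars :=
  g a *: (x : N).

Lemma rs_scaleA a b u : rs_scale a (rs_scale b u) = rs_scale (a * b) u.
Proof. by rewrite /rs_scale scalerA rmorphM. Qed.
Lemma rs_scale1 : left_id 1 rs_scale.
Proof. by move=> u; rewrite /rs_scale rmorph1 scale1r. Qed.
Lemma rs_scaleDr : right_distributive rs_scale +%R.
Proof. by move=> a u v; apply: scalerDr. Qed.
Lemma rs_scaleDl u : {morph rs_scale^~ u : a b / a + b}.
Proof. by move=> a b; rewrite /rs_scale rmorphD scalerDl. Qed.

HB.instance Definition _ := GRing.Zmodule_isLmodule.Build S restrict_scalars
  rs_scaleA rs_scale1 rs_scaleDr rs_scaleDl.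

Lemma rs_scaleE a (x : restrict_scalars) : a *: x = g a *: (x : N).
Proof. by []. Qed.

End RestrictScalars.

Section BaseChangeMap.
Variables (R S : comNzRingType) (f : {rmorphism R -> S}).
Variables (M N : lmodType R) (h : {linear M -> N}).

Lemma bc_map_subproof : semilinear f (fun m => tensor f 1 (h m)).
Proof. by move=> a x y; rewrite linearP tensor_semilinear. Qed.

Definition base_change_map : {linear base_change f M -> base_change f N} :=
  base_change_lift bc_map_subproof.

Lemma base_change_mapE s m : base_change_map (tensor f s m) = tensor f s (h m).
Proof. by rewrite base_change_liftE -tensorE. Qed.

End BaseChangeMap.

(* [T (x)_S (S (x)_R M) ~ T (x)_R M] *)
Section BaseChangeAssoc.
Variables (R S T : comNzRingType).
Variables (f : {rmorphism R -> S}) (g : {rmorphism S -> T}) (h : {rmorphism R -> T}).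
Hypothesis gf : forall x, g (f x) = h x.
Variable M : lmodType R.

Lemma assoc_inner_subproof :
  semilinear f (fun m : M => tensor h 1 m : restrict_scalars g (base_change h M)).
Proof. by move=> a x y; rewrite tensor_semilinear rs_scaleE gf. Qed.

Definition assoc_inner := base_change_lift assoc_inner_subproof.

Lemma assoc_inner_semilinear : semilinear g (assoc_inner : _ -> base_change h M).
Proof. by move=> a x y; rewrite linearP rs_scaleE. Qed.

Definition base_change_assoc :
    {linear base_change g (base_change f M) -> base_change h M} :=
  base_change_lift assoc_inner_semilinear.

Lemma base_change_assocE t s m :
  base_change_assoc (tensor g t (tensor f s m)) = tensor h (t * g s) m.
Proof.
rewrite base_change_liftE /assoc_inner base_change_liftE rs_scaleE.
by rewrite tensorZ mulr1 tensorZ.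
Qed.

Lemma assoc_inv_subproof : semilinear h (fun m : M => tensor g 1 (tensor f 1 m)).
Proof.
by move=> a x y; rewrite (tensor_semilinear f) (tensor_semilinear g) gf.
Qed.

Definition base_change_assoc_inv :
    {linear base_change h M -> base_change g (base_change f M)} :=
  base_change_lift assoc_inv_subproof.

Lemma base_change_assoc_invE t m :
  base_change_assoc_inv (tensor h t m) = tensor g t (tensor f 1 m).
Proof. by rewrite base_change_liftE -tensorE. Qed.

Lemma tensor2_ind (Q : base_change g (base_change f M) -> Prop) :
  Q 0 -> (forall t s m, Q (tensor g t (tensor f s m))) ->
  (forall u v, Q u -> Q v -> Q (u + v)) -> forall u, Q u.
Proof.
move=> Q0 Qt QD; apply: tensor_ind => // t; apply: tensor_ind => //.
- by rewrite tensor0r.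
- by move=> u v Qu Qv; rewrite tensorDr; apply: QD.
Qed.

Lemma base_change_assocK : cancel base_change_assoc base_change_assoc_inv.
Proof.
apply: tensor2_ind => [|t s m|u v uE vE]; first by rewrite !linear0.
- by rewrite base_change_assocE base_change_assoc_invE -tensorZr tensorZ mulr1.
- by rewrite !linearD uE vE.
Qed.

Lemma base_change_assoc_invK : cancel base_change_assoc_inv base_change_assoc.
Proof.
apply: tensor_ind => [|t m|u v uE vE]; first by rewrite !linear0.
- by rewrite base_change_assoc_invE base_change_assocE rmorph1 mulr1.
- by rewrite !linearD uE vE.
Qed.

Lemma base_change_assoc_bij : bijective base_change_assoc.
Proof. exact: Bijective base_change_assocK base_change_assoc_invK. Qed.

End BaseChangeAssoc.

Lemma sum_pred1_seq (V : nmodType) (I : eqType) (s : seq I) (i0 : I) (F : I -> V) :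
  uniq s -> i0 \in s -> \sum_(i <- s | i == i0) F i = F i0.
Proof.
move=> s_uniq i0s; rewrite big_mkcond (bigD1_seq i0) //= eqxx big1 ?addr0 //.
by move=> i /negPf ->.
Qed.

Section FreeBaseChange.
Variables (R S : comNzRingType) (f : {rmorphism R -> S}) (M : lmodType R).

Lemma coordinate (I : eqType) (b : I -> M) :
    (forall x, exists s : seq (R * I), x = \sum_(p <- s) p.1 *: b p.2) ->
    (forall (s : seq I) (c : I -> R), uniq s ->
       \sum_(i <- s) c i *: b i = 0 -> forall i, i \in s -> c i = 0) ->
  forall i0, exists g : {linear M -> R^o}, forall i, g (b i) = (i == i0)%:R.
Proof.
move=> b_span b_free i0.
pose coord (s : seq (R * I)) i := \sum_(p <- s | p.2 == i) p.1.
have coord0 s : \sum_(p <- s) p.1 *: b p.2 = 0 -> coord s i0 = 0.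
  move=> s0; pose u := undup [seq p.2 | p <- s].
  have [i0u|i0u] := boolP (i0 \in u); last first.
    rewrite /coord big_seq_cond big1 // => p /andP[ps /eqP pi0].
    by case/negP: i0u; rewrite mem_undup -pi0 map_f.
  apply: (b_free u (coord s)) => //; first exact: undup_uniq.
  rewrite -[RHS]s0 /coord; under eq_bigr do rewrite scaler_suml big_mkcond.
  rewrite exchange_big big_seq [RHS]big_seq; apply: eq_bigr => p ps.
  rewrite -big_mkcond /= (eq_bigl (fun i => i == p.2)); last by move=> i; rewrite eq_sym.
  by rewrite sum_pred1_seq ?undup_uniq // mem_undup map_f.
have [rep repE] := choice b_span.
pose scale_rep a (s : seq (R * I)) := [seq (a * p.1, p.2) | p <- s].
have scale_sum a s : \sum_(p <- scale_rep a s) p.1 *: b p.2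
    = a *: \sum_(p <- s) p.1 *: b p.2.
  by rewrite big_map scaler_sumr; apply: eq_bigr => p _; rewrite scalerA.
have scale_coord a s i : coord (scale_rep a s) i = a * coord s i.
  by rewrite /coord big_map mulr_sumr.
have coord_cat s t i : coord (s ++ t) i = coord s i + coord t i by exact: big_cat.
have coord_eq s t : \sum_(p <- s) p.1 *: b p.2 = \sum_(p <- t) p.1 *: b p.2 ->
    coord s i0 = coord t i0.
  move=> st; apply/eqP; rewrite -subr_eq0 -mulN1r -scale_coord -coord_cat.
  by apply/eqP/coord0; rewrite big_cat /= scale_sum st scaleN1r subrr.
have glin : linear (fun x => coord (rep x) i0 : R^o).
  move=> a x y; rewrite /GRing.scale /= -scale_coord -coord_cat; apply: coord_eq.
  by rewrite big_cat /= scale_sum -!repE.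
exists (make_linear glin) => i /=.
rewrite (coord_eq _ [:: (1, i)]); last by rewrite -repE big_seq1 scale1r.
by rewrite /coord big_mkcond big_seq1 /=; case: eqP.
Qed.

Lemma free_base_change : free_module M -> free_module (base_change f M).
Proof.
move=> [I [b [b_span b_free]]].
exists I, (fun i => tensor f 1 (b i)); split=> [|s c s_uniq s0 i0 i0s].
  apply: tensor_ind => [|s m|u v [s uE] [t vE]].
  - by exists [::]; rewrite big_nil.
  - have [t ->] := b_span m.
    exists [seq (s * f p.1, p.2) | p <- t]; rewrite big_map /=.
    elim: t => [|p t IHt]; first by rewrite !big_nil tensor0r.
    by rewrite !big_cons tensorDr IHt tensorZr -tensorE.
  - by exists (s ++ t); rewrite big_cat uE vE.
have [g gE] := coordinate b_span b_free i0.
have fg_lin : @semilinear _ _ f _ S^o (fun m => f (g m)).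
  by move=> a x y; rewrite linearP rmorphD rmorphM.
have := congr1 (base_change_lift fg_lin) s0.
rewrite linear_sum linear0.
rewrite (eq_bigr (fun i => if i == i0 then c i else 0)); last first.
  move=> i _; rewrite tensorZ mulr1 base_change_liftE gE.
  by case: eqP => _; rewrite ?rmorph1 ?rmorph0 /GRing.scale /= ?mulr1 ?mulr0.
by rewrite -big_mkcond sum_pred1_seq.
Qed.

End FreeBaseChange.

(* A left [R (x)_k L]-module is an [R]-module with an [R]-linear left action of
   [L] such that the two induced actions of [k] agree. *)
Record bimodule (k : fieldType) (L : falgType k) (R : comAlgType k) := Bimodule {
  bim_sort :> lmodType R;
  act : L -> bim_sort -> bim_sort;
  act_linear : forall a, linear (act a);
  act_scale : forall c a b x, act (c *: a + b) x = (c%:A : R) *: act a x + act b x;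
  act1 : forall x, act 1 x = x;
  actM : forall a b x, act (a * b) x = act a (act b x) }.
Arguments act {k L R} M a x : rename.

Section Bimodules.
Variables (k : fieldType) (L : falgType k).

Lemma actD (R : comAlgType k) (M : bimodule L R) a (x y : M) :
  act M a (x + y) = act M a x + act M a y.
Proof. exact: (raddfD (make_linear (@act_linear _ _ _ M a))). Qed.

Lemma act0 (R : comAlgType k) (M : bimodule L R) a : act M a 0 = 0.
Proof. exact: (raddf0 (make_linear (@act_linear _ _ _ M a))). Qed.

Lemma actZ (R : comAlgType k) (M : bimodule L R) a r (x : M) :
  act M a (r *: x) = r *: act M a x.
Proof. by rewrite -[r *: x]addr0 act_linear act0 addr0. Qed.

Definition bim_finitely_generated (R : comAlgType k) (M : bimodule L R) : Prop :=
  exists n (g : 'I_n -> M), forall x, exists s : seq (R * L * 'I_n),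
    x = \sum_(p <- s) p.1.1 *: act M p.1.2 (g p.2).

Definition bim_isomorphism (R : comAlgType k) (M N : bimodule L R)
    (h : {linear M -> N}) : Prop :=
  bijective h /\ forall a x, h (act M a x) = act N a (h x).

Definition bim_iso (R : comAlgType k) (M N : bimodule L R) : Prop :=
  exists h : {linear M -> N}, bim_isomorphism h.

Section BaseChange.
Variables (R S : comAlgType k) (f : {lrmorphism R -> S}) (M : bimodule L R).

Definition bc_act (a : L) : {linear base_change f M -> base_change f M} :=
  base_change_map f (make_linear (@act_linear _ _ _ M a)).

Lemma bc_actE a s m : bc_act a (tensor f s m) = tensor f s (act M a m).
Proof. exact: base_change_mapE. Qed.

Lemma bc_act_linear a : linear (bc_act a).
Proof. exact: linearP. Qed.

Lemma bc_act_scale c a b x :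
  bc_act (c *: a + b) x = (c%:A : S) *: bc_act a x + bc_act b x.
Proof.
elim/tensor_ind: x => [|s m|u v uE vE]; first by rewrite !linear0 addr0.
- rewrite !bc_actE act_scale tensorDr tensorZr tensorZ.
  by rewrite [X in s * X](rmorph_alg f c) mulrC.
- by rewrite !linearD uE vE addrACA.
Qed.

Lemma bc_act1 x : bc_act 1 x = x.
Proof.
elim/tensor_ind: x => [|s m|u v uE vE]; first by rewrite linear0.
- by rewrite bc_actE act1.
- by rewrite linearD uE vE.
Qed.

Lemma bc_actM a b x : bc_act (a * b) x = bc_act a (bc_act b x).
Proof.
elim/tensor_ind: x => [|s m|u v uE vE]; first by rewrite !linear0.
- by rewrite !bc_actE actM.
- by rewrite !linearD uE vE.
Qed.

Definition bim_base_change : bimodule L S :=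
  Bimodule bc_act_linear bc_act_scale bc_act1 bc_actM.

Lemma act_tensor a s m :
  act bim_base_change a (tensor f s m) = tensor f s (act M a m).
Proof. exact: bc_actE. Qed.

Lemma bim_fg_base_change :
  bim_finitely_generated M -> bim_finitely_generated bim_base_change.
Proof.
move=> [n [g g_span]]; exists n, (fun i => tensor f 1 (g i)).
apply: tensor_ind => [|s m|u v [s uE] [t vE]].
- by exists [::]; rewrite big_nil.
- have [t ->] := g_span m.
  exists [seq (s * f p.1.1, p.1.2, p.2) | p <- t]; rewrite big_map.
  elim: t => [|p t IHt]; first by rewrite !big_nil tensor0r.
  rewrite !big_cons -IHt tensorDr tensorZr; cbn [fst snd].
  by rewrite act_tensor -tensorE.
- by exists (s ++ t); rewrite big_cat uE vE.
Qed.
End BaseChange.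

Lemma bim_isomorphism_id (R : comAlgType k) (M : bimodule L R) :
  bim_isomorphism (M := M) (N := M) idfun.
Proof. by split=> //; exists idfun. Qed.

Lemma bim_isomorphism_comp (R : comAlgType k) (M N P : bimodule L R)
    (g : {linear N -> P}) (h : {linear M -> N}) :
  bim_isomorphism g -> bim_isomorphism h -> bim_isomorphism (M := M) (N := P) (g \o h).
Proof.
move=> [g_bij gE] [h_bij hE]; split; first exact: bij_comp.
by move=> a x; rewrite /= hE gE.
Qed.

Lemma bim_isomorphism_inv (R : comAlgType k) (M N : bimodule L R) (h : {linear M -> N}) :
  bim_isomorphism h ->
  exists g : {linear N -> M}, [/\ bim_isomorphism g, cancel h g & cancel g h].
Proof.
move=> [[g hK gK] hE].
have g_lin : linear g.
  by move=> a x y; apply: (can_inj hK); rewrite linearP !gK.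
exists (make_linear g_lin); split=> //; split; first by exists h.
by move=> a x; apply: (can_inj hK); rewrite hE /= !gK.
Qed.

Lemma bim_isomorphism_base_change (R S : comAlgType k) (f : {lrmorphism R -> S})
    (M N : bimodule L R) (h : {linear M -> N}) : bim_isomorphism h ->
  bim_isomorphism (M := bim_base_change f M) (N := bim_base_change f N)
    (base_change_map f h).
Proof.
move=> h_iso; have [g [_ hK gK]] := bim_isomorphism_inv h_iso.
case: h_iso => h_bij hE; split.
  exists (base_change_map f g); apply: tensor_ind => [|s m|u v uE vE];
    by rewrite ?linear0 ?base_change_mapE ?hK ?gK // !linearD uE vE.
move=> a; apply: tensor_ind => [|s m|u v uE vE].
- by rewrite act0 !linear0 act0.
- by rewrite act_tensor !base_change_mapE act_tensor hE.
- by rewrite actD !linearD uE vE actD.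
Qed.

Lemma bim_isomorphism_assoc (R S T : comAlgType k) (f : {lrmorphism R -> S})
    (g : {lrmorphism S -> T}) (h : {lrmorphism R -> T})
    (gf : forall x, g (f x) = h x) (M : bimodule L R) :
  bim_isomorphism (M := bim_base_change g (bim_base_change f M))
    (N := bim_base_change h M) (base_change_assoc gf M).
Proof.
split; first exact: base_change_assoc_bij.
move=> a; apply: tensor2_ind => [|t s m|u v uE vE].
- by rewrite act0 !linear0 act0.
- by rewrite !act_tensor !base_change_assocE act_tensor.
- by rewrite actD !linearD uE vE actD.
Qed.

End Bimodules.

Section Deformations.
Variables (k : fieldType) (L : falgType k) (V : lmodType L).
Implicit Types R S T : clnAlg k.

(* [lift_map] is the isomorphism of [L]-modules from [k (x)_R M] to [V]; its
   [k]-linearity follows from [lift_act]. *)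
Record lifting R := Lifting {
  lift_mod :> bimodule L R;
  lift_fg : bim_finitely_generated lift_mod;
  lift_free : free_module lift_mod;
  lift_map : {additive base_change (residue R) lift_mod -> V};
  lift_act : forall a x,
    lift_map (act (bim_base_change (residue R) lift_mod) a x) = a *: lift_map x;
  lift_bij : bijective lift_map }.

Definition lifting_iso R (M N : lifting R) : Prop :=
  exists h : {linear M -> N}, bim_isomorphism h /\
    forall x, lift_map N (base_change_map (residue R) h x) = lift_map M x.

Lemma lifting_iso_refl R (M : lifting R) : lifting_iso M M.
Proof.
exists idfun; split; first exact: bim_isomorphism_id.
apply: tensor_ind => [|s m|u v uE vE]; first by rewrite linear0.
- by rewrite base_change_mapE.
- by rewrite linearD !raddfD uE vE.
Qed.

Lemma lifting_iso_sym R (M N : lifting R) : lifting_iso M N -> lifting_iso N M.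
Proof.
move=> [h [h_iso hE]]; have [g [g_iso hK gK]] := bim_isomorphism_inv h_iso.
exists g; split=> // x; rewrite -hE; congr (lift_map N _).
elim/tensor_ind: x => [|s m|u v uE vE]; first by rewrite !linear0.
- by rewrite !base_change_mapE gK.
- by rewrite !linearD uE vE.
Qed.

Lemma lifting_iso_trans R (M N P : lifting R) :
  lifting_iso M N -> lifting_iso N P -> lifting_iso M P.
Proof.
move=> [h [h_iso hE]] [g [g_iso gE]]; exists (g \o h).
split=> [|x]; first exact: bim_isomorphism_comp.
rewrite -hE -gE; congr (lift_map P _).
elim/tensor_ind: x => [|s m|u v uE vE]; first by rewrite !linear0.
- by rewrite !base_change_mapE.
- by rewrite !linearD uE vE.
Qed.

Section LiftingBaseChange.
Variables (R S : clnAlg k) (f : clnHom R S) (M : lifting R).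

Definition lift_bc_map :
    {additive base_change (residue S) (bim_base_change f M) -> V} :=
  lift_map M \o base_change_assoc (hom_residue f) M.

Lemma lift_bc_act a x :
  lift_bc_map (act (bim_base_change (residue S) (bim_base_change f M)) a x) =
  a *: lift_bc_map x.
Proof.
have [_ E] := bim_isomorphism_assoc (hom_residue f) M.
exact: etrans (congr1 (lift_map M) (E a x)) (lift_act a _).
Qed.

Lemma lift_bc_bij : bijective lift_bc_map.
Proof. exact: bij_comp (lift_bij M) (base_change_assoc_bij _ _). Qed.

Definition lifting_base_change : lifting S :=
  Lifting (bim_fg_base_change f (lift_fg M)) (free_base_change f (lift_free M))
    lift_bc_act lift_bc_bij.

Lemma lift_bc_mapE t s m :
  lift_map lifting_base_change (tensor (residue S) t (tensor f s m)) =
  lift_map M (tensor (residue R) (t * residue S s) m).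
Proof. by rewrite -(base_change_assocE (hom_residue f)). Qed.

End LiftingBaseChange.

Lemma lifting_iso_base_change R S (f : clnHom R S) (M N : lifting R) :
  lifting_iso M N -> lifting_iso (lifting_base_change f M) (lifting_base_change f N).
Proof.
move=> [h [h_iso hE]]; exists (base_change_map f h).
split; first exact: bim_isomorphism_base_change.
apply: tensor2_ind => [|t s m|u v uE vE]; first by rewrite linear0 !raddf0.
- by rewrite !base_change_mapE !lift_bc_mapE -hE base_change_mapE.
- by rewrite linearD !raddfD uE vE.
Qed.

Lemma lifting_base_change_id R (M : lifting R) :
  lifting_iso (lifting_base_change (cln_id R) M) M.
Proof.
have id_lin : semilinear (cln_id R) (fun m : M => m) by [].
pose h : {linear lifting_base_change (cln_id R) M -> M} := base_change_lift id_lin.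
have hE s m : h (tensor (cln_id R) s m) = s *: m by apply: base_change_liftE.
exists h; split; first split.
- exists (tensor (cln_id R) 1) => [|m]; last by rewrite hE scale1r.
  apply: tensor_ind => [|s m|u v uE vE].
  + by rewrite linear0 tensor0r.
  + by rewrite hE tensorZr mul1r.
  + by rewrite linearD tensorDr uE vE.
- move=> a; apply: tensor_ind => [|s m|u v uE vE].
  + by rewrite act0 !linear0 act0.
  + by rewrite act_tensor !hE actZ.
  + by rewrite actD !linearD uE vE actD.
apply: tensor2_ind => [|t s m|u v uE vE]; first by rewrite linear0 !raddf0.
- by rewrite base_change_mapE hE lift_bc_mapE tensorZr.
- by rewrite linearD !raddfD uE vE.
Qed.

Lemma lifting_base_change_comp R S T (f : clnHom R S) (g : clnHom S T) (M : lifting R) :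
  lifting_iso (lifting_base_change g (lifting_base_change f M))
    (lifting_base_change (cln_comp g f) M).
Proof.
pose gf x : g (f x) = cln_comp g f x := erefl.
exists (base_change_assoc gf M); split; first exact: bim_isomorphism_assoc.
apply: tensor_ind => [|c|u v uE vE]; first by rewrite linear0 !raddf0.
- apply: tensor2_ind => [|t s m|u v uE vE].
  + by rewrite tensor0r linear0 !raddf0.
  + rewrite base_change_mapE base_change_assocE !lift_bc_mapE.
    congr (lift_map M (tensor _ _ m)); rewrite rmorphM -mulrA.
    by congr (_ * (_ * _)); apply: hom_residue.
  + by rewrite tensorDr linearD !raddfD uE vE.
- by rewrite linearD !raddfD uE vE.
Qed.

(* Sets of liftings which are isomorphism classes. *)
Definition deformation R : Type :=
  {C : lifting R -> Prop | exists M, C = lifting_iso M}.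

Definition deformation_of R (M : lifting R) : deformation R :=
  exist _ (lifting_iso M) (ex_intro _ M erefl).

Definition deformation_base_change_set R S (f : clnHom R S)
    (C : lifting R -> Prop) : lifting S -> Prop :=
  fun N => exists2 M, C M & lifting_iso (lifting_base_change f M) N.

Lemma deformation_base_change_setE R S (f : clnHom R S) (M : lifting R) :
  deformation_base_change_set f (lifting_iso M) = lifting_iso (lifting_base_change f M).
Proof.
apply/funext => N; apply/propext; split; last by exists M => //; apply: lifting_iso_refl.
by move=> [M' /(lifting_iso_base_change f)]; apply: lifting_iso_trans.
Qed.

Lemma deformation_base_change_subproof R S (f : clnHom R S) (x : deformation R) :
  exists N, deformation_base_change_set f (sval x) = lifting_iso N.
Proof.
have [M ->] := svalP x; exists (lifting_base_change f M).
exact: deformation_base_change_setE.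
Qed.

Definition deformation_base_change R S (f : clnHom R S) (x : deformation R) :
    deformation S :=
  exist _ (deformation_base_change_set f (sval x)) (deformation_base_change_subproof f x).

Lemma deformationP R (x y : deformation R) : sval x = sval y -> x = y.
Proof.
by case: x y => [C p] [D q] /= CD; case: _ / CD q => q; rewrite (Prop_irrelevance p q).
Qed.

Lemma deformation_ofP R (M N : lifting R) :
  deformation_of M = deformation_of N <-> lifting_iso M N.
Proof.
split=> [/(congr1 sval) /= ->|MN]; first exact: lifting_iso_refl.
apply: deformationP; apply/funext => P; apply/propext; split.
- exact/lifting_iso_trans/lifting_iso_sym.
- exact: lifting_iso_trans.
Qed.

Lemma deformation_ind R (Q : deformation R -> Prop) :
  (forall M, Q (deformation_of M)) -> forall x, Q x.
Proof.
move=> QM x; have [M xM] := svalP x.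
by have -> : x = deformation_of M by apply: deformationP.
Qed.

Lemma deformation_base_changeE R S (f : clnHom R S) (M : lifting R) :
  deformation_base_change f (deformation_of M) = deformation_of (lifting_base_change f M).
Proof. by apply: deformationP; apply: deformation_base_change_setE. Qed.

Lemma deformation_base_change_id R (x : deformation R) :
  deformation_base_change (cln_id R) x = x.
Proof.
elim/deformation_ind: x => M; rewrite deformation_base_changeE.
exact/deformation_ofP/lifting_base_change_id.
Qed.

Lemma deformation_base_change_comp R S T (f : clnHom R S) (g : clnHom S T)
    (x : deformation R) :
  deformation_base_change (cln_comp g f) x =
  deformation_base_change g (deformation_base_change f x).
Proof.
elim/deformation_ind: x => M; rewrite !deformation_base_changeE.
exact/deformation_ofP/lifting_iso_sym/lifting_base_change_comp.
Qed.

Definition deformation_functor : functor k :=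
  Functor deformation_base_change_id deformation_base_change_comp.

Lemma bim_iso_refl R (M : bimodule L R) : bim_iso M M.
Proof. by exists idfun; apply: bim_isomorphism_id. Qed.

Lemma bim_iso_sym R (M N : bimodule L R) : bim_iso M N -> bim_iso N M.
Proof. by move=> [h /bim_isomorphism_inv [g [g_iso _ _]]]; exists g. Qed.

Lemma bim_iso_trans R (M N P : bimodule L R) :
  bim_iso M N -> bim_iso N P -> bim_iso M P.
Proof.
by move=> [h h_iso] [g g_iso]; exists (g \o h); apply: bim_isomorphism_comp.
Qed.

Definition weak_deformation R : Type :=
  {C : bimodule L R -> Prop | exists M : lifting R, C = bim_iso M}.

Definition weak_deformation_of R (M : lifting R) : weak_deformation R :=
  exist _ (bim_iso M) (ex_intro _ M erefl).

Definition weak_base_change_set R S (f : clnHom R S)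
    (C : bimodule L R -> Prop) : bimodule L S -> Prop :=
  fun N => exists2 M, C M & bim_iso (bim_base_change f M) N.

Lemma weak_base_change_setE R S (f : clnHom R S) (M : bimodule L R) :
  weak_base_change_set f (bim_iso M) = bim_iso (bim_base_change f M).
Proof.
apply/funext => N; apply/propext; split; last by exists M => //; apply: bim_iso_refl.
move=> [M' [h h_iso]]; apply: bim_iso_trans.
by exists (base_change_map f h); apply: bim_isomorphism_base_change.
Qed.

Lemma weak_base_change_subproof R S (f : clnHom R S) (x : weak_deformation R) :
  exists N : lifting S, weak_base_change_set f (sval x) = bim_iso N.
Proof.
have [M ->] := svalP x; exists (lifting_base_change f M).
exact: weak_base_change_setE.
Qed.

Definition weak_base_change R S (f : clnHom R S) (x : weak_deformation R) :
    weak_deformation S :=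
  exist _ (weak_base_change_set f (sval x)) (weak_base_change_subproof f x).

Lemma weak_deformationP R (x y : weak_deformation R) : sval x = sval y -> x = y.
Proof.
by case: x y => [C p] [D q] /= CD; case: _ / CD q => q; rewrite (Prop_irrelevance p q).
Qed.

Lemma weak_deformation_ofP R (M N : lifting R) :
  weak_deformation_of M = weak_deformation_of N <-> bim_iso M N.
Proof.
split=> [/(congr1 sval) /= ->|MN]; first exact: bim_iso_refl.
apply: weak_deformationP; apply/funext => P; apply/propext; split.
- exact/bim_iso_trans/bim_iso_sym.
- exact: bim_iso_trans.
Qed.

Lemma weak_deformation_ind R (Q : weak_deformation R -> Prop) :
  (forall M, Q (weak_deformation_of M)) -> forall x, Q x.
Proof.
move=> QM x; have [M xM] := svalP x.
by have -> : x = weak_deformation_of M by apply: weak_deformationP.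
Qed.

Lemma weak_base_changeE R S (f : clnHom R S) (M : lifting R) :
  weak_base_change f (weak_deformation_of M) =
  weak_deformation_of (lifting_base_change f M).
Proof. by apply: weak_deformationP; apply: weak_base_change_setE. Qed.

Lemma weak_base_change_id R (x : weak_deformation R) :
  weak_base_change (cln_id R) x = x.
Proof.
elim/weak_deformation_ind: x => M; rewrite weak_base_changeE.
by apply/weak_deformation_ofP; have [h [? _]] := lifting_base_change_id M; exists h.
Qed.

Lemma weak_base_change_comp R S T (f : clnHom R S) (g : clnHom S T)
    (x : weak_deformation R) :
  weak_base_change (cln_comp g f) x = weak_base_change g (weak_base_change f x).
Proof.
elim/weak_deformation_ind: x => M; rewrite !weak_base_changeE.
apply/weak_deformation_ofP/bim_iso_sym.
by have [h [? _]] := lifting_base_change_comp f g M; exists h.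
Qed.

Definition weak_deformation_functor : functor k :=
  Functor weak_base_change_id weak_base_change_comp.

Definition universal_deformation_ring R : Prop :=
  naturally_isomorphic deformation_functor (hom_functor R).

End Deformations.

(* Main.v *)
(* In k-bases a lift of V over R is a representation of L by matrices over R
   reducing to a fixed one over k, and deformations are such representations
   modulo conjugation by matrices congruent to 1.

   The tool for all parts is averaging.  A finitely generated projective module
   over a self-injective algebra is both a direct summand of L (x)_k P and of
   Hom_k(L, P); the matrices of a splitting remain a splitting over every R, and
   turn an arbitrary R-linear map from (or to) such a module into an L-linear
   one, fixing the maps that are L-linear already.  Hence L-linear maps to and
   from P lift along R -> k.  As an endomorphism of V is a scalar plus a map
   factoring through a projective, every endomorphism of V lifts to every lift
   of V, which gives (i).

   For (ii), choose a generalized inverse W of the differential D of conjugation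
   at V.  Each lift is conjugate to one in the slice D W = 0 by successive
   approximation, and to only one because the endomorphisms of V lift.  The
   slice is given by polynomial equations, so it is represented by a quotient of
   a power series ring; dividing by the closure of the ideal of equations makes
   completeness of the quotient immediate, without Krull's intersection theorem.

   For (iii) and (iv) the correspondences M |-> M (+) P_R and
   0 -> N -> P_R -> M -> 0 are shown to be bijective on deformations, where P_R is
   the unique lift of P; Yoneda then identifies the representing rings. *)

Require Import Defs.
From HB Require Import structures.
From mathcomp Require Import all_boot all_algebra all_field.
From mathcomp Require Import boolp.

Set Implicit Arguments.
Unset Strict Implicit.
Unset Printing Implicit Defensive.

Import GRing.Theory.
Local Open Scope ring_scope.
Local Open Scope quotient_scope.

(** * Complete local algebras *)

(** Averaging needs two kinds of matrices: those of a section of L (x)_k P -> P make maps out of P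
    L-linear, those of a retraction of Hom_k(L, P) make maps into P L-linear. An endomorphism of V
    that factors through P uses both, one for each factor. The obstacle in (ii) is uniqueness in the
    slice. A conjugation g = 1 mod m between two points r and s of the slice need not be the
    identity, since automorphisms of r are always left over. The slice controls only the W D
    component of a matrix, so g is first composed with an endomorphism of r to reach the form 1 + c
    with c = W D c; that r has enough endomorphisms is the property [endo_lifting], the only trace
    of the stable endomorphism ring in (i) and (ii). D and W are given by matrices over k. They
    therefore commute with every homomorphism R -> S, and the slice is functorial. In (iii) and (iv)
    an averaged map agrees with the intended block inclusion or projection only modulo m.
    Conjugation by a matrix congruent to 1 makes the two equal, after which sub- and quotient
    representations are blocks. *)

Section IdealPowers.
Variables (R : comNzRingType) (I : R -> Prop).
Hypothesis I_ideal : is_ideal I.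

Lemma ideal_pow_elim n (Q : R -> Prop) :
  Q 0 -> (forall x y, Q x -> Q y -> Q (x + y)) ->
  (forall c (y : 'I_n -> R), (forall j, I (y j)) -> Q (c * \prod_j y j)) ->
  forall x, ideal_pow I n x -> Q x.
Proof.
move=> Q0 QD QM x [m [c [y [Iy ->]]]].
by apply: big_ind => // i _; apply: QM.
Qed.

Lemma ideal_pow_gen n c (y : 'I_n -> R) :
  (forall j, I (y j)) -> ideal_pow I n (c * \prod_j y j).
Proof.
by move=> Iy; exists 1%N, (fun=> c), (fun=> y); split=> //; rewrite big_ord1.
Qed.

Lemma ideal_pow_zero n : ideal_pow I n 0.
Proof.
exists 0%N, (fun=> 0), (fun _ _ => 0); split; last by rewrite big_ord0.
by case.
Qed.

Lemma ideal_pow_add n x y :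
  ideal_pow I n x -> ideal_pow I n y -> ideal_pow I n (x + y).
Proof.
move=> [m [c [u [Iu ->]]]] [l [d [v [Iv ->]]]].
exists (m + l)%N, (fun i => match split i with inl j => c j | inr j => d j end).
exists (fun i => match split i with inl j => u j | inr j => v j end).
split=> [i j|]; first by case: (split i).
rewrite big_split_ord /=; congr (_ + _); apply: eq_bigr => i _.
  by rewrite -[lshift l i]/(unsplit (inl i)) unsplitK.
by rewrite -[rshift m i]/(unsplit (inr i)) unsplitK.
Qed.

Lemma ideal_pow_mulr n a x : ideal_pow I n x -> ideal_pow I n (a * x).
Proof.
move: x; apply: ideal_pow_elim => [|x y|c y Iy].
- by rewrite mulr0; apply: ideal_pow_zero.
- by rewrite mulrDr; apply: ideal_pow_add.
- by rewrite mulrA; apply: ideal_pow_gen.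
Qed.

Lemma ideal_pow_opp n x : ideal_pow I n x -> ideal_pow I n (- x).
Proof. by rewrite -mulN1r; apply: ideal_pow_mulr. Qed.

Lemma ideal_pow_sub n x y :
  ideal_pow I n x -> ideal_pow I n y -> ideal_pow I n (x - y).
Proof. by move=> Ix /ideal_pow_opp; apply: ideal_pow_add. Qed.

Lemma ideal_pow_sum n (J : Type) (s : seq J) (P : pred J) (F : J -> R) :
  (forall i, P i -> ideal_pow I n (F i)) -> ideal_pow I n (\sum_(i <- s | P i) F i).
Proof.
move=> IF; apply: big_ind => //; first exact: ideal_pow_zero.
exact: ideal_pow_add.
Qed.

Lemma ideal_pow0 x : ideal_pow I 0 x.
Proof.
have /(ideal_pow_gen x) : forall j : 'I_0, I ((fun=> 0) j) by case.
by rewrite big_ord0 mulr1.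
Qed.

Lemma ideal_pow1 x : ideal_pow I 1 x <-> I x.
Proof.
have [I0 ID IM] := I_ideal; split=> [|Ix].
  by move: x; apply: ideal_pow_elim => // c y Iy; rewrite big_ord1; apply: IM.
by have := @ideal_pow_gen 1 1 (fun=> x) (fun=> Ix); rewrite big_ord1 mul1r.
Qed.

Lemma ideal_powM m n x y :
  ideal_pow I m x -> ideal_pow I n y -> ideal_pow I (m + n) (x * y).
Proof.
move=> Ix Iy; move: x Ix; apply: ideal_pow_elim => [|x z Ix Iz|c u Iu].
- by rewrite mul0r; apply: ideal_pow_zero.
- by rewrite mulrDl; apply: ideal_pow_add.
move: y Iy; apply: ideal_pow_elim => [|x z Ix Iz|d v Iv].
- by rewrite mulr0; apply: ideal_pow_zero.
- by rewrite mulrDr; apply: ideal_pow_add.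
rewrite mulrACA; pose w i := match split i with inl j => u j | inr j => v j end.
have -> : \prod_j u j * \prod_j v j = \prod_i w i.
  rewrite big_split_ord; congr (_ * _); apply: eq_bigr => i _; rewrite /w.
    by rewrite -[lshift n i]/(unsplit (inl i)) unsplitK.
  by rewrite -[rshift m i]/(unsplit (inr i)) unsplitK.
by apply: ideal_pow_gen => i; rewrite /w; case: (split i).
Qed.

Lemma ideal_pow_le m n x : (m <= n)%N -> ideal_pow I n x -> ideal_pow I m x.
Proof.
move=> /subnKC <-; move: x; apply: ideal_pow_elim => [|x y Ix Iy|c y Iy].
- exact: ideal_pow_zero.
- exact: ideal_pow_add.
- by rewrite big_split_ord mulrCA mulrC; apply: ideal_pow_gen.
Qed.

Lemma ideal_pow_exp n x : I x -> ideal_pow I n (x ^+ n).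
Proof.
by move=> Ix; have := @ideal_pow_gen n 1 (fun=> x) (fun=> Ix); rewrite prodr_const card_ord mul1r.
Qed.

End IdealPowers.

Lemma ideal_pow_map (R S : comNzRingType) (I : R -> Prop) (J : S -> Prop)
    (f : {rmorphism R -> S}) n x :
  (forall x, I x -> J (f x)) -> ideal_pow I n x -> ideal_pow J n (f x).
Proof.
move=> IJ; move: x; apply: ideal_pow_elim => [|x y Ix Iy|c y Iy].
- by rewrite rmorph0; apply: ideal_pow_zero.
- by rewrite rmorphD; apply: ideal_pow_add.
- by rewrite rmorphM rmorph_prod; apply: ideal_pow_gen => j; apply: IJ.
Qed.

Section Local.
Variables (k : fieldType) (A : comAlgType k) (res : {lrmorphism A -> k^o}).
Let m : A -> Prop := fun x => res x = 0.

Lemma residue_alg c : res c%:A = c.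
Proof. by rewrite rmorph_alg /= /GRing.scale /= mulr1. Qed.

Lemma residue_ideal : is_ideal m.
Proof.
rewrite /m; split=> [|x y x0 y0|a x x0]; first by rewrite rmorph0.
  by rewrite (rmorphD res) /= x0 y0 addr0.
by rewrite (rmorphM res) /= x0 mulr0.
Qed.

Hypothesis A_complete : adically_complete m.

(** Up to a scalar, [x] is 1 - z with z in m. The geometric series of z converges by completeness,
    and separatedness turns the approximate inverses into an exact one. *)
Lemma complete_unit x : res x <> 0 -> exists y, x * y = 1.
Proof.
move=> x0; have cx0 : res x != 0 by apply/eqP.
have ideal_m := residue_ideal.
pose z := 1 - (res x)^-1%:A * x.
have mz : m z by rewrite /m (rmorphB res) (rmorphM res) (rmorph1 res) /= residue_alg mulVf // subrr.
pose u n := \sum_(i < n) z ^+ i.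
have uE n : (1 - z) * u n = 1 - z ^+ n.
  by rewrite -[z in LHS]opprK opprK -{1}[1 - z]opprB mulNr -subrX1 opprB.
have [|y yE] := A_complete.2 u.
  by move=> n; rewrite /u big_ord_recr /= addrAC subrr add0r; apply: ideal_pow_exp.
exists ((res x)^-1%:A * y); rewrite mulrCA mulrA.
have -> : (res x)^-1%:A * x = 1 - z by rewrite subKr.
apply/subr0_eq/A_complete.1 => n.
have -> : (1 - z) * y - 1 = (1 - z) * (y - u n) - z ^+ n.
  by rewrite mulrBr uE -addrA; congr (_ + _); rewrite opprB addrAC subrr add0r.
by apply: ideal_pow_sub; [apply: ideal_pow_mulr | apply: ideal_pow_exp].
Qed.

(** Everything outside m is a unit, so m contains every proper ideal. Hence power series rings and
    quotients below only have to be shown complete and noetherian. *)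
Lemma complete_local : unique_maximal_ideal m.
Proof.
have ideal_m := residue_ideal.
have proper_sub (J : A -> Prop) : is_ideal J -> ~ J 1 -> forall x, J x -> m x.
  move=> [J0 JD JM] J1 x Jx; apply: contrapT => /complete_unit [y xy].
  by apply: J1; rewrite -xy mulrC; apply: JM.
have m1 : ~ m 1 by rewrite /m rmorph1 => /eqP; rewrite oner_eq0.
split; first by split=> // J J_ideal _ J1; apply: proper_sub.
move=> J [J_ideal J1 J_max] x; split; first exact: proper_sub.
by apply: J_max => // y; apply: proper_sub.
Qed.

Definition complete_cln (A_noeth : noetherian A) : clnAlg k :=
  ClnAlg complete_local A_noeth A_complete.
End Local.

Section ClnFacts.
Variable k : fieldType.
Implicit Types R S : clnAlg k.

Definition pw R n : R -> Prop := ideal_pow (@max_ideal k R) n.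

Lemma pw1 R (x : R) : pw 1 x <-> residue R x = 0.
Proof. exact/ideal_pow1/residue_ideal. Qed.

Lemma pw0 R (x : R) : pw 0 x. Proof. exact: ideal_pow0. Qed.
Lemma pw_zero R n : pw n (0 : R). Proof. exact: ideal_pow_zero. Qed.
Lemma pwD R n (x y : R) : pw n x -> pw n y -> pw n (x + y).
Proof. exact: ideal_pow_add. Qed.
Lemma pwN R n (x : R) : pw n x -> pw n (- x).
Proof. exact: ideal_pow_opp. Qed.
Lemma pwB R n (x y : R) : pw n x -> pw n y -> pw n (x - y).
Proof. exact: ideal_pow_sub. Qed.
Lemma pwMl R n (a x : R) : pw n x -> pw n (a * x).
Proof. exact: ideal_pow_mulr. Qed.
Lemma pwM R m n (x y : R) : pw m x -> pw n y -> pw (m + n) (x * y).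
Proof. exact: ideal_powM. Qed.
Lemma pw_le R m n (x : R) : (m <= n)%N -> pw n x -> pw m x.
Proof. exact: ideal_pow_le. Qed.
Lemma pw_sum R n (J : Type) (s : seq J) (P : pred J) (F : J -> R) :
  (forall i, P i -> pw n (F i)) -> pw n (\sum_(i <- s | P i) F i).
Proof. exact: ideal_pow_sum. Qed.
Lemma pw_exp R n (x : R) : residue R x = 0 -> pw n (x ^+ n).
Proof. exact: ideal_pow_exp. Qed.

Lemma pw_eq0 R (x : R) : (forall n, pw n x) -> x = 0.
Proof. exact: (@cln_complete k R).1. Qed.

Lemma pw_lim R (u : nat -> R) : (forall n, pw n (u n.+1 - u n)) ->
  exists x, forall n, pw n (x - u n).
Proof. exact: (@cln_complete k R).2. Qed.

Lemma pw_hom R S (f : {lrmorphism R -> S}) :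
  (forall x, residue S (f x) = residue R x) ->
  forall n x, pw n x -> pw n (f x).
Proof. by move=> fr n x; apply: ideal_pow_map => y; rewrite /max_ideal fr. Qed.

(** Preserving residues means mapping m into m, hence m^n into m^n: the modulus of continuity is n
    itself. *)
Lemma local_hom_continuous R S (f : {lrmorphism R -> S}) :
  (forall x, residue S (f x) = residue R x) ->
  forall n, exists m, forall x,
  ideal_pow (@max_ideal k R) m x -> ideal_pow (@max_ideal k S) n (f x).
Proof. by move=> fr n; exists n => x; apply: pw_hom. Qed.

Definition local_hom R S (f : {lrmorphism R -> S})
    (fr : forall x, residue S (f x) = residue R x) : clnHom R S :=
  ClnHom fr (local_hom_continuous fr).

Lemma hom_pw R S (f : clnHom R S) n x : pw n x -> pw n (f x).
Proof. exact/pw_hom/hom_residue. Qed.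
End ClnFacts.

(** * Power series *)

(** A wrapper that keeps the Cauchy product apart from operations on plain functions. *)
Record powser (B : Type) := Powser { pscoef :> nat -> B }.

Lemma powserP (B : Type) (f g : powser B) : (forall i, f i = g i) -> f = g.
Proof. by case: f g => f [g] /= fg; congr Powser; apply/funext. Qed.

HB.instance Definition _ (B : Type) := gen_eqMixin (powser B).
HB.instance Definition _ (B : Type) := gen_choiceMixin (powser B).

Section PowserRing.
Variable B : comNzRingType.
Implicit Types f g h : powser B.

Definition ps_zero : powser B := Powser (fun=> 0).
Definition ps_add f g : powser B := Powser (fun i => f i + g i).
Definition ps_opp f : powser B := Powser (fun i => - f i).

Lemma ps_addA : associative ps_add.
Proof. by move=> f g h; apply: powserP => i /=; rewrite addrA. Qed.
Lemma ps_addC : commutative ps_add.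
Proof. by move=> f g; apply: powserP => i /=; rewrite addrC. Qed.
Lemma ps_add0 : left_id ps_zero ps_add.
Proof. by move=> f; apply: powserP => i /=; rewrite add0r. Qed.
Lemma ps_addN : left_inverse ps_zero ps_opp ps_add.
Proof. by move=> f; apply: powserP => i /=; rewrite addNr. Qed.

HB.instance Definition _ :=
  GRing.isZmodule.Build (powser B) ps_addA ps_addC ps_add0 ps_addN.

Definition ps_trunc n f : {poly B} := \poly_(i < n) f i.
Definition ps_const b : powser B := Powser (fun i => if i is 0%N then b else 0).
Definition ps_mul f g : powser B :=
  Powser (fun n => \sum_(i < n.+1) f i * g (n - i)%N).

(** A coefficient of a product only sees truncations of the factors, so the ring laws are inherited
    from [{poly B}]. *)
Lemma ps_mulE N n f g : (n < N)%N ->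
  ps_mul f g n = (ps_trunc N f * ps_trunc N g)`_n.
Proof.
move=> nN; rewrite coefM; apply: eq_bigr => i _.
by rewrite !coef_poly !(leq_ltn_trans _ nN) ?leq_subr // -ltnS.
Qed.

Lemma coefM_congr n (p q r : {poly B}) :
  (forall i, (i <= n)%N -> p`_i = q`_i) -> (p * r)`_n = (q * r)`_n.
Proof.
by move=> pq; rewrite !coefM; apply: eq_bigr => i _; rewrite pq // -ltnS.
Qed.

Lemma ps_mulC : commutative ps_mul.
Proof. by move=> f g; apply: powserP => n; rewrite !(ps_mulE _ _ (ltnSn n)) mulrC. Qed.

Lemma ps_mulA : associative ps_mul.
Proof.
move=> f g h; apply: powserP => n; rewrite ps_mulC !(ps_mulE _ _ (ltnSn n)).
transitivity ((ps_trunc n.+1 f * ps_trunc n.+1 g * ps_trunc n.+1 h)`_n).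
  rewrite -mulrA [in RHS]mulrC; apply: coefM_congr => i ni.
  by rewrite coef_poly ltnS ni (ps_mulE _ _ (N := n.+1)).
apply: coefM_congr => i ni.
by rewrite coef_poly ltnS ni (ps_mulE _ _ (N := n.+1)).
Qed.

Lemma ps_1mul : left_id (ps_const 1) ps_mul.
Proof.
move=> f; apply: powserP => n /=; rewrite big_ord_recl mul1r subn0 big1 ?addr0 //.
by move=> i _; rewrite mul0r.
Qed.

Lemma ps_mulDl : left_distributive ps_mul ps_add.
Proof.
move=> f g h; apply: powserP => n /=; rewrite -big_split.
by apply: eq_bigr => i _; rewrite mulrDl.
Qed.

Lemma ps_1neq0 : ps_const 1 != 0.
Proof. by apply/eqP => /(congr1 (fun f : powser B => f 0%N)) /eqP; rewrite oner_eq0. Qed.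

HB.instance Definition _ := GRing.Zmodule_isComNzRing.Build (powser B)
  ps_mulA ps_mulC ps_1mul ps_mulDl ps_1neq0.

Lemma psD f g i : (f + g) i = f i + g i. Proof. by []. Qed.
Lemma psN f i : (- f) i = - f i. Proof. by []. Qed.
Lemma ps0 i : (0 : powser B) i = 0. Proof. by []. Qed.
Lemma psM f g n : (f * g) n = \sum_(i < n.+1) f i * g (n - i)%N. Proof. by []. Qed.

Lemma ps_sum (J : Type) (s : seq J) (P : pred J) (F : J -> powser B) i :
  (\sum_(j <- s | P j) F j) i = \sum_(j <- s | P j) F j i.
Proof. by elim/big_rec2: _ => // j x y _ <-. Qed.

Lemma ps_trunc_coef n f i : (i < n)%N -> (ps_trunc n f)`_i = f i.
Proof. by move=> ni; rewrite coef_poly ni. Qed.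

Lemma ps_constM b f i : (ps_const b * f) i = b * f i.
Proof.
rewrite psM big_ord_recl /= subn0 big1 ?addr0 // => j _; exact: mul0r.
Qed.

Definition ps_X : powser B := Powser (fun i => (i == 1)%:R).

Lemma ps_XM f i : (ps_X * f) i = if i is j.+1 then f j else 0.
Proof.
rewrite psM big_ord_recl mul0r add0r; case: i => [|i]; first by rewrite big_ord0.
rewrite big_ord_recl /= mul1r subSS subn0 big1 ?addr0 // => j _; exact: mul0r.
Qed.

Lemma ps_XnM n f i : (ps_X ^+ n * f) i = if (n <= i)%N then f (i - n)%N else 0.
Proof.
elim: n i => [|n IHn] i; first by rewrite expr0 mul1r subn0.
by rewrite exprS -mulrA ps_XM; case: i => // i; rewrite IHn.
Qed.

(** Reduces statements about series modulo X^n, or modulo a power of the maximal ideal, to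
    polynomials. *)
Lemma ps_split n f :
  exists g, f = \sum_(i < n) ps_const (f i) * ps_X ^+ i + ps_X ^+ n * g.
Proof.
exists (Powser (fun i => f (i + n)%N)); apply: powserP => i.
rewrite psD ps_sum ps_XnM /=.
have E (j : 'I_n) : (ps_const (f j) * ps_X ^+ j) i = if j == i :> nat then f i else 0.
  rewrite mulrC ps_XnM /=; have [ji|ij|->] := ltngtP j i; last by rewrite subnn.
    by rewrite -(subnSK ji).
  by [].
rewrite (eq_bigr _ (fun j _ => E j)); case: leqP => [ni|ni].
  rewrite big1 ?add0r ?subnK // => j _; case: eqP => // ji.
  by move: (ltn_ord j); rewrite ji ltnNge ni.
by rewrite (bigD1 (Ordinal ni)) //= eqxx big1 ?addr0 // => j /negPf; rewrite -val_eqE /= => ->.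
Qed.

End PowserRing.

(** * Finite generation of ideals, and Hilbert's basis theorem for power series *)

Section Noetherian.

(** The coefficients are indexed by [nat], so that concatenating lists requires no casts between
    ordinals. *)
Definition lspan (R : comNzRingType) (s : seq R) (x : R) : Prop :=
  exists c : nat -> R, x = \sum_(i < size s) c i * s`_i.

Variable R : comNzRingType.
Implicit Types (s t : seq R) (I : R -> Prop).

Lemma span_cat s t x y : lspan s x -> lspan t y -> lspan (s ++ t) (x + y).
Proof.
move=> [c ->] [d ->]; exists (fun i => if (i < size s)%N then c i else d (i - size s)%N).
rewrite size_cat big_split_ord /=; congr (_ + _); apply: eq_bigr => i _.
  by rewrite ltn_ord nth_cat ltn_ord.
by rewrite nth_cat ltnNge leq_addr /= addKn.
Qed.

Lemma ideal_sum I (J : Type) (s : seq J) (P : pred J) (F : J -> R) : is_ideal I ->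
  (forall i, P i -> I (F i)) -> I (\sum_(i <- s | P i) F i).
Proof. by move=> [I0 ID _] IF; apply: big_ind. Qed.

Lemma span_sub I s x : is_ideal I -> (forall i, (i < size s)%N -> I s`_i) ->
  lspan s x -> I x.
Proof.
move=> I_ideal Is [c ->]; apply: ideal_sum => // i _.
by case: I_ideal => _ _ IM; apply: IM; apply: Is.
Qed.

Lemma noetherian_span I : noetherian R -> is_ideal I ->
  exists s, (forall i, (i < size s)%N -> I s`_i) /\ forall x, I x -> lspan s x.
Proof.
move=> R_noeth I_ideal; have [n [g gE]] := R_noeth I I_ideal.
exists [seq g i | i <- enum 'I_n]; rewrite size_map size_enum_ord.
split=> [i ni|x /gE [c ->]].
  rewrite (nth_map (Ordinal ni)) ?size_enum_ord //; apply/gE.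
  exists (fun j => (j == nth (Ordinal ni) (enum 'I_n) i)%:R).
  rewrite (bigD1 (nth (Ordinal ni) (enum 'I_n) i)) //= eqxx mul1r big1 ?addr0 //.
  by move=> j /negPf ->; rewrite mul0r.
exists (fun i => oapp c 0 (insub i)); rewrite size_map size_enum_ord.
apply: eq_bigr => i _; rewrite valK /= (nth_map i) ?size_enum_ord //.
by rewrite nth_ord_enum.
Qed.

Lemma span_noetherian :
  (forall I, is_ideal I ->
    exists s, (forall i, (i < size s)%N -> I s`_i) /\ forall x, I x -> lspan s x) ->
  noetherian R.
Proof.
move=> R_span I I_ideal; have [s [sI s_span]] := R_span I I_ideal.
exists (size s), (fun i => s`_i) => x; split=> [/s_span [c ->]|[c ->]].
  by exists (fun i => c i).
by apply: ideal_sum => // i _; case: I_ideal => _ _ IM; apply: IM; apply: sI.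
Qed.

(** The union of the chain is an ideal with finitely many generators; the chain is stationary from
    the largest of the indices at which these appear. *)
Lemma noetherian_chain (I : nat -> R -> Prop) : noetherian R ->
  (forall n, is_ideal (I n)) -> (forall n x, I n x -> I n.+1 x) ->
  exists D, forall n x, I n x -> I D x.
Proof.
move=> R_noeth I_ideal IS.
have I_le m n x : (m <= n)%N -> I m x -> I n x.
  by move=> /subnKC <- Ix; elim: (n - m)%N => [|d IHd]; rewrite ?addn0 ?addnS //; apply: IS.
have U_ideal : is_ideal (fun x => exists n, I n x).
  split=> [|x y [m Ix] [n Iy]|a x [n Ix]].
  - by exists 0%N; case: (I_ideal 0%N).
  - exists (maxn m n); case: (I_ideal (maxn m n)) => _ ID _.
    by apply: ID; [apply: I_le Ix; apply: leq_maxl | apply: I_le Iy; apply: leq_maxr].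
  - by exists n; case: (I_ideal n) => _ _ IM; apply: IM.
have [s [sU s_span]] := noetherian_span R_noeth U_ideal.
have [d dE] : {d : nat -> nat & forall i, (i < size s)%N -> I (d i) s`_i}.
  apply: (choice (P := fun i n => (i < size s)%N -> I n s`_i)) => i.
  case: (ltnP i (size s)) => [/sU [n ?]|_]; first by exists n.
  by exists 0%N.
exists (\max_(i < size s) d i) => n x Ix.
apply: span_sub (I_ideal _) _ (s_span x _) => [i si|]; last by exists n.
exact: I_le (leq_bigmax (Ordinal si)) (dE i si).
Qed.

End Noetherian.

(* The ideals of leading (that is, lowest) coefficients stabilize at some order
   [D]; below [D] finitely many generators of each of them are needed, and above
   [D] the generators of order [D] suffice, with power series as coefficients. *)
Section PowserNoetherian.
Variable B : comNzRingType.
Hypothesis B_noeth : noetherian B.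
Variable I : powser B -> Prop.
Hypothesis I_ideal : is_ideal I.

Let order d (f : powser B) := forall i, (i < d)%N -> f i = 0.
Let lead d b := exists f, [/\ I f, order d f & f d = b].

Let I0 : I 0. Proof. by case: I_ideal. Qed.
Let ID f g : I f -> I g -> I (f + g). Proof. by case: I_ideal => _ H _; apply: H. Qed.
Let IM f g : I g -> I (f * g). Proof. by case: I_ideal => _ _ H; apply: H. Qed.
Let IB f g : I f -> I g -> I (f - g).
Proof. by move=> If Ig; apply: ID => //; rewrite -mulN1r; apply: IM. Qed.

Lemma lead_ideal d : is_ideal (lead d).
Proof.
split=> [|_ _ [f [If f0 <-]] [g [Ig g0 <-]]|a _ [f [If f0 <-]]].
- by exists 0.
- exists (f + g); split=> [||//]; first exact: ID.
  by move=> i id; rewrite psD f0 ?g0 ?addr0.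
- exists (ps_const a * f); split=> [||]; first exact: IM.
    by move=> i id; rewrite ps_constM f0 ?mulr0.
  by rewrite ps_constM.
Qed.

Lemma lead_succ d b : lead d b -> lead d.+1 b.
Proof.
move=> [f [If f0 <-]]; exists (ps_X B * f); split; first exact: IM.
  by case=> [|i] id; rewrite ps_XM ?f0.
by rewrite ps_XM.
Qed.

Lemma powser_ideal_span :
  exists s, (forall i, (i < size s)%N -> I s`_i) /\ forall f, I f -> lspan s f.
Proof.
have [D D_max] := noetherian_chain B_noeth lead_ideal lead_succ.
(* For each order [d], series in [I] whose coefficients at [d] generate the ideal of leading
   coefficients. *)
have level d : exists s : seq (powser B), [/\ forall i, (i < size s)%N -> I s`_i /\ order d s`_i
  & forall b, lead d b -> exists a : nat -> B, b = \sum_(i < size s) a i * s`_i d].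
  have [s [sl s_span]] := noetherian_span B_noeth (lead_ideal d).
  have [u uE] : {u : nat -> powser B &
      forall i, (i < size s)%N -> [/\ I (u i), order d (u i) & u i d = s`_i]}.
    apply: (choice (P := fun i f => (i < size s)%N -> [/\ I f, order d f & f d = s`_i])) => i.
    case: (ltnP i (size s)) => [/sl [f ?]|_]; first by exists f.
    by exists 0.
  exists (mkseq u (size s)); rewrite size_mkseq; split=> [i si|b /s_span [a ->]].
    by rewrite nth_mkseq //; case: (uE i si).
  exists a; apply: eq_bigr => i _; rewrite nth_mkseq //.
  by case: (uE i (ltn_ord i)) => _ _ ->.
(* Induction that lowers the required order D - d; at d = D no condition on the order is left. *)
suff main d : (d <= D)%N -> exists s, (forall i, (i < size s)%N -> I s`_i) /\
    forall f, I f -> order (D - d) f -> lspan s f.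
  have [s [Is s_span]] := main D (leqnn D); exists s; split=> // f If.
  by apply: s_span => // i; rewrite subnn.
elim: d => [_|d IHd dD].
  rewrite subn0; have [s [sI s_lead]] := level D.
  exists s; split=> [i /sI []//|f If f0].
  (* Stated for all [n] and [g], with zero coefficients for ineligible [g], so that one use of
     choice precedes the recursion. *)
  have digit n g : exists a : nat -> B, I g -> order (n + D) g ->
      g (n + D)%N = \sum_(i < size s) a i * s`_i D.
    case: (pselect (I g /\ order (n + D) g)) => [[Ig g0]|ng]; last first.
      by exists (fun=> 0) => Ig g0; case: ng.
    have [|c cE] := s_lead (g (n + D)%N); last by exists c.
    by apply: (D_max (n + D)%N); exists g.
  have [a' aE'] := choice (fun ng => digit ng.1 ng.2).
  pose a n g := a' (n, g).
  have aE n g : I g -> order (n + D) g ->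
      g (n + D)%N = \sum_(i < size s) a n g i * s`_i D by exact: (aE' (n, g)).
  (* What remains of [f] after cancelling its coefficients at D, ..., D + n - 1. The coefficients
     used at stage n become the n-th coefficients of the series [c i]. *)
  pose fix rest n : powser B := if n is m.+1 then
    rest m - \sum_(i < size s) ps_const (a m (rest m) i) * ps_X B ^+ m * s`_i else f.
  have restP n : I (rest n) /\ order (n + D) (rest n).
    elim: n => [|n [IHI IH0]] //=; split.
      by apply: IB => //; apply: ideal_sum => // i _; apply: IM; case: (sI i (ltn_ord i)).
    move=> j; rewrite ltnS leq_eqVlt psD psN ps_sum => /orP [/eqP ->|jn].
      rewrite aE //; apply/eqP; rewrite subr_eq0; apply/eqP/eq_bigr => i _.
      by rewrite -mulrA ps_constM ps_XnM leq_addr addKn.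
    rewrite IH0 // sub0r big1 ?oppr0 // => i _; rewrite -mulrA ps_constM ps_XnM.
    case: leqP => nj; last by rewrite mulr0.
    by rewrite (sI i (ltn_ord i)).2 ?mulr0 // ltn_subLR.
  pose c i := Powser (fun n => a n (rest n) i); exists c.
  have restE n : rest n = f - \sum_(i < size s)
      (\sum_(j < n) ps_const (c i j) * ps_X B ^+ j) * s`_i.
    elim: n => [|n IHn] /=.
      by rewrite big1 ?subr0 // => i _; rewrite big_ord0 mul0r.
    rewrite {1}IHn -addrA -opprD -big_split; congr (_ - _); apply: eq_bigr => i _.
    by rewrite big_ord_recr mulrDl.
  apply/subr0_eq/powserP => n.
  have [_ /(_ n)] := restP n.+1; rewrite ltnS leq_addr restE psD psN ps_sum => /(_ isT) E.
  rewrite psD psN ps_sum ps0 -[RHS]E.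
  (* In degree n, [c i] may be replaced by its first n + 1 terms: the tail is divisible by
     X^(n+1). *)
  congr (_ - _); apply: eq_bigr => i _; have [g {1}->] := ps_split n.+1 (c i).
  rewrite mulrDl psD -[RHS]addr0; congr (_ + _).
  by rewrite -mulrA ps_XnM ltnn.
have [s [sI s_span]] := IHd (ltnW dD).
have [t [tI t_lead]] := level (D - d.+1)%N.
exists (t ++ s); split=> [i|f If f0].
  rewrite size_cat nth_cat => it; case: ltnP => ti; first by case: (tI i ti).
  by apply: sI; rewrite ltn_subLR.
(* Subtracting a combination of the generators of this level raises the order by one, and the
   induction hypothesis applies to the difference. *)
have [|c cE] := t_lead (f (D - d.+1)%N); first by exists f.
pose h := \sum_(i < size t) ps_const (c i) * t`_i.
rewrite -[f](addrNK h) addrC; apply: span_cat; first by exists (fun i => ps_const (c i)).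
apply: s_span => [|i iD].
  by apply: IB => //; apply: ideal_sum => // i _; apply: IM; case: (tI i (ltn_ord i)).
have hE j : h j = \sum_(i < size t) c i * t`_i j.
  by rewrite ps_sum; apply: eq_bigr => l _; rewrite ps_constM.
rewrite psD psN hE; move: iD; rewrite -subnSK // ltnS leq_eqVlt => /orP [/eqP ->|iD].
  by rewrite cE subrr.
rewrite f0 // sub0r big1 ?oppr0 // => j _.
by rewrite (tI j (ltn_ord j)).2 ?mulr0.
Qed.
End PowserNoetherian.

Lemma powser_noetherian (B : comNzRingType) : noetherian B -> noetherian (powser B).
Proof. by move=> Bn; apply: span_noetherian => I; apply: powser_ideal_span. Qed.

Section MakeLRMorphism.
Variables (k : fieldType) (A B : comAlgType k) (f : A -> B).
Hypotheses (fD : {morph f : x y / x + y}) (fM : {morph f : x y / x * y}).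
Hypothesis fA : forall c, f c%:A = c%:A.

Lemma lrmorphism_zmod : zmod_morphism f.
Proof.
have f0 : f 0 = 0 by apply: (addrI (f 0)); rewrite -fD !addr0.
move=> x y; rewrite fD; congr (_ + _).
by apply: (addrI (f y)); rewrite -fD !subrr.
Qed.
Lemma lrmorphism_monoid : monoid_morphism f.
Proof. by split=> //; have := fA 1; rewrite !scale1r. Qed.
Lemma lrmorphism_scalable : scalable f.
Proof. by move=> c x; rewrite -mulr_algl fM fA mulr_algl. Qed.

(** The proofs are arguments because the structures are inferred from this constant, which therefore
    has to carry them. *)
Definition lrmorphism_fun of {morph f : x y / x + y} & {morph f : x y / x * y}
  & (forall c, f c%:A = c%:A) : A -> B := f.
Local Notation F := (lrmorphism_fun fD fM fA).

HB.instance Definition _ := GRing.isZmodMorphism.Build A B F lrmorphism_zmod.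
HB.instance Definition _ := GRing.isMonoidMorphism.Build A B F lrmorphism_monoid.
HB.instance Definition _ := GRing.isScalable.Build k A B *:%R F lrmorphism_scalable.
Definition make_lrmorphism : {lrmorphism A -> B} := F.
End MakeLRMorphism.

Section PowserAlgebra.
Variables (k : fieldType) (B : comAlgType k).
Implicit Types f g : powser B.

Definition ps_scale (c : k) f : powser B := Powser (fun i => c *: f i).

Lemma ps_scaleA a b f : ps_scale a (ps_scale b f) = ps_scale (a * b) f.
Proof. by apply: powserP => i; apply: scalerA. Qed.
Lemma ps_scale1 : left_id 1 ps_scale.
Proof. by move=> f; apply: powserP => i; apply: scale1r. Qed.
Lemma ps_scaleDr : right_distributive ps_scale +%R.
Proof. by move=> c f g; apply: powserP => i; apply: scalerDr. Qed.
Lemma ps_scaleDl f : {morph ps_scale^~ f : a b / a + b}.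
Proof. by move=> a b; apply: powserP => i; apply: scalerDl. Qed.

HB.instance Definition _ := GRing.Zmodule_isLmodule.Build k (powser B)
  ps_scaleA ps_scale1 ps_scaleDr ps_scaleDl.

Lemma ps_scaleAl (c : k) f g : c *: (f * g) = c *: f * g.
Proof.
apply: powserP => n; rewrite -[LHS]/(c *: (f * g) n) psM scaler_sumr.
by apply: eq_bigr => i _; apply: scalerAl.
Qed.

HB.instance Definition _ := GRing.Lmodule_isLalgebra.Build k (powser B) ps_scaleAl.
HB.instance Definition _ := GRing.Lalgebra_isComAlgebra.Build k (powser B).

Lemma ps_algE (c : k) i : (c%:A : powser B) i = if i is 0%N then c%:A else 0.
Proof. by case: i => [|i]; [|apply: scaler0]. Qed.

Lemma ps_constD : {morph @ps_const B : x y / x + y}.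
Proof. by move=> x y; apply: powserP => -[|i]; rewrite psD //= addr0. Qed.
Lemma ps_constMM : {morph @ps_const B : x y / x * y}.
Proof. by move=> x y; apply: powserP => -[|i]; rewrite ps_constM //= mulr0. Qed.
Lemma ps_constA (c : k) : @ps_const B c%:A = c%:A.
Proof. by apply: powserP => i; rewrite ps_algE. Qed.

Definition ps_const_hom : {lrmorphism B -> powser B} :=
  make_lrmorphism ps_constD ps_constMM ps_constA.
End PowserAlgebra.

Section PowserCln.
Variables (k : fieldType) (B : clnAlg k).

Definition ps_residue_fun (f : powser B) : k^o := residue B (f 0%N).

Lemma ps_residueD : {morph ps_residue_fun : x y / x + y}.
Proof. by move=> f g; apply: (rmorphD (residue B)). Qed.
Lemma ps_residueM : {morph ps_residue_fun : x y / x * y}.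
Proof. by move=> f g; rewrite /ps_residue_fun psM big_ord1; apply: (rmorphM (residue B)). Qed.
Lemma ps_residueA (c : k) : ps_residue_fun c%:A = c%:A.
Proof. by rewrite /ps_residue_fun ps_algE rmorph_alg. Qed.

Definition ps_residue : {lrmorphism powser B -> k^o} :=
  make_lrmorphism ps_residueD ps_residueM ps_residueA.

Let m : B -> Prop := fun x => residue B x = 0.
Let J : powser B -> Prop := fun f => ps_residue f = 0.
Let m_ideal : is_ideal m := residue_ideal _.
Let J_ideal : is_ideal J := residue_ideal _.

(** The maximal ideal of B[[X]] is (m, X), whose n-th power is the sum of the m^(n-i) X^i. The
    truncated subtraction leaves coefficients of index at least n unconstrained, as X^n demands. *)
Lemma ps_powE n f : ideal_pow J n f <-> forall i, ideal_pow m (n - i) (f i).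
Proof.
split=> [|fm].
  move: f; apply: ideal_pow_elim => [i|f g fm gm i|f g Jg i].
  - exact: ideal_pow_zero.
  - exact: ideal_pow_add.
  have {Jg} Pg : forall i, ideal_pow m (n - i) ((\prod_j g j) i).
    elim: n g Jg => [|n IHn] g Jg {}i; first by rewrite sub0n; apply: ideal_pow0.
    rewrite big_ord_recl psM; apply: ideal_pow_sum => //.
    (* The constant term of the first factor lies in m and supplies one power; a later term instead
       lowers the index of the coefficient of the remaining product. *)
    move=> [[|j] /= ji] _.
      case: (leqP i n) => [ni|]; last first.
        by rewrite -subn_eq0 => /eqP ->; apply: ideal_pow0.
      rewrite subn0 subSn // -add1n; apply: ideal_powM; last by apply: IHn => l; apply: Jg.
      by apply/(ideal_pow1 m_ideal); apply: Jg.
    apply: ideal_pow_mulr; have := IHn (fun l => g (lift ord0 l)) (fun l => Jg _) (i - j.+1)%N.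
    apply: ideal_pow_le; move: (ji); rewrite ltnS => {}ji; rewrite -(subnKC ji) addKn addSn subSS.
    by apply: leq_sub2l; apply: leq_addl.
  rewrite psM; apply: ideal_pow_sum => j _; apply: ideal_pow_mulr.
  by apply: ideal_pow_le (Pg _); apply: leq_sub2l; apply: leq_subr.
have JX : J (ps_X B) by exact: (rmorph0 (residue B)).
have Jc a x : ideal_pow m a x -> ideal_pow J a (ps_const_hom B x).
  by apply: ideal_pow_map.
have [g ->] := ps_split n f; apply: ideal_pow_add.
  apply: ideal_pow_sum => i _.
  apply: (@ideal_pow_le _ _ n (n - i + i)); first by rewrite subnK // ltnW.
  by apply: ideal_powM; [apply: Jc | apply: ideal_pow_exp].
by rewrite mulrC; apply/ideal_pow_mulr/ideal_pow_exp.
Qed.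

Lemma powser_complete : adically_complete J.
Proof.
split=> [f fJ|u uJ].
  apply: powserP => i; apply: pw_eq0 => n.
  by have /ps_powE/(_ i) := fJ (n + i)%N; rewrite addnK.
(* Coefficient [i] of a difference in J^(n+i) lies in m^n, hence the shift of the sequence by
   [i]. *)
have lim i : exists y : B, forall n, ideal_pow m n (y - u (n + i)%N i).
  apply: (@pw_lim _ B (fun n => u (n + i)%N i)) => n.
  by have /ps_powE/(_ i) := uJ (n + i)%N; rewrite addnK.
have [y yE] := choice lim; exists (Powser y) => n; apply/ps_powE => i.
case: (leqP i n) => [ni|/ltnW]; last by rewrite -subn_eq0 => /eqP ->; apply: ideal_pow0.
by have := yE i (n - i)%N; rewrite subnK.
Qed.

Definition powser_cln : clnAlg k :=
  complete_cln powser_complete (powser_noetherian (cln_noetherian (c := B))).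

Definition ps_const_cln : clnHom B powser_cln :=
  @local_hom _ B powser_cln (ps_const_hom B) (fun=> erefl).

Lemma ps_X_residue : residue powser_cln (ps_X B) = 0.
Proof. exact: (rmorph0 (residue B)). Qed.

Section Evaluation.
Variables (S : clnAlg k) (phi : clnHom B S) (s : S).
Hypothesis s0 : residue S s = 0.

Let part n (f : powser B) : S := \sum_(i < n) phi (f i) * s ^+ i.

Let part_horner n f : part n f = (map_poly phi (ps_trunc n f)).[s].
Proof.
rewrite (@horner_coef_wide _ n); last first.
  by apply: leq_trans (size_poly _ _) _; apply: size_poly.
by apply: eq_bigr => i _; rewrite coef_map /= ps_trunc_coef.
Qed.

Let horner_pw n (p : {poly S}) : (forall i, (i < n)%N -> p`_i = 0) -> pw n p.[s].
Proof.
move=> p0; rewrite horner_coef; apply: ideal_pow_sum => i _.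
case: (ltnP i n) => [/p0 ->|ni]; first by rewrite mul0r; apply: ideal_pow_zero.
by apply/ideal_pow_mulr/(ideal_pow_le ni)/ideal_pow_exp.
Qed.

Lemma evaluation_exists f : exists y, forall n, pw n (y - part n f).
Proof.
apply: pw_lim => n; rewrite /part big_ord_recr /= addrAC subrr add0r.
exact/ideal_pow_mulr/ideal_pow_exp.
Qed.

Let ev f : S := sval (cid (evaluation_exists f)).
Let evP f n : pw n (ev f - part n f).
Proof. exact: svalP (cid (evaluation_exists f)) n. Qed.

Let ev_uniq f y : (forall n, pw n (y - part n f)) -> ev f = y.
Proof.
move=> yP; apply/subr0_eq/pw_eq0 => n.
by rewrite -(subrKA (part n f)) -[part n f - y]opprB; apply: pwB.
Qed.

Let evD : {morph ev : f g / f + g}.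
Proof.
move=> f g; apply: ev_uniq => n.
have -> : part n (f + g) = part n f + part n g.
  by rewrite -big_split; apply: eq_bigr => i _; rewrite psD rmorphD mulrDl.
by rewrite opprD addrACA; apply: pwD.
Qed.

Let evM : {morph ev : f g / f * g}.
Proof.
move=> f g; apply: ev_uniq => n.
(* The product of the truncations and the truncated product have equal coefficients below degree n,
   so they differ by a polynomial in s with lowest degree at least n. *)
have P : pw n (part n f * part n g - part n (f * g)).
  rewrite !part_horner -hornerM -hornerN -hornerD -rmorphM -rmorphB.
  apply: horner_pw => i ni; rewrite coef_map coefB ps_trunc_coef // (ps_mulE _ _ ni).
  by rewrite subrr raddf0.
have -> : ev f * ev g - part n (f * g) = ev f * (ev g - part n g)
    + part n g * (ev f - part n f) + (part n f * part n g - part n (f * g)).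
  rewrite !mulrBr [part n g * ev f]mulrC [part n g * part n f]mulrC.
  by rewrite !subrKA.
by apply: pwD => //; apply: pwD; apply: pwMl; apply: evP.
Qed.

Let ev_const b : ev (ps_const b) = phi b.
Proof.
apply: ev_uniq => -[|n]; first exact: pw0.
rewrite /part big_ord_recl mulr1 big1 => [|i _]; last by rewrite !lift0 /= rmorph0 mul0r.
by rewrite addr0 subrr; apply: pw_zero.
Qed.

Let evA c : ev c%:A = c%:A.
Proof. by rewrite -ps_constA ev_const rmorph_alg. Qed.

Let evX : ev (ps_X B) = s.
Proof.
apply: ev_uniq => -[|[|n]]; first exact: pw0.
  by rewrite /part big_ord1 rmorph0 mul0r subr0; apply/pw1.
rewrite /part !big_ord_recl big1 => [|i _]; last by rewrite !lift0 /= rmorph0 mul0r.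
by rewrite /= rmorph0 rmorph1 mul0r mul1r add0r addr0 subrr; apply: pw_zero.
Qed.

Let ev_res f : residue S (make_lrmorphism evD evM evA f) = residue powser_cln f.
Proof.
have /pw1 := evP f 1; rewrite /part big_ord1 mulr1 rmorphB /= => /subr0_eq.
by rewrite hom_residue.
Qed.

Lemma ps_evaluation : exists ev : clnHom powser_cln S,
  (forall b, ev (ps_const b) = phi b) /\ ev (ps_X B) = s.
Proof. by exists (@local_hom _ powser_cln S _ ev_res). Qed.

(** The maps agree on polynomials in X, and a series differs from such a polynomial by a multiple of
    X^n, which both send into m^n. *)
Lemma ps_hom_ext (e1 e2 : clnHom powser_cln S) :
  (forall b, e1 (ps_const b) = e2 (ps_const b)) -> e1 (ps_X B) = e2 (ps_X B) ->
  e1 = e2.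
Proof.
move=> ec eX; apply: clnHomP => f; apply/subr0_eq/pw_eq0 => n.
have [g ->] := ps_split n f; rewrite !rmorphD !rmorph_sum opprD addrACA -sumrB.
rewrite big1 ?add0r => [|i _]; last by rewrite !rmorphM !rmorphXn /= ec eX subrr.
rewrite !rmorphM !rmorphXn /= eX -mulrBr mulrC.
apply/pwMl/pw_exp.
by rewrite /max_ideal hom_residue ps_X_residue.
Qed.
End Evaluation.

End PowserCln.

(** * The ground field, and power series rings in finitely many variables *)

Section FieldCln.
Variable k : fieldType.

Lemma regular_algE (c : k) : c%:A = c :> k^o.
Proof. exact: mulr1. Qed.

Lemma regular_idA (c : k) : idfun (c%:A : k^o) = c%:A. Proof. by []. Qed.

Definition field_residue : {lrmorphism k^o -> k^o} :=
  @make_lrmorphism k k^o k^o idfun (fun _ _ => erefl) (fun _ _ => erefl) regular_idA.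

Let m : k^o -> Prop := fun x => field_residue x = 0.

Lemma field_complete : adically_complete m.
Proof.
have pow1 n x : ideal_pow m n.+1 x -> x = 0.
  by move=> /(ideal_pow_le (ltn0Sn n))/(ideal_pow1 (residue_ideal field_residue)).
(* Here m = 0, so the sequence is constant from index 1 on; the step from index 0 is only known to
   lie in m^0, the whole ring. *)
split=> [x /(_ 1%N) /pow1 //|u uP]; exists (u 1%N) => -[|n]; first exact: ideal_pow0.
suff -> : u n.+1 = u 1%N by rewrite subrr; apply: ideal_pow_zero.
by elim: n => // n IHn; rewrite -IHn; apply/subr0_eq/(@pow1 n).
Qed.

Lemma field_noetherian : noetherian (k^o : comNzRingType).
Proof.
apply: span_noetherian => I [I0 _ IM].
case: (pselect (exists2 x, I x & x <> 0)) => [[x Ix /eqP x0]|nI].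
  exists [:: x]; split=> [[|i] //|y _]; exists (fun=> y / x).
  by rewrite big_ord1 /= divfK.
exists [::]; split=> // x Ix; exists (fun=> 0); rewrite big_ord0.
by apply: contrapT => x0; apply: nI; exists x.
Qed.

Definition field_cln : clnAlg k := complete_cln field_complete field_noetherian.

Section Unit.
Variable A : comAlgType k.
Let unit (c : k^o) : A := c%:A.
Let unitD : {morph unit : x y / x + y}.
Proof. by move=> x y; apply: scalerDl. Qed.
Let unitM : {morph unit : x y / x * y}.
Proof. by move=> x y; rewrite /unit -scalerAl mul1r scalerA. Qed.
Let unitA c : unit c%:A = c%:A.
Proof. by rewrite regular_algE. Qed.

Definition unit_lrmorphism : {lrmorphism k^o -> A} := make_lrmorphism unitD unitM unitA.
End Unit.

Section UnitHom.
Variable R : clnAlg k.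

Lemma unit_residue x : residue R (unit_lrmorphism R x) = residue field_cln x.
Proof. exact: residue_alg. Qed.

Definition unit_hom : clnHom field_cln R := @local_hom _ field_cln R _ unit_residue.

Lemma unit_hom_ext (f g : clnHom field_cln R) : f = g.
Proof.
apply: clnHomP => x.
have xE : x = (x : k)%:A :> k^o by rewrite regular_algE.
by rewrite [in LHS]xE [in RHS]xE (rmorph_alg f) (rmorph_alg g).
Qed.
End UnitHom.
End FieldCln.

Section FreeCln.
Variable k : fieldType.

(** The universal property of the power series ring in the variables x_j; nothing else about that
    ring is used later. *)
Definition free_on (J : Type) (R : clnAlg k) (x : J -> R) : Prop :=
  (forall j, residue R (x j) = 0) /\
  forall (S : clnAlg k) (s : J -> S), (forall j, residue S (s j) = 0) ->
    exists! f : clnHom R S, forall j, f (x j) = s j.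

(** Variables are adjoined one at a time: the earlier ones sit in the constants of R[[X]], and X is
    the new one. *)
Lemma free_cln_ord n : exists (R : clnAlg k) (x : 'I_n -> R), free_on x.
Proof.
elim: n => [|n [R [x [x0 x_free]]]].
  exists (field_cln k), (fun=> 0); split=> [[]//|S s s0].
  by exists (unit_hom S); split=> [[]//|f _]; apply: unit_hom_ext.
exists (powser_cln R).
pose y (i : 'I_n.+1) : powser_cln R := oapp (fun j => ps_const (x j)) (ps_X R) (unlift ord0 i).
exists y; split=> [i|S s s0].
  by rewrite /y; case: unliftP => [j|] _; [apply: x0 | apply: ps_X_residue].
have [phi [phiE phi_uniq]] := x_free S (fun j => s (lift ord0 j)) (fun j => s0 _).
have [f [fc fX]] := ps_evaluation phi (s0 ord0).
exists f; split=> [i|g gE].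
  by rewrite /y; case: unliftP => [j|] -> /=; rewrite ?fc.
have gX : g (ps_X R) = s ord0 by rewrite -gE /y unlift_none.
apply: ps_hom_ext => [b|]; last by rewrite fX gX.
rewrite fc.
have -> : phi = cln_comp g (ps_const_cln R) by apply: phi_uniq => j; rewrite -gE /y liftK.
by [].
Qed.

Lemma free_cln (J : finType) : exists (R : clnAlg k) (x : J -> R), free_on x.
Proof.
have [R [x [x0 x_free]]] := free_cln_ord #|J|.
exists R, (x \o enum_rank); split=> [j|S s s0]; first exact: x0.
have [f [fE f_uniq]] := x_free S (s \o enum_val) (fun i => s0 _).
exists f; split=> [j|g gE]; first by rewrite /= fE /= enum_rankK.
by apply: f_uniq => i; rewrite /= -gE /= enum_valK.
Qed.
End FreeCln.

(** * Quotients *)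

Section Quotient.
Variables (k : fieldType) (R : clnAlg k) (E : R -> Prop).
Hypothesis E0 : forall x, E x -> residue R x = 0.

(* The closure of the ideal generated by [E]; this makes the quotient separated. *)
Definition closed_span (x : R) : Prop :=
  forall n, exists y z, [/\ ideal_pow E 1 y, pw n z & x = y + z].

Lemma closed_span_zero : closed_span 0.
Proof.
move=> n; exists 0, 0; split; rewrite ?addr0 //.
  exact: ideal_pow_zero.
exact: pw_zero.
Qed.
Lemma closed_spanD x y : closed_span x -> closed_span y -> closed_span (x + y).
Proof.
move=> xE yE n; have [u [v [Eu mv ->]]] := xE n; have [u' [v' [Eu' mv' ->]]] := yE n.
exists (u + u'), (v + v'); split; last by rewrite addrACA.
  exact: ideal_pow_add.
exact: pwD.
Qed.
Lemma closed_spanM a x : closed_span x -> closed_span (a * x).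
Proof.
move=> xE n; have [u [v [Eu mv ->]]] := xE n.
exists (a * u), (a * v); split; last by rewrite mulrDr.
  exact: ideal_pow_mulr.
exact: pwMl.
Qed.
Lemma closed_spanN x : closed_span x -> closed_span (- x).
Proof. by rewrite -mulN1r; apply: closed_spanM. Qed.
Lemma closed_span_residue x : closed_span x -> residue R x = 0.
Proof.
move=> /(_ 1%N) [y [z [Ey /pw1 z0 ->]]]; rewrite rmorphD /= z0 addr0.
move: y Ey; apply: ideal_pow_elim => [|u v u0 v0|c u Eu].
- by rewrite rmorph0.
- by rewrite rmorphD /= u0 v0 addr0.
- by rewrite big_ord1 rmorphM /= (E0 (Eu _)) mulr0.
Qed.
Lemma closed_span_gen x : E x -> closed_span x.
Proof.
move=> Ex n; exists x, 0; split; rewrite ?addr0 //; last exact: pw_zero.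
by have := @ideal_pow_gen R E 1 1 (fun=> x) (fun=> Ex); rewrite big_ord1 mul1r.
Qed.
Lemma closed_span_closed x : (forall n, exists y z, [/\ closed_span y, pw n z & x = y + z]) ->
  closed_span x.
Proof.
move=> xE n; have [y [z [yE mz ->]]] := xE n; have [u [v [Eu mv ->]]] := yE n.
by exists u, (v + z); split; rewrite ?addrA //; apply: pwD.
Qed.

Definition cs_eq (x y : R) : bool := `[< closed_span (x - y) >].
Lemma cs_eq_refl : reflexive cs_eq.
Proof. by move=> x; apply/asboolP; rewrite subrr; apply: closed_span_zero. Qed.
Lemma cs_eq_sym : symmetric cs_eq.
Proof. by move=> x y; apply/asboolP/asboolP => /closed_spanN; rewrite opprB. Qed.
Lemma cs_eq_trans : transitive cs_eq.
Proof.
move=> y x z /asboolP xy /asboolP yz; apply/asboolP.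
by have := closed_spanD xy yz; rewrite subrKA.
Qed.
Canonical cs_equiv := EquivRel cs_eq cs_eq_refl cs_eq_sym cs_eq_trans.
Definition cs_quot : Type := {eq_quot cs_equiv}.
HB.instance Definition _ := Choice.on cs_quot.
Definition cs_pi (x : R) : cs_quot := \pi_({eq_quot cs_equiv}) x.

Lemma cs_piP x y : cs_pi x = cs_pi y <-> closed_span (x - y).
Proof. by split=> [/eqmodP /asboolP //|xy]; apply/eqmodP; apply/asboolP. Qed.

Lemma cs_ind (Q : cs_quot -> Prop) : (forall x, Q (cs_pi x)) -> forall u, Q u.
Proof. by move=> Qx u; rewrite -[u]reprK; apply: Qx. Qed.

Lemma cs_repr x : closed_span (repr (cs_pi x) - x).
Proof. by apply/cs_piP; rewrite /cs_pi reprK. Qed.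

Definition cs_add (u v : cs_quot) := cs_pi (repr u + repr v).
Definition cs_opp (u : cs_quot) := cs_pi (- repr u).
Definition cs_mul (u v : cs_quot) := cs_pi (repr u * repr v).

Lemma cs_addE x y : cs_add (cs_pi x) (cs_pi y) = cs_pi (x + y).
Proof.
apply/cs_piP; rewrite opprD addrACA.
by apply: closed_spanD; apply: cs_repr.
Qed.
Lemma cs_oppE x : cs_opp (cs_pi x) = cs_pi (- x).
Proof. by apply/cs_piP; rewrite -opprD; apply: closed_spanN (cs_repr x). Qed.
Lemma cs_mulE x y : cs_mul (cs_pi x) (cs_pi y) = cs_pi (x * y).
Proof.
apply/cs_piP; set x' := repr _; set y' := repr _.
rewrite -(subrKA (x' * y)) -mulrBr -mulrBl [(x' - x) * y]mulrC.
by apply: closed_spanD; apply: closed_spanM; apply: cs_repr.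
Qed.

Lemma cs_addA : associative cs_add.
Proof. by elim/cs_ind=> x; elim/cs_ind=> y; elim/cs_ind=> z; rewrite !cs_addE addrA. Qed.
Lemma cs_addC : commutative cs_add.
Proof. by elim/cs_ind=> x; elim/cs_ind=> y; rewrite !cs_addE addrC. Qed.
Lemma cs_add0 : left_id (cs_pi 0) cs_add.
Proof. by elim/cs_ind=> x; rewrite cs_addE add0r. Qed.
Lemma cs_addN : left_inverse (cs_pi 0) cs_opp cs_add.
Proof. by elim/cs_ind=> x; rewrite cs_oppE cs_addE addNr. Qed.
HB.instance Definition _ :=
  GRing.isZmodule.Build cs_quot cs_addA cs_addC cs_add0 cs_addN.

Lemma cs_mulA : associative cs_mul.
Proof. by elim/cs_ind=> x; elim/cs_ind=> y; elim/cs_ind=> z; rewrite !cs_mulE mulrA. Qed.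
Lemma cs_mulC : commutative cs_mul.
Proof. by elim/cs_ind=> x; elim/cs_ind=> y; rewrite !cs_mulE mulrC. Qed.
Lemma cs_1mul : left_id (cs_pi 1) cs_mul.
Proof. by elim/cs_ind=> x; rewrite cs_mulE mul1r. Qed.
Lemma cs_mulDl : left_distributive cs_mul cs_add.
Proof.
elim/cs_ind=> x; elim/cs_ind=> y; elim/cs_ind=> z.
by rewrite !(cs_mulE, cs_addE) mulrDl.
Qed.
Lemma cs_1neq0 : cs_pi 1 != cs_pi 0.
Proof.
apply/eqP => /cs_piP /closed_span_residue /eqP.
by rewrite subr0 rmorph1 oner_eq0.
Qed.
HB.instance Definition _ := GRing.Zmodule_isComNzRing.Build cs_quot
  cs_mulA cs_mulC cs_1mul cs_mulDl cs_1neq0.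

Lemma cs_piD : {morph cs_pi : x y / x + y}.
Proof. by move=> x y; rewrite -cs_addE. Qed.
Lemma cs_piM : {morph cs_pi : x y / x * y}.
Proof. by move=> x y; rewrite -cs_mulE. Qed.

Definition cs_scale (c : k) (u : cs_quot) : cs_quot := cs_pi c%:A * u.
Lemma cs_scaleA a b u : cs_scale a (cs_scale b u) = cs_scale (a * b) u.
Proof. by rewrite /cs_scale mulrA -cs_piM -scalerAl mul1r scalerA. Qed.
Lemma cs_scale1 : left_id 1 cs_scale.
Proof. by move=> u; rewrite /cs_scale scale1r; apply: mul1r. Qed.
Lemma cs_scaleDr : right_distributive cs_scale +%R.
Proof. by move=> c u v; apply: mulrDr. Qed.
Lemma cs_scaleDl u : {morph cs_scale^~ u : a b / a + b}.
Proof. by move=> a b; rewrite /cs_scale scalerDl cs_piD mulrDl. Qed.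
HB.instance Definition _ := GRing.Zmodule_isLmodule.Build k cs_quot
  cs_scaleA cs_scale1 cs_scaleDr cs_scaleDl.
Lemma cs_scaleAl (c : k) (u v : cs_quot) : c *: (u * v) = c *: u * v.
Proof. exact: mulrA. Qed.
HB.instance Definition _ := GRing.Lmodule_isLalgebra.Build k cs_quot cs_scaleAl.
HB.instance Definition _ := GRing.Lalgebra_isComAlgebra.Build k cs_quot.

Lemma cs_piA (c : k) : cs_pi c%:A = c%:A.
Proof. by rewrite -[RHS]/(cs_pi c%:A * 1) mulr1. Qed.
Definition cs_proj : {lrmorphism R -> cs_quot} := make_lrmorphism cs_piD cs_piM cs_piA.

Lemma cs_pi_sum n (F : 'I_n -> R) : cs_pi (\sum_i F i) = \sum_i cs_pi (F i).
Proof. exact: (rmorph_sum cs_proj). Qed.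
Lemma cs_pi_prod n (F : 'I_n -> R) : cs_pi (\prod_i F i) = \prod_i cs_pi (F i).
Proof. exact: (rmorph_prod cs_proj). Qed.

Section Descend.
Variables (S : comAlgType k) (f : {lrmorphism R -> S}).
Hypothesis fE : forall x, closed_span x -> f x = 0.
Definition cs_desc_fun (u : cs_quot) : S := f (repr u).
Lemma cs_desc_pi x : cs_desc_fun (cs_pi x) = f x.
Proof. by apply/subr0_eq; rewrite /cs_desc_fun -rmorphB; apply/fE/cs_repr. Qed.
Lemma cs_descD : {morph cs_desc_fun : x y / x + y}.
Proof. by elim/cs_ind=> x; elim/cs_ind=> y; rewrite -cs_piD !cs_desc_pi rmorphD. Qed.
Lemma cs_descM : {morph cs_desc_fun : x y / x * y}.
Proof. by elim/cs_ind=> x; elim/cs_ind=> y; rewrite -cs_piM !cs_desc_pi rmorphM. Qed.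
Lemma cs_descA c : cs_desc_fun c%:A = c%:A.
Proof. by rewrite -cs_piA cs_desc_pi rmorph_alg. Qed.
Definition cs_desc : {lrmorphism cs_quot -> S} := make_lrmorphism cs_descD cs_descM cs_descA.
End Descend.

Definition cs_residue := cs_desc closed_span_residue.
Let m : cs_quot -> Prop := fun u => cs_residue u = 0.

Lemma cs_residue_pi x : cs_residue (cs_pi x) = residue R x.
Proof. exact: (cs_desc_pi closed_span_residue). Qed.

(** A representative of an element of the maximal ideal has residue 0, so products of n such
    elements lift to m^n with the same exponent. *)
Lemma cs_pow_lift n u : ideal_pow m n u -> exists2 x, pw n x & cs_pi x = u.
Proof.
move: u; apply: ideal_pow_elim => [|_ _ [x mx <-] [y my <-]|c y my].
- by exists 0; first exact: pw_zero.
- by exists (x + y); [apply: pwD | apply: cs_piD].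
exists (repr c * \prod_j repr (y j)).
  by apply: ideal_pow_gen => j; apply: my.
rewrite cs_piM cs_pi_prod /cs_pi reprK; congr (_ * _).
by apply: eq_bigr => j _; rewrite /= /cs_pi reprK.
Qed.

Lemma cs_noetherian : noetherian cs_quot.
Proof.
apply: span_noetherian => I [I0 ID IM].
have I_ideal : is_ideal (fun x => I (cs_pi x)).
  split=> [||a x Ix]; [exact: I0 | by move=> x y Ix Iy; rewrite cs_piD; apply: ID|].
  by rewrite (cs_piM a x); apply: IM.
have [s [sI s_span]] := noetherian_span (cln_noetherian (c := R)) I_ideal.
exists (map cs_pi s); rewrite size_map; split=> [i si|].
  by rewrite (nth_map 0) //; apply: sI.
elim/cs_ind=> x /s_span [c ->]; exists (fun i => cs_pi (c i)).
rewrite cs_pi_sum size_map; apply: eq_bigr => i _ /=.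
by rewrite cs_piM (nth_map 0).
Qed.

Lemma cs_complete : adically_complete m.
Proof.
split=> [|u uP].
  (* An element of all powers is represented by some [x] lying in [closed_span] + m^n for each n,
     hence in [closed_span]: this is the purpose of taking the closure. *)
  elim/cs_ind=> x xP; apply/cs_piP; rewrite subr0; apply: closed_span_closed => n.
  have [y my yE] := cs_pow_lift (xP n); exists (x - y), y; split; rewrite ?subrK //.
  exact/cs_piP.
(* The differences are lifted rather than the terms, so that the sums [U] form a Cauchy sequence in
   [R]; arbitrary representatives of the terms need not. *)
have [d dP] : {d : nat -> R & forall n, pw n (d n) /\ cs_pi (d n) = u n.+1 - u n}.
  apply: (choice (P := fun n x => pw n x /\ cs_pi x = u n.+1 - u n)) => n.
  by have [x mx xE] := cs_pow_lift (uP n); exists x.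
pose U n := repr (u 0%N) + \sum_(i < n) d i.
have UE n : cs_pi (U n) = u n.
  rewrite /U cs_piD cs_pi_sum {1}/cs_pi reprK.
  elim: n => [|n IHn]; first by rewrite big_ord0 addr0.
  by rewrite big_ord_recr /= addrA IHn (dP n).2 addrC subrK.
have [|x xP] := @pw_lim _ R U.
  move=> n; have -> : U n.+1 - U n = d n; last by case: (dP n).
  by rewrite /U big_ord_recr /= addrA [_ + d n]addrC addrK.
exists (cs_pi x) => n; rewrite -UE.
have -> : cs_pi x - cs_pi (U n) = cs_proj (x - U n) by rewrite rmorphB.
by apply: ideal_pow_map (xP n) => y y0; rewrite /m -[RHS]y0; apply: cs_residue_pi.
Qed.

Definition quotient_cln : clnAlg k := complete_cln cs_complete cs_noetherian.

Definition quotient_hom : clnHom R quotient_cln :=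
  @local_hom _ R quotient_cln cs_proj cs_residue_pi.

Lemma quotient_hom_gen x : E x -> quotient_hom x = 0.
Proof. by move=> Ex; apply/cs_piP; rewrite subr0; apply: closed_span_gen. Qed.

(** A map that kills [E] sends the closure into every power of the maximal ideal of [S], hence to 0
    because [S] is separated. *)
Lemma quotient_desc (S : clnAlg k) (f : clnHom R S) : (forall x, E x -> f x = 0) ->
  exists g : clnHom quotient_cln S, cln_comp g quotient_hom = f.
Proof.
move=> fE.
have f0 x : closed_span x -> f x = 0.
  move=> xE; apply: pw_eq0 => n; have [y [z [Ey mz ->]]] := xE n.
  rewrite rmorphD /=; have -> : f y = 0; last by rewrite add0r; apply: hom_pw.
  move: y Ey; apply: ideal_pow_elim => [|u v u0 v0|c u Eu].
  - by rewrite rmorph0.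
  - by rewrite rmorphD /= u0 v0 addr0.
  - by rewrite big_ord1 rmorphM /= (fE _ (Eu _)) mulr0.
have fr x : residue S (cs_desc f0 x) = residue quotient_cln x.
  elim/cs_ind: x => x.
  have -> : cs_desc f0 (cs_pi x) = f x by apply: (cs_desc_pi f0).
  by rewrite hom_residue -cs_residue_pi.
exists (@local_hom _ quotient_cln S _ fr); apply: clnHomP => x.
exact: (cs_desc_pi f0).
Qed.

Lemma quotient_hom_epi (S : clnAlg k) (f g : clnHom quotient_cln S) :
  cln_comp f quotient_hom = cln_comp g quotient_hom -> f = g.
Proof.
move=> fg; apply: clnHomP; elim/cs_ind => x.
exact: (congr1 (fun h : clnHom R S => h x) fg).
Qed.

End Quotient.

(** Equations natural in the ring are determined by their values at the generic point of the power
    series ring, and the quotient by these values represents the solutions in the maximal ideal. The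
    second hypothesis keeps this quotient from being zero. *)
Lemma universal_solution (k : fieldType) (J : finType) (T : Type)
    (eqn : forall R : clnAlg k, (J -> R) -> T -> R) :
  (forall (R S : clnAlg k) (f : clnHom R S) x t, f (eqn R x t) = eqn S (f \o x) t) ->
  (forall (R : clnAlg k) (x : J -> R), (forall j, residue R (x j) = 0) ->
    forall t, residue R (eqn R x t) = 0) ->
  exists (R : clnAlg k) (x : J -> R),
    [/\ forall j, residue R (x j) = 0, forall t, eqn R x t = 0
     & forall (S : clnAlg k) (s : J -> S), (forall j, residue S (s j) = 0) ->
       (forall t, eqn S s t = 0) -> exists! f : clnHom R S, forall j, f (x j) = s j].
Proof.
move=> eqn_nat eqn0; have [F [x [x0 x_free]]] := free_cln k J.
pose E y := exists t, y = eqn F x t.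
have E0 y : E y -> residue F y = 0 by move=> [t ->]; apply: eqn0.
pose q := quotient_hom E0.
exists (quotient_cln E0), (q \o x); split=> [j|t|S s s0 sE].
- exact: etrans (hom_residue q (x j)) (x0 j).
- by rewrite -eqn_nat; apply: quotient_hom_gen; exists t.
have [f [fE f_uniq]] := x_free S s s0.
have [y [t ->]|g gE] := @quotient_desc _ _ _ E0 S f.
  by rewrite eqn_nat -(sE t); congr (eqn S _ t); apply/funext => j; apply: fE.
exists g; split=> [j|h hE].
  exact: etrans (congr1 (fun h : clnHom F S => h (x j)) gE) (fE j).
apply: quotient_hom_epi; rewrite gE; apply: f_uniq => j; exact: hE.
Qed.

(** * Liftings as matrix representations *)

Lemma cV_sum (R : pzRingType) n (x : 'cV[R]_n) : x = \sum_i x i 0 *: delta_mx i 0.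
Proof.
rewrite {1}[x]matrix_sum_delta; apply: eq_bigr => i _.
by rewrite (bigD1 ord0) //= big1 ?addr0 // => j; rewrite ord1 eqxx.
Qed.

Lemma cV_free (R : comNzRingType) n : free_module ('cV[R]_n : lmodType R).
Proof.
exists 'I_n, (fun i => delta_mx i 0); split=> [x|s c s_uniq s0 i si].
  exists [seq (x i 0, i) | i <- enum 'I_n].
  by rewrite big_map big_enum /= {1}[x]cV_sum.
have := congr1 (fun x : 'cV[R]_n => x i 0) s0.
rewrite summxE mxE (bigD1_seq i) //= !mxE !eqxx mulr1 big1 ?addr0 // => j /negPf ij.
by rewrite !mxE eq_sym ij mulr0.
Qed.
Lemma linear_mx (R : comNzRingType) m p (h : {linear 'cV[R]_m -> 'cV[R]_p}) :
  exists g : 'M[R]_(p, m), forall x, h x = g *m x.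
Proof.
exists (\matrix_(i, j) h (delta_mx j 0) i 0) => x.
rewrite {1}[x]cV_sum linear_sum; apply/colP => i; rewrite summxE mxE.
by apply: eq_bigr => j _; rewrite linearZ !mxE mulrC.
Qed.

Lemma mulmx_col_inj (R : comNzRingType) m p (A B : 'M[R]_(p, m)) :
  (forall x : 'cV_m, A *m x = B *m x) -> A = B.
Proof.
move=> AB; apply/matrixP => i j; have := congr1 (fun x : 'cV_p => x i 0) (AB (delta_mx j 0)).
by rewrite -!colE !mxE.
Qed.

Section Representations.
Variables (k : fieldType) (L : falgType k).
Implicit Types R S : comAlgType k.

Record rep R n := Rep {
  rep_fun :> L -> 'M[R]_n;
  rep_lin : forall c a b, rep_fun (c *: a + b) = (c%:A : R) *: rep_fun a + rep_fun b;
  rep1 : rep_fun 1 = 1%:M;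
  repM : forall a b, rep_fun (a * b) = rep_fun a *m rep_fun b }.

Lemma rep_ext R n (r s : rep R n) : (forall a, r a = s a) -> r = s.
Proof.
case: r s => r r1 r2 r3 [s s1 s2 s3] /= /funext rs.
case: _ / rs s1 s2 s3 => s1 s2 s3.
by rewrite (Prop_irrelevance r1 s1) (Prop_irrelevance r2 s2) (Prop_irrelevance r3 s3).
Qed.

Section RepTheory.
Variables (R : comAlgType k) (n : nat) (r : rep R n).

Lemma rep0 : r 0 = 0.
Proof.
by have := rep_lin r (-1) 0 0; rewrite scaler0 addr0 scaleNr !scale1r scaleN1r addNr.
Qed.
Lemma repD a b : r (a + b) = r a + r b.
Proof. by have := rep_lin r 1 a b; rewrite !scale1r. Qed.
Lemma repZ c a : r (c *: a) = (c%:A : R) *: r a.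
Proof. by have := rep_lin r c a 0; rewrite rep0 !addr0. Qed.
Lemma rep_sum (I : Type) (s : seq I) (P : pred I) (F : I -> L) :
  r (\sum_(i <- s | P i) F i) = \sum_(i <- s | P i) r (F i).
Proof. exact: (big_morph r repD rep0). Qed.
End RepTheory.

Lemma lrmorphism_alg R S (f : {lrmorphism R -> S}) (c : k) :
  (f : {rmorphism R -> S}) c%:A = c%:A.
Proof. exact: rmorph_alg. Qed.

Section MapRep.
Variables (R S : comAlgType k) (f : {lrmorphism R -> S}) (n : nat) (r : rep R n).
Lemma map_rep_lin c a b :
  map_mx f (r (c *: a + b)) = (c%:A : S) *: map_mx f (r a) + map_mx f (r b).
Proof. by rewrite rep_lin map_mxD map_mxZ lrmorphism_alg. Qed.
Lemma map_rep1 : map_mx f (r 1) = 1%:M.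
Proof. by rewrite rep1 map_mx1. Qed.
Lemma map_repM a b : map_mx f (r (a * b)) = map_mx f (r a) *m map_mx f (r b).
Proof. by rewrite repM map_mxM. Qed.
Definition map_rep : rep S n := Rep map_rep_lin map_rep1 map_repM.
End MapRep.

Section Bimodule.
Variables (R : comAlgType k) (n : nat) (r : rep R n).
Let M : lmodType R := 'cV[R]_n.
Let rep_act (a : L) (x : M) : M := r a *m x.
Lemma rep_act_linear a : linear (rep_act a).
Proof. by move=> c x y; rewrite /rep_act mulmxDr scalemxAr. Qed.
Lemma rep_act_scale c a b x : rep_act (c *: a + b) x = (c%:A : R) *: rep_act a x + rep_act b x.
Proof. by rewrite /rep_act rep_lin mulmxDl scalemxAl. Qed.
Lemma rep_act1 x : rep_act 1 x = x.
Proof. by rewrite /rep_act rep1 mul1mx. Qed.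
Lemma rep_actM a b x : rep_act (a * b) x = rep_act a (rep_act b x).
Proof. by rewrite /rep_act repM mulmxA. Qed.
Definition rep_bim : bimodule L R :=
  Bimodule rep_act_linear rep_act_scale rep_act1 rep_actM.

Lemma rep_bim_fg : bim_finitely_generated rep_bim.
Proof.
exists n, (fun i => delta_mx i 0 : 'cV[R]_n) => x.
exists [seq ((x : 'cV[R]_n) i 0, 1, i) | i <- enum 'I_n].
rewrite big_map big_enum /= {1}[x in LHS]cV_sum; apply: eq_bigr => i _ /=.
by rewrite rep_act1.
Qed.

End Bimodule.

Section BaseChangeColumns.
Variables (R S : comNzRingType) (f : {rmorphism R -> S}) (n : nat).

Lemma map_cV_semilinear :
  @Defs.semilinear R S f 'cV[R]_n 'cV[S]_n (map_mx f).
Proof. by move=> a x y; rewrite map_mxD map_mxZ. Qed.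

Definition bc_cV : {linear base_change f ('cV[R]_n : lmodType R) -> ('cV[S]_n : lmodType S)} :=
  base_change_lift map_cV_semilinear.

Lemma bc_cVE s x : bc_cV (tensor f s x) = s *: map_mx f x.
Proof. exact: base_change_liftE. Qed.

Definition bc_cV_inv (y : 'cV[S]_n) : base_change f ('cV[R]_n : lmodType R) :=
  \sum_i tensor f (y i 0) (delta_mx i 0 : 'cV[R]_n).

Lemma bc_cVK : cancel bc_cV bc_cV_inv.
Proof.
apply: tensor_ind => [|s x|u v uE vE].
- by rewrite linear0 /bc_cV_inv big1 // => i _; rewrite mxE tensorE scale0r.
- rewrite bc_cVE {2}[x]cV_sum.
  rewrite (big_morph (tensor f s) (@tensorDr _ _ f _ s) (@tensor0r _ _ f _ s)).
  by apply: eq_bigr => i _; rewrite tensorZr !mxE.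
- rewrite linearD -{2}uE -{2}vE -big_split; apply: eq_bigr => i _.
  by rewrite !mxE tensorE scalerDl -!tensorE.
Qed.

Lemma bc_cV_invK : cancel bc_cV_inv bc_cV.
Proof.
move=> y; rewrite linear_sum [RHS]cV_sum; apply: eq_bigr => i _.
by rewrite bc_cVE map_delta_mx.
Qed.

Lemma bc_cV_bij : bijective bc_cV.
Proof. exact: Bijective bc_cVK bc_cV_invK. Qed.
End BaseChangeColumns.

Lemma bc_cV_act R S (f : {lrmorphism R -> S}) n (r : rep R n) a x :
  bc_cV f n (act (bim_base_change f (rep_bim r)) a x) = map_mx f (r a) *m bc_cV f n x.
Proof.
elim/tensor_ind: x => [|s x|u v uE vE].
- by rewrite act0 linear0 mulmx0.
- by rewrite act_tensor !bc_cVE map_mxM scalemxAr.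
- by rewrite actD !linearD uE vE.
Qed.

End Representations.

Section ResidueMatrices.
Variables (k : fieldType) (R : clnAlg k).
Local Notation res := (map_mx (residue R)).

Definition const_mx_cln m n (A : 'M[k^o]_(m, n)) : 'M[R]_(m, n) :=
  map_mx (unit_lrmorphism R) A.

Lemma res_const m n (A : 'M[k^o]_(m, n)) : res (const_mx_cln A) = A.
Proof. by apply/matrixP => i j; rewrite !mxE; apply: residue_alg. Qed.

(** The determinant has residue 1 and is therefore a unit; the inverse is the rescaled adjugate. *)
Lemma mx_inverse_res1 n (A : 'M[R]_n) : res A = 1%:M ->
  exists B, [/\ A *m B = 1%:M, B *m A = 1%:M & res B = 1%:M].
Proof.
move=> A1; have d1 : residue R (\det A) = 1 by rewrite -det_map_mx A1 det1.
have [|d dE] := complete_unit (@cln_complete k R) (x := \det A).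
  by rewrite d1; apply/eqP/oner_neq0.
exists (d *: \adj A); have AB : A *m (d *: \adj A) = 1%:M.
  by rewrite -scalemxAr mul_mx_adj scale_scalar_mx mulrC dE.
split=> //; first by rewrite -scalemxAl mul_adj_mx scale_scalar_mx mulrC dE.
by have := congr1 res AB; rewrite map_mxM A1 mul1mx map_mx1.
Qed.

(** Both products with the constant lift of [B] reduce to 1 and are invertible, which gives a right
    and a left inverse that coincide. The rectangular format serves a change of basis between
    families not yet known to have equal length. *)
Lemma mx_inverse_res m n (A : 'M[R]_(m, n)) (B : 'M[k^o]_(n, m)) :
  res A *m B = 1%:M -> B *m res A = 1%:M ->
  exists C, [/\ A *m C = 1%:M, C *m A = 1%:M & res C = B].
Proof.
move=> AB BA; pose B' := const_mx_cln B.
have [|C [AC CA C1]] := @mx_inverse_res1 m (A *m B').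
  by rewrite map_mxM res_const.
have [|D [AD DA D1]] := @mx_inverse_res1 n (B' *m A).
  by rewrite map_mxM res_const.
have E : D *m B' = B' *m C.
  by rewrite -[LHS]mulmx1 -AC mulmxA -[D *m B' *m _]mulmxA [B' *m _]mulmxA mulmxA DA mul1mx.
exists (B' *m C); split; first by rewrite mulmxA.
  by rewrite -E -mulmxA.
by rewrite map_mxM res_const C1 mulmx1.
Qed.

End ResidueMatrices.

Section Frames.
Variables (k : fieldType) (L : falgType k).

(** A k-basis of V, as coordinates together with the matrices of the action. Compatibility with k is
    contained in [fr_act], because k acts on V through its image in L. *)
Record frame (V : lmodType L) n := Frame {
  fr_rep :> rep L k^o n;
  fr_map : {additive V -> 'cV[k^o]_n};
  fr_inv : 'cV[k^o]_n -> V;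
  fr_mapK : cancel fr_map fr_inv;
  fr_invK : cancel fr_inv fr_map;
  fr_act : forall a v, fr_map (a *: v) = fr_rep a *m fr_map v }.

Section FrameTheory.
Variables (V : lmodType L) (n : nat) (F : frame V n).

Lemma fr_inv_zmod : zmod_morphism (fr_inv F).
Proof. by move=> x y; apply: (can_inj (fr_mapK F)); rewrite raddfB !fr_invK. Qed.
HB.instance Definition _ := GRing.isZmodMorphism.Build _ _ (fr_inv F) fr_inv_zmod.

Lemma rep_scalar (R : comAlgType k) (r : rep L R n) (c : k) : r c%:A = (c%:A : R)%:M.
Proof. by rewrite repZ rep1 scale_scalar_mx mulr1. Qed.

Lemma fr_mapZ (c : k) v : fr_map F ((c%:A : L) *: v) = (c : k^o) *: fr_map F v.
Proof. by rewrite fr_act rep_scalar regular_algE mul_scalar_mx. Qed.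

Lemma fr_inv_act a x : fr_inv F (F a *m x) = a *: fr_inv F x.
Proof. by apply: (can_inj (fr_mapK F)); rewrite fr_act !fr_invK. Qed.
Lemma fr_invZ (c : k^o) x : fr_inv F (c *: x) = ((c : k)%:A : L) *: fr_inv F x.
Proof. by apply: (can_inj (fr_mapK F)); rewrite fr_mapZ !fr_invK. Qed.
End FrameTheory.

Definition is_lift n (r0 : rep L k^o n) (R : clnAlg k) (r : rep L R n) : Prop :=
  forall a, map_mx (residue R) (r a) = r0 a.

Lemma is_lift_map n (r0 : rep L k^o n) (R S : clnAlg k) (f : clnHom R S) (r : rep L R n) :
  is_lift r0 r -> is_lift r0 (map_rep f r).
Proof.
move=> rl a; rewrite -rl; apply/matrixP => i j; rewrite !mxE; exact: hom_residue.
Qed.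

Section RepLifting.
Variables (V : lmodType L) (n : nat) (F : frame V n) (R : clnAlg k).

Section Make.
Variables (r : rep L R n) (rl : is_lift F r).

Definition rep_lift_map : {additive base_change (residue R) (rep_bim r) -> V} :=
  fr_inv F \o bc_cV (residue R) n.

Lemma rep_lift_act a x :
  rep_lift_map (act (bim_base_change (residue R) (rep_bim r)) a x) = a *: rep_lift_map x.
Proof.
by rewrite -[RHS]fr_inv_act -rl -bc_cV_act.
Qed.

Lemma rep_lift_bij : bijective rep_lift_map.
Proof.
apply: bij_comp (bc_cV_bij _ _).
by exists (fr_map F); [apply: fr_invK | apply: fr_mapK].
Qed.

Definition rep_lifting : lifting V R :=
  Lifting (rep_bim_fg r) (@cV_free R n) rep_lift_act rep_lift_bij.

Lemma rep_lifting_mapE s x :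
  lift_map rep_lifting (tensor (residue R) s x) = fr_inv F (s *: map_mx (residue R) x).
Proof. by rewrite -(bc_cVE (residue R)). Qed.
End Make.

Definition conj1 (r s : rep L R n) : Prop :=
  exists g : 'M[R]_n, map_mx (residue R) g = 1%:M /\ forall a, g *m r a = s a *m g.

(** Compatibility of an isomorphism with the two maps to V says precisely that its matrix has
    residue 1; such a matrix is automatically invertible. *)
Lemma lifting_iso_conj1 (r s : rep L R n) (rl : is_lift F r) (sl : is_lift F s) :
  lifting_iso (rep_lifting rl) (rep_lifting sl) <-> conj1 r s.
Proof.
split=> [[h [[_ hE] h1]]|[g [g1 gE]]].
  have [g ghE] := linear_mx h; exists g; split=> [|a].
    apply/matrixP => i j; have := h1 (tensor (residue R) 1 (delta_mx j 0 : 'cV[R]_n)).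
    rewrite base_change_mapE !rep_lifting_mapE !scale1r ghE => /(can_inj (fr_invK F)).
    move=> /(congr1 (fun x : 'cV_n => x i 0)); rewrite -colE !mxE => ->.
    by rewrite eqxx andbT rmorph_nat.
  apply: mulmx_col_inj => x; rewrite -!mulmxA -!ghE.
  exact: (hE a x).
have [g' [gg' g'g _]] := mx_inverse_res1 g1.
have glin : linear (fun x : 'cV[R]_n => g *m x).
  by move=> a x y; rewrite mulmxDr scalemxAr.
exists (make_linear glin : {linear rep_bim r -> rep_bim s}); split; first split.
- by exists (mulmx g') => x; rewrite /= mulmxA ?gg' ?g'g mul1mx.
- by move=> a x; rewrite /= !mulmxA gE.
apply: tensor_ind => [|t x|u v uE vE]; first by rewrite linear0 !raddf0.
- by rewrite base_change_mapE !rep_lifting_mapE /= map_mxM g1 mul1mx.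
- by rewrite linearD !raddfD uE vE.
Qed.

Lemma bim_iso_conj (r s : rep L R n) : bim_iso (rep_bim r) (rep_bim s) ->
  exists g h : 'M[R]_n, [/\ g *m h = 1%:M, h *m g = 1%:M & forall a, g *m r a = s a *m g].
Proof.
move=> [h h_iso]; have [h' [h'_iso hK h'K]] := bim_isomorphism_inv h_iso.
have [g gE] := linear_mx h; have [g' g'E] := linear_mx h'.
exists g, g'; split.
- by apply: mulmx_col_inj => x; rewrite -mulmxA -g'E -gE mul1mx; apply: h'K.
- by apply: mulmx_col_inj => x; rewrite -mulmxA -gE -g'E mul1mx; apply: hK.
move=> a; apply: mulmx_col_inj => x; rewrite -!mulmxA -!gE.
exact: (h_iso.2 a x).
Qed.

End RepLifting.

Lemma rep_lifting_base_change (V : lmodType L) n (F : frame V n) (R S : clnAlg k)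
    (f : clnHom R S) (r : rep L R n) (rl : is_lift F r) (sl : is_lift F (map_rep f r)) :
  lifting_iso (lifting_base_change f (rep_lifting rl)) (rep_lifting sl).
Proof.
exists (bc_cV f n : {linear bim_base_change f (rep_bim r) -> rep_bim (map_rep f r)}).
split; first split.
- exact: bc_cV_bij.
- by move=> a x; rewrite bc_cV_act.
apply: tensor2_ind => [|t s x|u v uE vE]; first by rewrite linear0 !raddf0.
- rewrite lift_bc_mapE base_change_mapE bc_cVE !rep_lifting_mapE.
  rewrite map_mxZ scalerA; congr (fr_inv F (_ *: _)).
  by apply/matrixP => i j; rewrite !mxE; apply: hom_residue.
- by rewrite linearD !raddfD uE vE.
Qed.

End Frames.

(** * Existence of frames *)

Lemma wide_kernel (K : fieldType) b r (A : 'M[K]_(b, r)) :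
  (b < r)%N -> exists2 c : 'cV[K]_r, A *m c = 0 & c != 0.
Proof.
move=> br; have /rowV0Pn [v /sub_kermxP vA v0] : kermx A^T != 0.
  by rewrite kermx_eq0 /row_free neq_ltn (leq_ltn_trans (rank_leq_col _) br).
exists v^T; first by rewrite -[A]trmxK -trmx_mul vA trmx0.
by rewrite -(inj_eq trmx_inj) trmxK trmx0.
Qed.

Lemma make_frame (k : fieldType) (L : falgType k) (V : lmodType L) n
    (m : V -> 'cV[k^o]_n) (w : 'cV[k^o]_n -> V) :
  cancel m w -> cancel w m -> zmod_morphism m ->
  (forall (c : k) v, m ((c%:A : L) *: v) = (c : k^o) *: m v) ->
  exists F : frame V n, forall v, fr_map F v = m v.
Proof.
move=> mK wK mB mZ.
pose mA := GRing.isZmodMorphism.Build _ _ m mB.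
pose ma : {additive V -> 'cV[k^o]_n} := HB.pack m mA.
have mD x y : m (x + y) = m x + m y by exact: (raddfD ma).
have g_lin a : linear (fun y => m (a *: w y)).
  move=> c x y; rewrite -mZ -mD; congr m.
  have -> : w (c *: x + y) = ((c : k)%:A : L) *: w x + w y.
    by apply: (can_inj mK); rewrite mD mZ !wK.
  by rewrite scalerDr !scalerA mulr_algr mulr_algl.
have [r rE] := choice (fun a => linear_mx (make_linear (g_lin a))).
have {}rE a v : ma (a *: v) = r a *m ma v by rewrite -rE /= mK.
have r_inj (A B : 'M[k^o]_n) : (forall v, A *m ma v = B *m ma v) -> A = B.
  by move=> AB; apply: (@mulmx_col_inj k^o) => y; rewrite -[y]wK; apply: AB.
have rl (c : k) a a' : r (c *: a + a') = (c%:A : k^o) *: r a + r a'.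
  apply: r_inj => v; rewrite mulmxDl -scalemxAl -!rE regular_algE.
  by rewrite scalerDl raddfD /= -mZ scalerA mulr_algl.
have r1 : r 1 = 1%:M by apply: r_inj => v; rewrite -rE scale1r mul1mx.
have rM a a' : r (a * a') = r a *m r a'.
  by apply: r_inj => v; rewrite -mulmxA -!rE scalerA.
by exists (@Frame k L V n (Rep rl r1 rM) ma w mK wK rE).
Qed.

Section FrameExistence.
Variables (k : fieldType) (L : falgType k) (V : lmodType L).

Definition kindep r (x : 'I_r -> V) : Prop :=
  forall c : 'I_r -> k, \sum_i ((c i)%:A : L) *: x i = 0 -> forall i, c i = 0.

Variable b : nat.
Hypothesis rank_bound : forall r (x : 'I_r -> V), exists A : 'M[k]_(b, r),
  forall c : 'cV[k]_r, A *m c = 0 -> \sum_i ((c i 0)%:A : L) *: x i = 0.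

(** [rank_bound] isolates what bounds the dimension: a vector in the kernel of a matrix with b rows
    is a linear relation. It is applied to coordinates in a finite k-generating family, and to
    coordinates in an ambient framed module. *)
Lemma kindep_bound r (x : 'I_r -> V) : kindep x -> (r <= b)%N.
Proof.
move=> x_indep; rewrite leqNgt; apply/negP => br.
have [A AE] := rank_bound x; have [c /AE c0 /negP] := wide_kernel A br; case.
by apply/eqP/colP => i; rewrite mxE; apply: (x_indep (fun i => c i 0)).
Qed.

(** An independent family of maximal length spans: a vector outside its span would extend it. *)
Lemma kbasis_exists : exists n (x : 'I_n -> V), kindep x /\
  forall v, exists c : 'I_n -> k, v = \sum_i ((c i)%:A : L) *: x i.
Proof.
pose P n := `[< exists x : 'I_n -> V, kindep x >].
have P0 : exists n, P n by exists 0%N; apply/asboolP; exists (fun=> 0) => c _ [].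
have Pb n : P n -> (n <= b)%N by move=> /asboolP [x /kindep_bound].
have [n /asboolP [x x_indep] n_max] := ex_maxnP P0 Pb.
exists n, x; split=> // v; apply: contrapT => nv.
suff /n_max : P n.+1 by rewrite ltnn.
apply/asboolP; exists (fun i => oapp x v (unlift ord0 i)) => c.
rewrite big_ord_recl unlift_none /= => c0.
have {}c0 : (c ord0)%:A *: v + \sum_i ((c (lift ord0 i))%:A : L) *: x i = 0.
  by rewrite -[RHS]c0; congr (_ + _); apply: eq_bigr => i _; rewrite liftK.
have [cz|cnz] := eqVneq (c ord0) 0.
  move: c0; rewrite cz scale0r scale0r add0r => /x_indep c0 i.
  by case: (unliftP ord0 i) => [j|] ->.
case: nv; exists (fun i => - ((c ord0)^-1 * c (lift ord0 i))).
have E : ((c ord0)^-1%:A : L) *: ((c ord0)%:A *: v) = v.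
  by rewrite scalerA -scalerAl mul1r scalerA mulVf // scale1r scale1r.
have -> : \sum_i ((- ((c ord0)^-1 * c (lift ord0 i)))%:A : L) *: x i =
    - (((c ord0)^-1%:A : L) *: \sum_i ((c (lift ord0 i))%:A : L) *: x i).
  rewrite scaler_sumr -sumrN; apply: eq_bigr => i _.
  by rewrite scaleNr scaleNr; congr (- _); rewrite scalerA -scalerAl mul1r scalerA.
apply/subr0_eq; rewrite opprK -[in LHS]E -scalerDr c0 scaler0 //.
Qed.

Lemma frame_exists : exists n, inhabited (frame V n).
Proof.
have [n [x [x_indep x_span]]] := kbasis_exists.
have [co coE] := choice x_span.
have co_uniq v (c : 'I_n -> k) : v = \sum_i ((c i)%:A : L) *: x i -> forall i, co v i = c i.
  move=> vE i; apply/subr0_eq; apply: (x_indep (fun i => co v i - c i)).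
  under eq_bigr do rewrite !scalerBl.
  by rewrite sumrB -coE -vE subrr.
pose m v : 'cV[k^o]_n := \col_i co v i.
pose w (y : 'cV[k^o]_n) : V := \sum_i ((y i 0 : k)%:A : L) *: x i.
have mK : cancel m w.
  by move=> v; rewrite /w [RHS]coE; apply: eq_bigr => i _; rewrite mxE.
have wK : cancel w m by move=> y; apply/colP => i; rewrite mxE; apply: (co_uniq _ (fun i => y i 0)).
have wB : zmod_morphism w.
  move=> y z; rewrite /w -sumrB; apply: eq_bigr => i _.
  by rewrite !mxE !scalerBl.
have mB : zmod_morphism m by move=> u v; apply: (can_inj wK); rewrite wB !mK.
have wZ (c : k) y : w ((c : k^o) *: y) = (c%:A : L) *: w y.
  rewrite /w scaler_sumr; apply: eq_bigr => i _.
  by rewrite mxE scalerA -scalerAl mul1r scalerA.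
have mZ (c : k) v : m ((c%:A : L) *: v) = (c : k^o) *: m v.
  by apply: (can_inj wK); rewrite wZ !mK.
by have [F _] := make_frame mK wK mB mZ; exists n.
Qed.

End FrameExistence.

Section FrameCriteria.
Variables (k : fieldType) (L : falgType k).

(** Products of a basis of L with generators of V span V over k; coordinates in them are not unique
    but still bound the dimension. *)
Lemma fg_frame (V : lmodType L) : finitely_generated V -> exists n, inhabited (frame V n).
Proof.
move=> [m [g g_span]]; pose N := \dim {:L}.
have [e e_span] : exists e : 'I_m * 'I_N -> V, forall v,
    exists c : 'I_m * 'I_N -> k, v = \sum_ij ((c ij)%:A : L) *: e ij.
  exists (fun ij : 'I_m * 'I_N => (vbasis {:L})`_ij.2 *: g ij.1) => v.
  have [a ->] := g_span v; exists (fun ij => coord (vbasis {:L}) ij.2 (a ij.1)).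
  rewrite -(pair_bigA _ (fun i j => ((coord (vbasis {:L}) j (a i))%:A : L) *:
    ((vbasis {:L})`_j *: g i))) /=.
  apply: eq_bigr => i _; rewrite {1}(coord_vbasis (memvf (a i))) scaler_suml.
  by apply: eq_bigr => j _; rewrite scalerA mulr_algl.
apply: (@frame_exists k L V #|{: 'I_m * 'I_N}|) => r x.
have [c cE] := choice (fun j => e_span (x j)).
exists (\matrix_(i, j) c j (enum_val i)) => y y0.
under eq_bigr do rewrite cE scaler_sumr.
rewrite exchange_big big1 // => ij _.
transitivity (((\sum_j y j 0 * c j ij)%:A : L) *: e ij).
  rewrite !scaler_suml; apply: eq_bigr => j _.
  by rewrite scalerA mulr_algl scalerA.
have := congr1 (fun z : 'cV_ _ => z (enum_rank ij) 0) y0; rewrite !mxE => z0.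
rewrite (_ : \sum_j _ = 0) ?scale0r ?scale0r // -[RHS]z0; apply: eq_bigr => j _.
by rewrite mxE enum_rankK mulrC.
Qed.

Lemma sub_frame (V W : lmodType L) n (F : frame V n) (i : {linear W -> V}) :
  injective i -> exists m, inhabited (frame W m).
Proof.
move=> i_inj; apply: (@frame_exists k L W n) => r x.
exists (\matrix_(p, j) fr_map F (i (x j)) p 0) => c c0.
apply: i_inj; apply: (can_inj (fr_mapK F)); rewrite linear0 linear_sum raddf0 raddf_sum.
apply/colP => p; have := congr1 (fun z : 'cV_ _ => z p 0) c0.
rewrite summxE !mxE => E; rewrite -[RHS]E; apply: eq_bigr => j _.
by rewrite linearZ fr_mapZ !mxE mulrC.
Qed.

Lemma frame_fg (V : lmodType L) n (F : frame V n) : finitely_generated V.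
Proof.
exists n, (fun i => fr_inv F (delta_mx i 0)) => v.
exists (fun i => ((fr_map F v i 0 : k)%:A)).
rewrite -[LHS](fr_mapK F) {1}[fr_map F v]cV_sum raddf_sum.
by apply: eq_bigr => i _; apply: fr_invZ.
Qed.
End FrameCriteria.

(** * Every lift is given by matrices *)

Section LiftingRep.
Variables (k : fieldType) (L : falgType k) (V : lmodType L) (n : nat) (F : frame V n).
Variables (R : clnAlg k) (M : lifting V R).
Local Notation res := (residue R).
Local Notation ten := (tensor (residue R) (M := M)).

Let phi (u : base_change res M) : 'cV[k^o]_n := fr_map F (lift_map M u).

Let phiD u v : phi (u + v) = phi u + phi v.
Proof. by rewrite /phi !raddfD. Qed.
Let phi0 : phi 0 = 0.
Proof. by rewrite /phi !raddf0. Qed.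
Let phi_act a u : phi (act (bim_base_change res M) a u) = F a *m phi u.
Proof. by rewrite /phi lift_act fr_act. Qed.
Let phiZ (c : k^o) u : phi (c *: u) = c *: phi u.
Proof.
have -> : c *: u = act (bim_base_change res M) ((c : k)%:A) u.
  have := @act_scale k L _ (bim_base_change res M) (c : k) 1 0 u.
  rewrite addr0 act1 => ->; have := @act_scale k L _ (bim_base_change res M) (-1) 0 0 u.
  rewrite scaler0 addr0 scaleNr scale1r scaleN1r addNr => ->.
  by rewrite addr0 regular_algE.
by rewrite phi_act rep_scalar regular_algE mul_scalar_mx.
Qed.
Let phi_sum (I : Type) (s : seq I) (P : pred I) G :
  phi (\sum_(i <- s | P i) G i) = \sum_(i <- s | P i) phi (G i).
Proof. exact: (big_morph phi phiD phi0). Qed.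
Let phi_surj y : exists u, phi u = y.
Proof.
have [psi psiK psiK'] := lift_bij M.
by exists (psi (fr_inv F y)); rewrite /phi psiK' fr_invK.
Qed.
Let phi_eq0 u : phi u = 0 -> u = 0.
Proof.
move=> u0; apply: (bij_inj (lift_bij M)); apply: (can_inj (fr_mapK F)).
by rewrite -/(phi u) u0 !raddf0.
Qed.

Let tensor1_surj (u : base_change res M) : exists x : M, u = ten 1 x.
Proof.
elim/tensor_ind: u => [|s x|u v [x ->] [y ->]].
- by exists 0; rewrite tensor0r.
- exists (((s : k)%:A : R) *: x); rewrite tensorZr mul1r; congr (tensor _ _ _).
  by rewrite -[LHS](@residue_alg _ R (residue R)).
- by exists (x + y); rewrite tensorDr.
Qed.

(** The index type of a basis of M is arbitrary, so its finiteness has to be proved. The basis stays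
    independent in k (x)_R M, of dimension n, hence a duplicate-free list of indices has length at
    most n, and a longest one exhausts the index type. *)
Let free_basis : exists m (b : 'I_m -> M) (z : M -> 'cV[R]_m),
  [/\ linear z, forall x, x = \sum_j z x j 0 *: b j
    & forall c : 'cV[k^o]_m, \sum_j c j 0 *: phi (ten 1 (b j)) = 0 -> c = 0].
Proof.
have [I [b [b_span b_free]]] := lift_free M.
have [g gE] := choice (coordinate b_span b_free).
have indep (s : seq I) (c : I -> k^o) : uniq s ->
    \sum_(i <- s) c i *: phi (ten 1 (b i)) = 0 -> forall i, i \in s -> c i = 0.
  move=> s_uniq s0 i si.
  have {}s0 : \sum_(i <- s) c i *: ten 1 (b i) = 0.
    by apply: phi_eq0; rewrite phi_sum -[RHS]s0; apply: eq_bigr => j _; rewrite phiZ.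
  have g_lin : @Defs.semilinear R k^o res M k^o (fun m => res (g i m)).
    by move=> a x y; rewrite linearP rmorphD rmorphM.
  have := congr1 (base_change_lift g_lin) s0.
  rewrite linear_sum linear0.
  rewrite (eq_bigr (fun j => if j == i then c j else 0)); last first.
    move=> j _; rewrite tensorZ mulr1 base_change_liftE gE.
    by case: eqP => _; rewrite ?rmorph1 ?rmorph0 /GRing.scale /= ?mulr1 ?mulr0.
  by rewrite -big_mkcond sum_pred1_seq.
have bound (s : seq I) : uniq s -> (size s <= n)%N.
  move=> s_uniq; rewrite leqNgt; apply/negP => ns.
  case: s => [|i0 s] in s_uniq ns *; first by [].
  set t := i0 :: s in s_uniq ns *.
  have [c c0 /negP []] := wide_kernel
    (\matrix_(p < n, j < size t) phi (ten 1 (b (nth i0 t j))) p 0 : 'M[k^o]_(_, _)) ns.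
  apply/eqP/colP => j; rewrite mxE.
  pose d i := oapp (fun j : 'I_(size t) => c j 0) 0 (insub (index i t)).
  have dE (l : 'I_(size t)) : d (nth i0 t l) = c l 0.
    by rewrite /d index_uniq // valK.
  rewrite -dE; apply: (indep t d s_uniq) => //; last exact: mem_nth.
  rewrite (big_nth i0) big_mkord; apply/colP => p; rewrite summxE.
  have := congr1 (fun z : 'cV_n => z p 0) c0; rewrite !mxE => E; rewrite -[RHS]E.
  by apply: eq_bigr => l _; rewrite !mxE dE mulrC.
have [s [s_uniq s_max]] : exists s : seq I, uniq s /\ forall i, i \in s.
  pose P m := `[< exists s : seq I, uniq s /\ size s = m >].
  have P0 : exists m, P m by exists 0%N; apply/asboolP; exists [::].
  have Pb m : P m -> (m <= n)%N by move=> /asboolP [s [/bound + <-]].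
  have [m /asboolP [s [s_uniq sm]] m_max] := ex_maxnP P0 Pb.
  exists s; split=> // i; apply: contrapT => /negP si.
  suff /m_max : P m.+1 by rewrite ltnn.
  by apply/asboolP; exists (i :: s); rewrite /= si s_uniq sm.
pose z (x : M) : 'cV[R]_(size s) := \col_j g (tnth (in_tuple s) j) x.
have z_lin : linear z by move=> a x y; apply/colP => j; rewrite !mxE linearP.
have zZ a x : z (a *: x) = a *: z x by exact: (linearZ_LR (make_linear z_lin)).
have z_sum J (l : seq J) (G : J -> M) : z (\sum_(i <- l) G i) = \sum_(i <- l) z (G i).
  exact: (linear_sum (make_linear z_lin)).
exists (size s), (fun j => b (tnth (in_tuple s) j)), z; split=> // [x|c c0].
  have [t ->] := b_span x; under [RHS]eq_bigr do rewrite z_sum summxE scaler_suml.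
  rewrite exchange_big; apply: eq_bigr => p _ /=.
  have [j jE] : exists j, tnth (in_tuple s) j = p.2.
    by have /tnthP [j ->] : p.2 \in in_tuple s by []; exists j.
  rewrite (bigD1 j) //= zZ !mxE gE jE eqxx mulr1 big1 ?addr0 // => l lj.
  rewrite !mxE gE -jE eq_sym (inj_eq (tuple_uniqP _ _)) // (negPf lj).
  by rewrite mulr0 scale0r.
apply/colP => j; rewrite mxE.
pose d i := oapp (fun j : 'I_(size s) => c j 0) 0 (insub (index i s)).
have dE (l : 'I_(size s)) : d (tnth (in_tuple s) l) = c l 0.
  by rewrite /d (tnth_nth (tnth (in_tuple s) l)) index_uniq // valK.
rewrite -dE; apply: (indep s d s_uniq); last exact: mem_tnth.
rewrite -[RHS]c0 (big_tnth _ _ s); apply: eq_bigr => l _.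
by rewrite dE.
Qed.

(** Taking preimages x_i of the standard basis vectors makes reduction agree with the coordinates of
    [F] exactly. The matrix [X] expressing them in the given basis is invertible modulo m, hence
    invertible. *)
Lemma lifting_basis : exists (x : 'I_n -> M) (z : M -> 'cV[R]_n),
  [/\ forall v, v = \sum_j z v j 0 *: x j,
      forall y : 'cV[R]_n, z (\sum_j y j 0 *: x j) = y
    & forall y : 'cV[R]_n, phi (ten 1 (\sum_j y j 0 *: x j)) = map_mx res y].
Proof.
have [m [b [z [z_lin z_span b_indep]]]] := free_basis.
have [x xE] : {x : 'I_n -> M & forall i, phi (ten 1 (x i)) = delta_mx i 0}.
  apply: (choice (P := fun i x => phi (ten 1 x) = delta_mx i 0)) => i.
  have [u <-] := phi_surj (delta_mx i 0); have [y ->] := tensor1_surj u.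
  by exists y.
pose X : 'M[R]_(m, n) := \matrix_(j, i) z (x i) j 0.
pose Z : 'M[k^o]_(n, m) := \matrix_(p, j) phi (ten 1 (b j)) p 0.
have phi_span (y : 'I_m -> R) :
    phi (ten 1 (\sum_j y j *: b j)) = \sum_j res (y j) *: phi (ten 1 (b j)).
  rewrite (big_morph (ten 1) (@tensorDr _ _ res _ 1) (@tensor0r _ _ res _ 1)) phi_sum.
  by apply: eq_bigr => j _; rewrite tensorZr mul1r tensorE phiZ.
have phi_spanx (y : 'I_n -> R) : phi (ten 1 (\sum_j y j *: x j)) = \col_j res (y j).
  rewrite (big_morph (ten 1) (@tensorDr _ _ res _ 1) (@tensor0r _ _ res _ 1)) phi_sum.
  rewrite [RHS]cV_sum; apply: eq_bigr => j _.
  by rewrite tensorZr mul1r tensorE phiZ xE mxE.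
have ZX : Z *m map_mx res X = 1%:M.
  apply/matrixP => p i; have := congr1 (fun y : 'cV_n => y p 0) (xE i).
  rewrite [x i]z_span phi_span summxE !mxE eqxx andbT => <-.
  by apply: eq_bigr => j _; rewrite !mxE mulrC.
(* Z kills X Z - 1 because Z X = 1, and a column killed by Z is a relation among the reduced basis
   elements, hence zero. *)
have XZ : map_mx res X *m Z = 1%:M.
  suff /subr0_eq -> : map_mx res X *m Z - 1%:M = 0 by [].
  have : Z *m (map_mx res X *m Z - 1%:M) = 0.
    by rewrite mulmxBr mulmxA ZX mul1mx mulmx1 subrr.
  move: (map_mx res X *m Z - 1%:M) => Y ZY.
  apply/matrixP => i j; rewrite !mxE.
  suff /(congr1 (fun y : 'cV_m => y i 0)) : col j Y = 0 by rewrite !mxE.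
  apply: b_indep; apply/colP => p; rewrite summxE.
  have := congr1 (fun A : 'M_(n, m) => A p j) ZY; rewrite !mxE => E; rewrite -[RHS]E.
  by apply: eq_bigr => l _; rewrite !mxE mulrC.
have [Y [XY YX _]] := mx_inverse_res XZ ZX.
have zE (y : 'cV[R]_n) : z (\sum_j y j 0 *: x j) = X *m y.
  have -> : z (\sum_j y j 0 *: x j) = \sum_j y j 0 *: z (x j).
    transitivity (\sum_j z (y j 0 *: x j)); first exact: (linear_sum (make_linear z_lin)).
    apply: eq_bigr => j _.
    exact: (linearZ_LR (make_linear z_lin)).
  by apply/colP => p; rewrite summxE mxE; apply: eq_bigr => j _; rewrite !mxE mulrC.
have z_inj u v : z u = z v -> u = v by move=> uv; rewrite [u]z_span uv -z_span.
exists x, (fun v => Y *m z v); split=> [v|y|y].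
- by apply: z_inj; rewrite zE mulmxA XY mul1mx.
- by rewrite zE mulmxA YX mul1mx.
- by rewrite phi_spanx; apply/colP => i; rewrite !mxE.
Qed.

Lemma lifting_rep : exists (r : rep L R n) (rl : is_lift F r), lifting_iso (rep_lifting rl) M.
Proof.
have [x [z [z_span zK x_phi]]] := lifting_basis.
pose h (y : 'cV[R]_n) : M := \sum_j y j 0 *: x j.
have h_lin : linear h.
  move=> a u v; rewrite /h scaler_sumr -big_split; apply: eq_bigr => j _.
  by rewrite !mxE scalerDl scalerA.
have hK : cancel h z by move=> y; apply: zK.
have zhK : cancel z h by move=> v; apply: esym (z_span v).
pose g a : {linear 'cV[R]_n -> M} := make_linear (@act_linear _ _ _ M a) \o make_linear h_lin.
have gz_lin a : linear (fun y : 'cV[R]_n => z (g a y)).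
  by move=> c u v; apply: (can_inj hK); rewrite zhK linearP h_lin !zhK.
have [r rE] := choice (fun a => linear_mx (make_linear (gz_lin a))).
have hr a y : h (r a *m y) = act M a (h y) by rewrite -rE /= zhK.
have h_inj := can_inj hK.
have r_lin c a b : r (c *: a + b) = (c%:A : R) *: r a + r b.
  apply: mulmx_col_inj => y; apply: h_inj.
  by rewrite hr act_scale mulmxDl -scalemxAl h_lin !hr.
have r1 : r 1 = 1%:M.
  by apply: mulmx_col_inj => y; apply: h_inj; rewrite hr act1 mul1mx.
have rM a b : r (a * b) = r a *m r b.
  by apply: mulmx_col_inj => y; apply: h_inj; rewrite hr actM -mulmxA !hr.
pose rr := Rep r_lin r1 rM.
have rl : is_lift F rr.
  move=> a; apply/matrixP => i j.
  have E := x_phi (r a *m delta_mx j 0); rewrite -/(h _) hr in E.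
  have : ten 1 (act M a (h (delta_mx j 0))) =
      act (bim_base_change res M) a (ten 1 (h (delta_mx j 0))) by rewrite act_tensor.
  move=> E'; rewrite E' phi_act x_phi map_delta_mx -!colE in E.
  have := congr1 (fun y : 'cV_n => y i 0) E.
  by rewrite !mxE => ->.
exists rr, rl, (make_linear h_lin : {linear rep_bim rr -> M}); split; first split.
- by exists z.
- by move=> a y; rewrite /= -hr.
apply: tensor_ind => [|s y|u v uE vE]; first by rewrite linear0 !raddf0.
- rewrite base_change_mapE rep_lifting_mapE; apply: (can_inj (fr_mapK F)).
  by rewrite fr_invK -x_phi -phiZ tensorZ mulr1.
- by rewrite linearD !raddfD uE vE.
Qed.

End LiftingRep.

(** * Natural isomorphisms, the Yoneda lemma, and correspondences of deformations *)

Section NaturalIsomorphisms.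
Variable k : fieldType.
Implicit Types F G H : functor k.

(** Correspondences are easier to give on representatives. Choice is made here once;
    single-valuedness in both directions makes the choices mutually inverse and natural. *)
Lemma nat_iso_of_rel F G (T : forall R, F R -> G R -> Prop) :
  (forall R (x : F R), exists y, T R x y) ->
  (forall R (y : G R), exists x, T R x y) ->
  (forall R (x : F R) y y', T R x y -> T R x y' -> y = y') ->
  (forall R (x x' : F R) y, T R x y -> T R x' y -> x = x') ->
  (forall R S (f : clnHom R S) x y, T R x y -> T S (fmap f x) (fmap f y)) ->
  naturally_isomorphic F G.
Proof.
move=> Tex Tsurj Tfun Tinj Tnat.
pose eta R x : G R := sval (cid (Tex R x)).
have etaP R x : T R x (eta R x) := svalP (cid (Tex R x)).
exists eta; split=> [R|R S f x].
  pose inv y : F R := sval (cid (Tsurj R y)).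
  have invP y : T R (inv y) y := svalP (cid (Tsurj R y)).
  by exists inv => [x|y]; [apply: Tinj (invP _) (etaP _ _) | apply: Tfun (etaP _ _) (invP _)].
exact: Tfun (etaP _ _) (Tnat _ _ _ _ _ (etaP _ _)).
Qed.

Lemma nat_iso_sym F G : naturally_isomorphic F G -> naturally_isomorphic G F.
Proof.
move=> [eta [eta_bij eta_nat]].
apply: (@nat_iso_of_rel _ _ (fun R y x => eta R x = y)) => [R y|R x|R y x x'|R y y' x|R S f _ x <-].
- by have [inv _ invK] := eta_bij R; exists (inv y).
- by exists (eta R x).
- by move=> <- /(bij_inj (eta_bij R)).
- by move=> <- <-.
- by rewrite eta_nat.
Qed.

Lemma nat_iso_trans F G H :
  naturally_isomorphic F G -> naturally_isomorphic G H -> naturally_isomorphic F H.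
Proof.
move=> [eta [eta_bij eta_nat]] [mu [mu_bij mu_nat]].
exists (fun R => mu R \o eta R); split=> [R|R S f x]; first exact: bij_comp.
by rewrite /= eta_nat mu_nat.
Qed.

(** Every component of eta is composition with the image [g] of the identity of R; the inverse of
    [g] is the element mapped to the identity of S. *)
Lemma hom_functor_iso (R S : clnAlg k) :
  naturally_isomorphic (hom_functor R) (hom_functor S) -> cln_iso R S.
Proof.
move=> [eta [eta_bij eta_nat]].
pose g : clnHom S R := eta R (cln_id R).
have [f fE] : exists f : clnHom R S, eta S f = cln_id S.
  by have [inv _ invK] := eta_bij S; exists (inv (cln_id S)).
have etaE T (h : clnHom R T) : eta T h = cln_comp h g.
  have := eta_nat _ _ h (cln_id R); rewrite /= => <-; congr (eta T _); exact: clnHomP.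
exists f, g; split; last by rewrite -etaE.
apply: (bij_inj (eta_bij R)).
have := eta_nat _ _ g f; rewrite /= fE => ->; exact: clnHomP.
Qed.

End NaturalIsomorphisms.

Section Correspondence.
Variables (k : fieldType) (L : falgType k).

Lemma deformation_rep (V : lmodType L) n (F : frame V n) (R : clnAlg k) (x : deformation V R) :
  exists (r : rep L R n) (rl : is_lift F r), x = deformation_of (rep_lifting rl).
Proof.
elim/deformation_ind: x => M; have [r [rl rM]] := lifting_rep F M.
by exists r, rl; apply/deformation_ofP/lifting_iso_sym.
Qed.

Lemma deformation_rep_eq (V : lmodType L) n (F : frame V n) (R : clnAlg k) (r s : rep L R n)
    (rl : is_lift F r) (sl : is_lift F s) :
  deformation_of (rep_lifting rl) = deformation_of (rep_lifting sl) <-> conj1 r s.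
Proof. exact: iff_trans (deformation_ofP _ _) (lifting_iso_conj1 _ _). Qed.

Lemma deformation_rep_map (V : lmodType L) n (F : frame V n) (R S : clnAlg k)
    (f : clnHom R S) (r : rep L R n) (rl : is_lift F r) :
  deformation_base_change f (deformation_of (rep_lifting rl)) =
  deformation_of (rep_lifting (is_lift_map f rl)).
Proof.
rewrite deformation_base_changeE; apply/deformation_ofP.
exact: rep_lifting_base_change.
Qed.

Lemma conj1_refl (R : clnAlg k) n (r : rep L R n) : conj1 r r.
Proof. by exists 1%:M; rewrite map_mx1; split=> // a; rewrite mul1mx mulmx1. Qed.

Lemma conj1_sym (R : clnAlg k) n (r s : rep L R n) : conj1 r s -> conj1 s r.
Proof.
move=> [g [g1 gE]]; have [h [gh hg h1]] := mx_inverse_res1 g1.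
exists h; split=> // a; rewrite -[LHS]mulmx1 -gh mulmxA -[h *m _ *m g]mulmxA -gE.
by rewrite mulmxA hg mul1mx.
Qed.

Lemma conj1_trans (R : clnAlg k) n (r s t : rep L R n) : conj1 r s -> conj1 s t -> conj1 r t.
Proof.
move=> [g [g1 gE]] [h [h1 hE]]; exists (h *m g); split=> [|a].
  by rewrite map_mxM g1 h1 mul1mx.
by rewrite -mulmxA gE mulmxA hE mulmxA.
Qed.

Lemma conj1_map (R S : clnAlg k) (f : clnHom R S) n (r s : rep L R n) :
  conj1 r s -> conj1 (map_rep f r) (map_rep f s).
Proof.
move=> [g [g1 gE]]; exists (map_mx f g); split=> [|a]; last by rewrite -!map_mxM gE.
by rewrite -g1; apply/matrixP => i j; rewrite !mxE; apply: hom_residue.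
Qed.

(** The common frame of the proofs for V (+) P and for syzygies. [T] may relate one representation
    to many; it only has to match the conjugacy classes of both sides. *)
Lemma deformation_correspondence (V W : lmodType L) n p (F : frame V n) (G : frame W p)
    (T : forall R : clnAlg k, rep L R n -> rep L R p -> Prop) :
  (forall (R : clnAlg k) (r : rep L R n), is_lift F r -> exists2 s, is_lift G s & T R r s) ->
  (forall (R : clnAlg k) (s : rep L R p), is_lift G s -> exists2 r, is_lift F r & T R r s) ->
  (forall (R : clnAlg k) (r r' : rep L R n) (s s' : rep L R p),
     is_lift F r -> is_lift F r' -> is_lift G s -> is_lift G s' ->
     T R r s -> T R r' s' -> conj1 r r' <-> conj1 s s') ->
  (forall (R S : clnAlg k) (f : clnHom R S) (r : rep L R n) (s : rep L R p),
     T R r s -> T S (map_rep f r) (map_rep f s)) ->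
  naturally_isomorphic (deformation_functor V) (deformation_functor W).
Proof.
move=> Tex Tsurj Tconj Tmap.
apply: (@nat_iso_of_rel k (deformation_functor V) (deformation_functor W)
  (fun R x y => exists (r : rep L R n) (rl : is_lift F r) (s : rep L R p) (sl : is_lift G s),
     [/\ x = deformation_of (rep_lifting rl), y = deformation_of (rep_lifting sl) & T R r s])).
- move=> R x; have [r [rl ->]] := deformation_rep F x; have [s sl rs] := Tex _ _ rl.
  by exists (deformation_of (rep_lifting sl)), r, rl, s, sl.
- move=> R y; have [s [sl ->]] := deformation_rep G y; have [r rl rs] := Tsurj _ _ sl.
  by exists (deformation_of (rep_lifting rl)), r, rl, s, sl.
- move=> R x y y' [r [rl [s [sl [-> -> rs]]]]] [r' [rl' [s' [sl' [/deformation_rep_eq rr' -> rs']]]]].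
  by apply/deformation_rep_eq; apply: (Tconj _ r r' s s' rl rl' sl sl' rs rs').1.
- move=> R x x' y [r [rl [s [sl [-> -> rs]]]]] [r' [rl' [s' [sl' [-> /deformation_rep_eq ss' rs']]]]].
  by apply/deformation_rep_eq; apply: (Tconj _ r r' s s' rl rl' sl sl' rs rs').2.
- move=> R S f x y [r [rl [s [sl [-> -> rs]]]]].
  exists (map_rep f r), (is_lift_map f rl), (map_rep f s), (is_lift_map f sl).
  by split; [apply: deformation_rep_map | apply: deformation_rep_map | apply: Tmap].
Qed.

End Correspondence.

(** * Averaging *)

Section Averaging.
Variables (k : fieldType) (L : falgType k).
Local Notation N := (\dim {:L}).
Local Notation e := (fun i : 'I_N => (vbasis {:L})`_i).
Local Notation co := (coord (vbasis {:L})).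

Definition intertwiner (R : comAlgType k) n p (r : rep L R n) (s : rep L R p)
  (T : 'M[R]_(p, n)) : Prop := forall a, T *m r a = s a *m T.

(* [u] is an L-linear section x |-> \sum_i e_i (x) u_i x of the action map
   L (x)_k M -> M; in [inj_data] it is an L-linear retraction
   f |-> \sum_i u_i (f e_i) of the embedding x |-> (a |-> a x) of M in
   Hom_k(L, M). *)
Definition proj_data (R : comAlgType k) n (r : rep L R n) (u : 'I_N -> 'M[R]_n) : Prop :=
  \sum_i r (e i) *m u i = 1%:M /\
  forall a j, u j *m r a = \sum_i ((co j (a * e i))%:A : R) *: u i.

Definition inj_data (R : comAlgType k) n (r : rep L R n) (u : 'I_N -> 'M[R]_n) : Prop :=
  \sum_i u i *m r (e i) = 1%:M /\
  forall a j, r a *m u j = \sum_i ((co j (e i * a))%:A : R) *: u i.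

Lemma intertwiner_inv (R : comAlgType k) n p (r : rep L R n) (s : rep L R p) g h :
  intertwiner r s g -> g *m h = 1%:M -> h *m g = 1%:M -> intertwiner s r h.
Proof.
move=> gE gh hg a.
by rewrite -[LHS]mulmx1 -gh mulmxA -[h *m _ *m g]mulmxA -gE mulmxA hg mul1mx.
Qed.

Section Averages.
Variables (R : comAlgType k) (n : nat) (r : rep L R n) (u : 'I_N -> 'M[R]_n).

(** The composite M -> L (x) M -> L (x) N -> N of the section, id (x) T and the action. *)
Definition proj_avg p (s : rep L R p) (T : 'M[R]_(p, n)) : 'M[R]_(p, n) :=
  \sum_i s (e i) *m T *m u i.

(** The composite N -> Hom(L, N) -> Hom(L, M) -> M of the embedding, composition with T and the
    retraction. *)
Definition inj_avg p (s : rep L R p) (T : 'M[R]_(n, p)) : 'M[R]_(n, p) :=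
  \sum_i u i *m T *m s (e i).

Lemma rep_coord p (s : rep L R p) a : s a = \sum_j ((co j a)%:A : R) *: s (e j).
Proof.
rewrite {1}(coord_vbasis (memvf a)) rep_sum; apply: eq_bigr => j _; exact: repZ.
Qed.

Lemma proj_avg_intertwiner p (s : rep L R p) T : proj_data r u ->
  intertwiner r s (proj_avg s T).
Proof.
move=> [_ uE] a; rewrite /proj_avg mulmx_suml mulmx_sumr.
under eq_bigr do rewrite -mulmxA uE mulmx_sumr.
rewrite exchange_big; apply: eq_bigr => i _; rewrite !mulmxA -repM (rep_coord s (a * _)).
rewrite !mulmx_suml; apply: eq_bigr => j _.
by rewrite -!scalemxAl -!scalemxAr.
Qed.

Lemma inj_avg_intertwiner p (s : rep L R p) T : inj_data r u ->
  intertwiner s r (inj_avg s T).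
Proof.
move=> [_ uE] a; rewrite /inj_avg mulmx_suml mulmx_sumr.
under [RHS]eq_bigr do rewrite !mulmxA uE !mulmx_suml.
rewrite exchange_big; apply: eq_bigr => i _; rewrite -!mulmxA -repM (rep_coord s (_ * a)).
rewrite !mulmx_sumr; apply: eq_bigr => j _.
by rewrite -!scalemxAr -!scalemxAl !mulmxA.
Qed.

Lemma proj_avg_id p (s : rep L R p) T : proj_data r u -> intertwiner r s T -> proj_avg s T = T.
Proof.
move=> [u1 _] TE; rewrite /proj_avg; under eq_bigr do rewrite -TE -mulmxA.
by rewrite -mulmx_sumr u1 mulmx1.
Qed.

Lemma inj_avg_id p (s : rep L R p) T : inj_data r u -> intertwiner s r T -> inj_avg s T = T.
Proof.
move=> [u1 _] TE; rewrite /inj_avg; under eq_bigr do rewrite -mulmxA TE mulmxA.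
by rewrite -mulmx_suml u1 mul1mx.
Qed.

Lemma proj_avg_comp p q (s : rep L R p) (t : rep L R q) Q T :
  intertwiner s t Q -> Q *m proj_avg s T = proj_avg t (Q *m T).
Proof.
move=> QE; rewrite mulmx_sumr; apply: eq_bigr => i _.
by rewrite !mulmxA QE.
Qed.

Lemma inj_avg_comp p q (s : rep L R p) (t : rep L R q) Q T :
  intertwiner t s Q -> inj_avg s T *m Q = inj_avg t (T *m Q).
Proof.
move=> QE; rewrite mulmx_suml; apply: eq_bigr => i _.
by rewrite -!mulmxA QE.
Qed.
End Averages.

Section MapData.
Variables (R S : comAlgType k) (f : {lrmorphism R -> S}) (n : nat) (r : rep L R n).
Variable u : 'I_N -> 'M[R]_n.

Lemma map_mx_sum m p (J : finType) (A : J -> 'M[R]_(m, p)) :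
  map_mx f (\sum_j A j) = \sum_j map_mx f (A j).
Proof. by apply: big_morph => [x y|]; rewrite ?map_mxD ?map_mx0. Qed.

Lemma proj_data_map : proj_data r u -> proj_data (map_rep f r) (fun i => map_mx f (u i)).
Proof.
move=> [u1 uE]; split=> [|a j].
  by rewrite -(map_mx1 f) -u1 map_mx_sum; apply: eq_bigr => i _; rewrite map_mxM.
rewrite -map_mxM uE map_mx_sum; apply: eq_bigr => i _.
by rewrite map_mxZ lrmorphism_alg.
Qed.

Lemma inj_data_map : inj_data r u -> inj_data (map_rep f r) (fun i => map_mx f (u i)).
Proof.
move=> [u1 uE]; split=> [|a j].
  by rewrite -(map_mx1 f) -u1 map_mx_sum; apply: eq_bigr => i _; rewrite map_mxM.
rewrite -map_mxM uE map_mx_sum; apply: eq_bigr => i _.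
by rewrite map_mxZ lrmorphism_alg.
Qed.

Lemma proj_avg_map p (s : rep L R p) T :
  map_mx f (proj_avg u s T) = proj_avg (fun i => map_mx f (u i)) (map_rep f s) (map_mx f T).
Proof. by rewrite map_mx_sum; apply: eq_bigr => i _; rewrite !map_mxM. Qed.

Lemma inj_avg_map p (s : rep L R p) T :
  map_mx f (inj_avg u s T) = inj_avg (fun i => map_mx f (u i)) (map_rep f s) (map_mx f T).
Proof. by rewrite map_mx_sum; apply: eq_bigr => i _; rewrite !map_mxM. Qed.
End MapData.

Lemma proj_data_conj (R : comAlgType k) n (r s : rep L R n) u g h :
  g *m h = 1%:M -> h *m g = 1%:M -> intertwiner r s g -> proj_data r u ->
  proj_data s (fun i => g *m u i *m h).
Proof.
move=> gh hg gE [u1 uE]; split=> [|a j].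
  rewrite -gh -[g in RHS]mulmx1 -u1 mulmx_sumr mulmx_suml; apply: eq_bigr => i _.
  by rewrite !mulmxA gE.
rewrite -mulmxA (intertwiner_inv gE gh hg) mulmxA -[g *m _ *m r a]mulmxA uE mulmx_sumr mulmx_suml.
by apply: eq_bigr => i _; rewrite -scalemxAr -scalemxAl.
Qed.

Lemma inj_data_conj (R : comAlgType k) n (r s : rep L R n) u g h :
  g *m h = 1%:M -> h *m g = 1%:M -> intertwiner r s g -> inj_data r u ->
  inj_data s (fun i => g *m u i *m h).
Proof.
move=> gh hg gE [u1 uE].
have hE := intertwiner_inv gE gh hg.
split=> [|a j].
  rewrite -gh -[g in RHS]mulmx1 -u1 mulmx_sumr mulmx_suml; apply: eq_bigr => i _.
  by rewrite -!mulmxA hE.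
rewrite mulmxA mulmxA -gE -[g *m _ *m u j]mulmxA uE mulmx_sumr mulmx_suml.
by apply: eq_bigr => i _; rewrite -scalemxAr -scalemxAl.
Qed.

Lemma is_liftE (R : clnAlg k) n (r0 : rep L k^o n) (r : rep L R n) :
  is_lift r0 r -> map_rep (residue R) r = r0.
Proof. by move=> rl; apply: rep_ext => a; apply: rl. Qed.

Section Lifts.
Variables (R : clnAlg k) (n : nat) (r0 : rep L k^o n).

Definition const_rep : rep L R n := map_rep (unit_lrmorphism R) r0.

Lemma const_rep_lift : is_lift r0 const_rep.
Proof. by move=> a; apply: res_const. Qed.

(** The identity matrix, averaged between the constant lift and [r], becomes an intertwiner; it
    still reduces to 1, since over k the identity is an intertwiner already. *)
Lemma proj_rep_rigid u (r : rep L R n) : proj_data r0 u -> is_lift r0 r ->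
  conj1 const_rep r.
Proof.
move=> uP rl; have uR := proj_data_map (unit_lrmorphism R) uP.
exists (proj_avg (fun i => map_mx (unit_lrmorphism R) (u i)) r 1%:M); split; last first.
  by move=> a; apply: (proj_avg_intertwiner _ _ uR).
rewrite proj_avg_map map_mx1 (is_liftE rl).
have -> : (fun i => map_mx (residue R) (map_mx (unit_lrmorphism R) (u i))) = u.
  by apply/funext => i; apply: res_const.
by apply: proj_avg_id uP _ => a; rewrite mul1mx mulmx1.
Qed.

Lemma proj_data_lift u (r : rep L R n) : proj_data r0 u -> is_lift r0 r ->
  exists u', proj_data r u'.
Proof.
move=> uP rl; have [g [g1 gE]] := proj_rep_rigid uP rl.
have [h [gh hg _]] := mx_inverse_res1 g1.
have uR := proj_data_map (unit_lrmorphism R) uP.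
by exists (fun i => g *m map_mx (unit_lrmorphism R) (u i) *m h); apply: proj_data_conj uR.
Qed.

Lemma inj_data_lift u v (r : rep L R n) : proj_data r0 u -> inj_data r0 v -> is_lift r0 r ->
  exists v', inj_data r v'.
Proof.
move=> uP vP rl; have [g [g1 gE]] := proj_rep_rigid uP rl.
have [h [gh hg _]] := mx_inverse_res1 g1.
have vR := inj_data_map (unit_lrmorphism R) vP.
by exists (fun i => g *m map_mx (unit_lrmorphism R) (v i) *m h); apply: inj_data_conj vR.
Qed.

(** Averaging commutes with reduction and fixes [T0], so any lift of [T0] as a mere matrix averages
    to a lift as an intertwiner. *)
Lemma proj_intertwiner_lift p (s0 : rep L k^o p) (r : rep L R n) (s : rep L R p) u T0 :
  is_lift r0 r -> is_lift s0 s -> proj_data r u -> intertwiner r0 s0 T0 ->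
  forall T, map_mx (residue R) T = T0 -> map_mx (residue R) (proj_avg u s T) = T0.
Proof.
move=> rl sl uP T0E T TE; rewrite proj_avg_map TE (is_liftE sl).
have := proj_data_map (residue R) uP; rewrite (is_liftE rl) => uP'.
exact: proj_avg_id uP' T0E.
Qed.

Lemma inj_intertwiner_lift p (s0 : rep L k^o p) (r : rep L R n) (s : rep L R p) u T0 :
  is_lift r0 r -> is_lift s0 s -> inj_data r u -> intertwiner s0 r0 T0 ->
  forall T, map_mx (residue R) T = T0 -> map_mx (residue R) (inj_avg u s T) = T0.
Proof.
move=> rl sl uP T0E T TE; rewrite inj_avg_map TE (is_liftE sl).
have := inj_data_map (residue R) uP; rewrite (is_liftE rl) => uP'.
exact: inj_avg_id uP' T0E.
Qed.
End Lifts.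

End Averaging.

(** * Projective and injective modules over a self-injective algebra *)

Section ColumnModules.
Variable A : nzRingType.

Lemma col_map_linear (M : lmodType A) n (x : 'I_n -> M) :
  linear (fun l : 'cV[A]_n => \sum_i l i 0 *: x i).
Proof.
move=> a u v; rewrite scaler_sumr -big_split; apply: eq_bigr => i _.
by rewrite !mxE scalerDl scalerA.
Qed.

Definition col_map (M : lmodType A) n (x : 'I_n -> M) : {linear 'cV[A]_n -> M} :=
  make_linear (col_map_linear x).

Lemma cV_projective n : projective ('cV[A]_n : lmodType A).
Proof.
move=> M N g f g_surj.
have [m mE] := choice (fun i => g_surj (f (delta_mx i 0))).
exists (col_map m) => l; rewrite /= linear_sum [in RHS](cV_sum l) linear_sum.
by apply: eq_bigr => i _; rewrite !linearZ /= mE.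
Qed.

Lemma cV_finitely_generated n : finitely_generated ('cV[A]_n : lmodType A).
Proof. by exists n, (fun i => delta_mx i 0) => l; exists (fun i => l i 0); apply: cV_sum. Qed.

Lemma fg_surjection (V : lmodType A) : finitely_generated V ->
  exists n (g : {linear 'cV[A]_n -> V}), surjective g.
Proof.
move=> [n [x x_span]]; exists n, (col_map x) => v; have [c ->] := x_span v.
by exists (\col_i c i); apply: eq_bigr => i _; rewrite mxE.
Qed.

Lemma fg_projective_summand (P : lmodType A) : finitely_generated P -> projective P ->
  exists n (g : {linear 'cV[A]_n -> P}) (h : {linear P -> 'cV[A]_n}), cancel h g.
Proof.
move=> /fg_surjection [n [g g_surj]] /(_ _ _ g idfun g_surj) [h hE].
by exists n, g, h.
Qed.
End ColumnModules.

Section SelfInjective.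
Variables (k : fieldType) (L : falgType k).
Local Notation N := (\dim {:L}).
Local Notation e i := ((vbasis {:L})`_i).
Local Notation co := (coord (vbasis {:L})).

(** P is a summand of some L^n, and a map into L^n extends coordinate by coordinate because L is
    injective. *)
Lemma fg_projective_injective (P : lmodType L) : self_injective L ->
  finitely_generated P -> projective P -> injective_module P.
Proof.
move=> L_inj P_fg P_proj M M' i f i_inj.
have [n [g [h hK]]] := fg_projective_summand P_fg P_proj.
have comp_lin q : linear (fun x : M => h (f x) q 0 : L^o).
  by move=> a x y; rewrite !linearP !mxE.
have [c cE] := choice (fun q => L_inj M M' i (make_linear (comp_lin q)) i_inj).
have c_lin : linear (fun x : M' => \col_q c q x : 'cV[L]_n).
  by move=> a x y; apply/colP => q; rewrite !mxE linearP.
exists (g \o make_linear c_lin) => x /=; rewrite -[RHS]hK; congr (g _).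
by apply/colP => q; rewrite mxE cE.
Qed.

Section Coinduced.
Variable P : lmodType L.

(* Hom_k(L, P), a map being recorded by its values on the basis of [L]. *)
Definition coind : Type := {ffun 'I_N -> P}.
HB.instance Definition _ := GRing.Zmodule.copy coind {ffun 'I_N -> P}.

(** The action (a f)(b) = f (b a), evaluated at basis elements b. *)
Definition coind_scale (a : L) (f : coind) : coind :=
  [ffun i : 'I_N => \sum_j ((co j (e i * a))%:A : L) *: (f : {ffun 'I_N -> P}) j].

Lemma coord_mul (a b : L) (l : 'I_N) :
  co l (a * b) = \sum_j co j a * co l (e j * b).
Proof.
rewrite {1}(coord_vbasis (memvf a)) mulr_suml linear_sum; apply: eq_bigr => j _.
by rewrite -scalerAl linearZ.
Qed.

Lemma coord_mulr (a b : L) (l : 'I_N) :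
  co l (a * b) = \sum_j co j b * co l (a * e j).
Proof.
rewrite {1}(coord_vbasis (memvf b)) mulr_sumr linear_sum; apply: eq_bigr => j _.
by rewrite -scalerAr linearZ.
Qed.

Lemma coind_scaleA a b f : coind_scale a (coind_scale b f) = coind_scale (a * b) f.
Proof.
apply/ffunP => i; rewrite !ffunE; under eq_bigr do rewrite ffunE scaler_sumr.
rewrite exchange_big; apply: eq_bigr => l _; rewrite mulrA coord_mul.
rewrite !scaler_suml; apply: eq_bigr => j _.
by rewrite scalerA mulr_algl scalerA.
Qed.
Lemma coind_scale1 : left_id 1 coind_scale.
Proof.
move=> f; apply/ffunP => i; rewrite ffunE (bigD1 i) //= big1 => [|j ji].
  rewrite mulr1 (coord_free i i (basis_free (vbasisP _))) eqxx scale1r scale1r addr0 //.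
by rewrite mulr1 (coord_free i j (basis_free (vbasisP _))) eq_sym (negPf ji) scale0r scale0r.
Qed.
Lemma coind_scaleDr : right_distributive coind_scale +%R.
Proof.
move=> a f g; apply/ffunP => i; rewrite !ffunE -big_split; apply: eq_bigr => j _.
by rewrite ffunE scalerDr.
Qed.
Lemma coind_scaleDl f : {morph coind_scale^~ f : a b / a + b}.
Proof.
move=> a b; apply/ffunP => i; rewrite !ffunE -big_split; apply: eq_bigr => j _.
by rewrite mulrDr linearD !scalerDl.
Qed.
HB.instance Definition _ := GRing.Zmodule_isLmodule.Build L coind
  coind_scaleA coind_scale1 coind_scaleDr coind_scaleDl.

Definition coind_incl (x : P) : coind := [ffun i : 'I_N => e i *: x].
Lemma coind_incl_linear : linear coind_incl.
Proof.
move=> a x y; apply/ffunP => i; rewrite !ffunE scalerDr scalerA; congr (_ + _).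
rewrite {1}(coord_vbasis (memvf (e i * a))) scaler_suml; apply: eq_bigr => j _.
by rewrite ffunE scalerA mulr_algl.
Qed.
Lemma coind_incl_inj : injective coind_incl.
Proof.
suff : cancel coind_incl (fun f => \sum_i ((co i 1)%:A : L) *: (f : {ffun 'I_N -> P}) i).
  exact: can_inj.
move=> x; under eq_bigr do rewrite ffunE scalerA mulr_algl.
by rewrite -scaler_suml -(coord_vbasis (memvf 1)) scale1r.
Qed.

Definition coind_at (i : 'I_N) (y : P) : coind := [ffun j => if j == i then y else 0].
Lemma coind_at_sum (f : coind) : f = \sum_i coind_at i ((f : {ffun 'I_N -> P}) i).
Proof.
apply/ffunP => j; rewrite sum_ffunE (bigD1 j) //= ffunE eqxx big1 ?addr0 // => i /negPf ij.
by rewrite ffunE eq_sym ij.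
Qed.
Lemma coind_at_act a j y :
  a *: coind_at j y = \sum_i coind_at i (((co j (e i * a))%:A : L) *: y).
Proof.
rewrite [LHS]coind_at_sum; apply: eq_bigr => i _; congr (coind_at i _).
rewrite ffunE (bigD1 j) //= ffunE eqxx big1 ?addr0 // => l /negPf lj.
by rewrite ffunE lj scaler0.
Qed.
Lemma coind_atB i : zmod_morphism (coind_at i).
Proof. by move=> x y; apply/ffunP => j; rewrite !ffunE; case: eqP; rewrite ?subr0. Qed.
End Coinduced.

Section Data.
Variables (V : lmodType L) (n : nat) (F : frame V n).

Lemma fr_inv_sum (J : Type) (s : seq J) (Q : pred J) G :
  fr_inv F (\sum_(i <- s | Q i) G i) = \sum_(i <- s | Q i) fr_inv F (G i).
Proof. exact: raddf_sum. Qed.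

Lemma frame_mx (f : V -> V) : zmod_morphism f ->
  (forall (c : k) v, f ((c%:A : L) *: v) = (c%:A : L) *: f v) ->
  exists T : 'M[k^o]_n, forall v, fr_map F (f v) = T *m fr_map F v.
Proof.
move=> fB fZ; pose g (y : 'cV[k^o]_n) := fr_map F (f (fr_inv F y)).
have g_lin : linear g.
  move=> a x y; rewrite /g raddfD /= fr_invZ.
  have fD u v : f (u + v) = f u + f v.
    have f0 : f 0 = 0 by have := fB 0 0; rewrite !subrr.
    by rewrite -[v in LHS]opprK fB -[- v]sub0r fB f0 sub0r opprK.
  by rewrite fD fZ raddfD /= fr_mapZ.
have [T TE] := linear_mx (make_linear g_lin).
by exists T => v; rewrite -TE /= /g fr_mapK.
Qed.

(** The surjection from L^n onto V given by the basis of [F] is the action map L (x)_k V -> V.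
    Writing a section of it as v |-> \sum_j e_j (x) u_j v yields the matrices u_j. *)
Lemma proj_data_exists : projective V -> exists u, proj_data F u.
Proof.
move=> V_proj; pose x i := fr_inv F (delta_mx i 0).
have x_span y : fr_inv F y = \sum_q (((y q 0 : k)%:A : L) *: x q).
  by rewrite {1}[y]cV_sum fr_inv_sum; apply: eq_bigr => i _; apply: fr_invZ.
have [|h hE] := V_proj _ _ (col_map x) idfun.
  move=> v; exists (\col_q ((fr_map F v q 0 : k)%:A : L)).
  rewrite /= -[RHS](fr_mapK F) x_span.
  by apply: eq_bigr => q _; rewrite mxE.
pose w (j : 'I_N) v := fr_inv F (\col_q (co j (h v q 0) : k^o)).
have wB j : zmod_morphism (w j).
  move=> a b; rewrite /w -raddfB; congr fr_inv; apply/colP => q.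
  by rewrite !mxE linearB !mxE linearB.
have wZ j (c : k) v : w j ((c%:A : L) *: v) = (c%:A : L) *: w j v.
  rewrite /w -fr_invZ; congr fr_inv; apply/colP => q.
  by rewrite !mxE linearZ !mxE mulr_algl linearZ.
have [u uE] := choice (fun j => frame_mx (wB j) (wZ j)).
have {}uE j y : u j *m y = \col_q (co j (h (fr_inv F y) q 0) : k^o).
  by rewrite -[y in LHS](fr_invK F) -uE fr_invK.
exists u; split=> [|a j]; apply: mulmx_col_inj => y.
  apply: (can_inj (fr_invK F)); rewrite mul1mx mulmx_suml fr_inv_sum.
  rewrite -[RHS]hE /= [RHS]/=.
  under eq_bigr do rewrite -mulmxA fr_inv_act uE x_span scaler_sumr.
  rewrite exchange_big; apply: eq_bigr => q _.
  rewrite [in RHS](coord_vbasis (memvf (h (fr_inv F y) q 0))) scaler_suml.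
  by apply: eq_bigr => i _; rewrite mxE scalerA mulr_algr.
rewrite -mulmxA uE fr_inv_act mulmx_suml; apply/colP => q; rewrite summxE mxE.
rewrite linearZ mxE coord_mulr; apply: eq_bigr => i _.
by rewrite -scalemxAl uE !mxE regular_algE mulrC.
Qed.

(** Injectivity gives a retraction t of V -> Hom_k(L, V); the matrix u_j sends v to the value of t
    at the map that is v on e_j and 0 on the other basis elements. *)
Lemma inj_data_exists : injective_module V -> exists u, inj_data F u.
Proof.
move=> V_inj.
have [t tE] := V_inj _ _ (make_linear (@coind_incl_linear V)) idfun (@coind_incl_inj V).
pose w (j : 'I_N) v := t (coind_at j v).
have wB j : zmod_morphism (w j) by move=> a b; rewrite /w coind_atB linearB.
have wZ j (c : k) v : w j ((c%:A : L) *: v) = (c%:A : L) *: w j v.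
  rewrite /w -linearZ_LR; congr (t _); apply/ffunP => i; rewrite !ffunE.
  rewrite (bigD1 i) //= big1 => [|l li]; rewrite mulr_algr linearZ /=.
    rewrite (coord_free i i (basis_free (vbasisP _))) eqxx mulr1 addr0 ffunE.
    by case: eqP; rewrite ?scaler0.
  rewrite (coord_free i l (basis_free (vbasisP _))) eq_sym (negPf li).
  by rewrite mulr0 !scale0r.
have [u uE] := choice (fun j => frame_mx (wB j) (wZ j)).
have {}uE j v : fr_inv F (u j *m fr_map F v) = w j v by rewrite -uE fr_mapK.
exists u; split=> [|a j]; apply: mulmx_col_inj => y;
    apply: (can_inj (fr_invK F)); rewrite -(fr_invK F y); move: (fr_inv F y) => v.
  rewrite mul1mx mulmx_suml fr_inv_sum fr_mapK.
  transitivity (t (coind_incl v)); last exact: tE.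
  rewrite (coind_at_sum (coind_incl v)) linear_sum.
  apply: eq_bigr => i _; rewrite -mulmxA -fr_act uE /w; congr (t (coind_at i _)).
  by rewrite ffunE.
rewrite -mulmxA fr_inv_act uE mulmx_suml fr_inv_sum /w -linearZ_LR coind_at_act linear_sum.
apply: eq_bigr => i _; rewrite -scalemxAl regular_algE fr_invZ uE.
by rewrite -[RHS]wZ.
Qed.
End Data.

End SelfInjective.

(** * Stable endomorphisms, their lifts, and weak deformations *)

Section Stable.
Variables (k : fieldType) (L : falgType k).

Definition endo_of (V : lmodType L) (f : {linear V -> V}) : endo V := f.

(** The stable endomorphism ring is k exactly when its identity spans it and is nonzero; this is the
    form in which the hypothesis is used and re-established. *)
Lemma stable_scalarP (V : lmodType L) :
  stable_endo_is_scalar V <->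
  (forall f : endo V, exists c : k, factors_through_projective (f - c *: (1 : endo V))) /\
  ~ factors_through_projective (1 : endo V).
Proof.
have classZ c f : stable_class (c *: f : endo V) = c *: stable_class f.
  by rewrite -stable_scaleE.
have classB (f g : endo V) : stable_class (f - g) = stable_class f - stable_class g.
  by rewrite stable_classD -stable_oppE.
have class0 (f : endo V) : stable_class f = 0 <-> factors_through_projective f.
  by rewrite -[0]/(stable_class 0) stable_classP subr0.
have class1 : stable_class (1 : endo V) = 1 by [].
split=> [[F [F_bij FZ]]|[V_scalar V1]].
  have F_eq0 u : F u = 0 -> u = 0 by rewrite -(rmorph0 F) => /(bij_inj F_bij).
  split=> [f|/class0 one0].
    exists (F (stable_class f)); apply/class0/F_eq0.
    by rewrite classB rmorphB classZ FZ class1 rmorph1 mulr1 subrr.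
  have /eqP : 1 = 0 :> k by rewrite -(rmorph1 F) -(rmorph0 F) -class1 one0.
  by rewrite oner_eq0.
have ex u : exists c : k, u = c *: (1 : stable_endo V).
  elim/stable_ind: u => f; have [c /class0] := V_scalar f.
  by rewrite classB classZ => /subr0_eq fc; exists c.
have [F FE] := choice ex.
have uniq (c d : k) : c *: (1 : stable_endo V) = d *: (1 : stable_endo V) -> c = d.
  move=> /eqP; rewrite -subr_eq0 -scalerBl => /eqP cd; apply/subr0_eq/eqP.
  apply: contrapT => /negP cd0; apply/V1/class0.
  by rewrite class1 -[1](scalerK cd0) cd scaler0.
have mulZ (c d : k) : (c *: (1 : stable_endo V)) * (d *: (1 : stable_endo V)) =
    (c * d) *: (1 : stable_endo V).
  have E (a : k) : a *: (1 : stable_endo V) = stable_class (a *: (1 : endo V)) by rewrite classZ.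
  transitivity (stable_class ((c *: (1 : endo V)) * (d *: (1 : endo V)))).
    by rewrite -stable_mulE !E.
  rewrite E; congr stable_class; apply: endoP => x.
  by rewrite endoM !endoZ !endo1 scalerA mulr_algl scalerA.
have FB : zmod_morphism F.
  by move=> u v; apply: uniq; rewrite -FE scalerBl -!FE.
have FM : monoid_morphism F.
  split; first by apply: uniq; rewrite -FE scale1r.
  by move=> u v; apply: uniq; rewrite -FE -mulZ -!FE.
pose FA := GRing.isZmodMorphism.Build _ _ F FB.
pose FR := GRing.isMonoidMorphism.Build _ _ F FM.
pose FF : {rmorphism stable_endo V -> k} := HB.pack F FA FR.
exists FF; split=> [|c u]; last by apply: uniq; rewrite /= -FE {1}(FE u) scalerA.
exists (fun c => c *: (1 : stable_endo V)) => [u|c]; first by rewrite /= -FE.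
by apply: uniq; rewrite /= -FE.
Qed.

(** The given projective module may be infinite dimensional. Its map to V lifts through a surjection
    from some L^n, so L^n, which has a frame, can replace it. *)
Lemma fproj_column (V : lmodType L) (f : endo V) : finitely_generated V ->
  factors_through_projective f ->
  exists n (g : {linear V -> 'cV[L]_n}) (h : {linear 'cV[L]_n -> V}), forall x, f x = h (g x).
Proof.
move=> /fg_surjection [n [m m_surj]] [P [g [h [P_proj fE]]]].
have [h' h'E] := P_proj _ _ m h m_surj.
by exists n, (h' \o g), m => x; rewrite fE /= h'E.
Qed.

Lemma frame_hom (V W : lmodType L) n p (F : frame V n) (G : frame W p) (f : {linear V -> W}) :
  exists2 T, intertwiner F G T & forall v, fr_map G (f v) = T *m fr_map F v.
Proof.
pose g (y : 'cV[k^o]_n) := fr_map G (f (fr_inv F y)).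
have g_lin : linear g.
  by move=> a x y; rewrite /g raddfD /= fr_invZ linearP raddfD /= fr_mapZ.
have [T TE] := linear_mx (make_linear g_lin).
have {}TE v : fr_map G (f v) = T *m fr_map F v by rewrite -TE /= /g fr_mapK.
exists T => // a; apply: mulmx_col_inj => y; rewrite -(fr_invK F y) -!mulmxA -fr_act.
by rewrite -!TE linearZ /= fr_act.
Qed.

Lemma hom_frame (V W : lmodType L) n p (F : frame V n) (G : frame W p) T :
  intertwiner F G T ->
  exists f : {linear V -> W}, forall v, fr_map G (f v) = T *m fr_map F v.
Proof.
move=> TE; have f_lin : linear (fun v => fr_inv G (T *m fr_map F v)).
  move=> a u v; apply: (can_inj (fr_mapK G)).
  rewrite fr_invK (raddfD (fr_map F)) /= fr_act (raddfD (fr_map G)) /= fr_act !fr_invK.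
  by rewrite mulmxDr !mulmxA TE.
by exists (make_linear f_lin) => v; rewrite fr_invK.
Qed.

Definition endo_lifting n (r0 : rep L k^o n) : Prop :=
  forall (R : clnAlg k) (r : rep L R n), is_lift r0 r ->
  forall T0, intertwiner r0 r0 T0 ->
  exists2 T, intertwiner r r T & map_mx (residue R) T = T0.

Lemma stable_endo_lifting (V : lmodType L) n (F : frame V n) :
  self_injective L -> stable_endo_is_scalar V -> endo_lifting F.
Proof.
move=> L_inj /stable_scalarP [V_scalar _] R r rl T0 T0E.
have [f fE] := hom_frame T0E.
have [c /(fproj_column (frame_fg F)) [m [g [h fgh]]]] := V_scalar f.
have [p [G]] := fg_frame (cV_finitely_generated L m).
have [u uP] := proj_data_exists G (@cV_projective L m).
have [v vP] := inj_data_exists G (fg_projective_injective L_inj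
  (@cV_finitely_generated L m) (@cV_projective L m)).
have [A AE AgE] := frame_hom F G g; have [B BE BhE] := frame_hom G F h.
have T0_eq : T0 = c%:M + B *m A.
  apply: mulmx_col_inj => y; rewrite -(fr_invK F y); move: (fr_inv F y) => x.
  rewrite -fE mulmxDl -mulmxA -AgE -BhE -fgh endoD endoN endoZ endo1 raddfB /= fr_mapZ.
  by rewrite mul_scalar_mx addrC subrK.
have uR := proj_data_map (unit_lrmorphism R) uP.
have vR := inj_data_map (unit_lrmorphism R) vP.
have cl := const_rep_lift R G.
(* The factors are lifted separately through the constant lift of L^m: [A] maps into L^m, which is
   injective by self-injectivity, and [B] maps out of it. *)
pose A' := inj_avg (fun i => map_mx (unit_lrmorphism R) (v i)) r (const_mx_cln R A).
pose B' := proj_avg (fun i => map_mx (unit_lrmorphism R) (u i)) r (const_mx_cln R B).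
have A'E : intertwiner r (const_rep R G) A' by exact: inj_avg_intertwiner vR.
have B'E : intertwiner (const_rep R G) r B' by exact: proj_avg_intertwiner uR.
exists ((c%:A : R)%:M + B' *m A') => [a|].
  rewrite mulmxDl mulmxDr mul_scalar_mx mul_mx_scalar; congr (_ + _).
  by rewrite -mulmxA A'E mulmxA B'E mulmxA.
have B'1 : map_mx (residue R) B' = B.
  by apply: proj_intertwiner_lift cl rl uR BE _ _; apply: res_const.
have A'1 : map_mx (residue R) A' = A.
  by apply: inj_intertwiner_lift cl rl vR AE _ _; apply: res_const.
rewrite map_mxD map_scalar_mx map_mxM B'1 A'1 T0_eq /=.
by rewrite (@residue_alg _ R (residue R)).
Qed.

Lemma weak_deformation_iso (V : lmodType L) n (F : frame V n) : endo_lifting F ->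
  naturally_isomorphic (deformation_functor V) (weak_deformation_functor V).
Proof.
move=> F_lift.
apply: (@nat_iso_of_rel k (deformation_functor V) (weak_deformation_functor V)
  (fun R x y => exists2 M, x = deformation_of M & y = weak_deformation_of M)).
- by move=> R; elim/deformation_ind=> M; exists (weak_deformation_of M), M.
- by move=> R; elim/weak_deformation_ind=> M; exists (deformation_of M), M.
- move=> R x y y' [M -> ->] [M' /deformation_ofP [h [h_iso _]] ->].
  by apply/weak_deformation_ofP; exists h.
- move=> R x x' y [M -> ->] [M' -> /weak_deformation_ofP MM'].
  have [r [rl rM]] := lifting_rep F M; have [s [sl sM]] := lifting_rep F M'.
  have /bim_iso_conj [g [h [gh hg gE]]] : bim_iso (rep_bim r) (rep_bim s).
    have [i [i_iso _]] := rM; have [j [j_iso _]] := sM.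
    apply: bim_iso_trans (bim_iso_trans MM' (bim_iso_sym _)); last by exists j.
    by exists i.
  apply/deformation_ofP; apply: lifting_iso_trans (lifting_iso_sym rM) _.
  apply: lifting_iso_trans sM; apply/lifting_iso_conj1.
  (* Both [r] and [s] reduce to [F], so the residue of the inverse [h] of [g] is an endomorphism of
     V. Its lift [T] to [r] corrects [g] to [g *m T], which has residue 1. *)
  have [|T TE T1] := F_lift _ _ rl (map_mx (residue R) h).
    move=> a; rewrite -{1}(sl a) -(rl a) -!map_mxM; congr map_mx.
    by rewrite -[LHS]mulmx1 -gh mulmxA -[h *m _ *m g]mulmxA -gE mulmxA hg mul1mx.
  exists (g *m T); split; first by rewrite map_mxM T1 -map_mxM gh map_mx1.
  by move=> a; rewrite -mulmxA TE mulmxA gE mulmxA.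
- move=> R S f x y [M -> ->]; exists (lifting_base_change f M).
    exact: deformation_base_changeE.
  exact: weak_base_changeE.
Qed.

End Stable.

(** * The slice *)

(** [w] records the values on matrix units of the inverse of the commutator map on its image,
    extended to the whole space. Unlike that map, these constant matrices make sense over every
    R. *)
Lemma commutator_pinv (K : fieldType) N n (A : 'I_N -> 'M[K]_n) :
  exists w : 'I_N -> 'I_n -> 'I_n -> 'M[K]_n, forall c : 'M[K]_n,
    let alpha i := A i *m c - c *m A i in
    let c' := \sum_i \sum_p \sum_q alpha i p q *: w i p q in
    forall i, A i *m c' - c' *m A i = alpha i.
Proof.
pose D (c : 'M[K]_n) : {ffun 'I_N -> 'M[K]_n} := [ffun i => A i *m c - c *m A i].
have D_lin : linear D.
  move=> a x y; apply/ffunP => i; rewrite !ffunE mulmxDr mulmxDl -scalemxAr -scalemxAl.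
  by rewrite opprD addrACA scalerBr.
pose f := linfun (make_linear D_lin).
have fE c : f c = D c by rewrite lfunE.
pose at_ i p q : {ffun 'I_N -> 'M[K]_n} := [ffun j => if j == i then delta_mx p q else 0].
exists (fun i p q => (f^-1)%VF (at_ i p q)) => c alpha c' i.
have -> : c' = (f^-1)%VF (D c).
  have -> : D c = \sum_i \sum_p \sum_q alpha i p q *: at_ i p q.
    apply/ffunP => j; rewrite sum_ffunE (bigD1 j) //=.
    rewrite [X in _ + X]big1 ?addr0 => [|l lj]; last first.
      rewrite sum_ffunE big1 // => p _; rewrite sum_ffunE big1 // => q _.
      by rewrite !ffunE eq_sym (negPf lj) scaler0.
    rewrite ffunE sum_ffunE -/(alpha j) {1}[alpha j]matrix_sum_delta.
    apply: eq_bigr => p _; rewrite sum_ffunE; apply: eq_bigr => q _.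
    by rewrite !ffunE eqxx.
  rewrite linear_sum; apply: eq_bigr => j _; rewrite linear_sum; apply: eq_bigr => p _.
  by rewrite linear_sum; apply: eq_bigr => q _; rewrite linearZ.
have := limg_lfunVK (memv_img f (memvf c)); rewrite !fE => /(congr1 (fun g : {ffun _} => g i)).
by rewrite !ffunE.
Qed.

Section MatrixFiltration.
Variables (k : fieldType) (R : clnAlg k).

Definition mpw m n j (A : 'M[R]_(m, n)) : Prop := forall p q, pw j (A p q).

Lemma mpw0 m n (A : 'M[R]_(m, n)) : mpw 0 A.
Proof. by move=> p q; apply: pw0. Qed.
Lemma mpwD m n j (A B : 'M[R]_(m, n)) : mpw j A -> mpw j B -> mpw j (A + B).
Proof. by move=> Aj Bj p q; rewrite mxE; apply: pwD. Qed.
Lemma mpwN m n j (A : 'M[R]_(m, n)) : mpw j A -> mpw j (- A).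
Proof. by move=> Aj p q; rewrite mxE; apply: pwN. Qed.
Lemma mpwB m n j (A B : 'M[R]_(m, n)) : mpw j A -> mpw j B -> mpw j (A - B).
Proof. by move=> Aj Bj; apply: mpwD => //; apply: mpwN. Qed.
Lemma mpwM m n p i j (A : 'M[R]_(m, n)) (B : 'M[R]_(n, p)) :
  mpw i A -> mpw j B -> mpw (i + j) (A *m B).
Proof. by move=> Ai Bj r s; rewrite mxE; apply: pw_sum => l _; apply: pwM. Qed.
Lemma mpwMl m n p j (A : 'M[R]_(m, n)) (B : 'M[R]_(n, p)) : mpw j B -> mpw j (A *m B).
Proof. exact: mpwM (mpw0 A). Qed.
Lemma mpwMr m n p j (A : 'M[R]_(m, n)) (B : 'M[R]_(n, p)) : mpw j A -> mpw j (A *m B).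
Proof. by move=> Aj; rewrite -[j]addn0; apply: mpwM Aj (mpw0 B). Qed.
Lemma mpw_le m n i j (A : 'M[R]_(m, n)) : (i <= j)%N -> mpw j A -> mpw i A.
Proof. by move=> ij Aj p q; apply: pw_le ij (Aj p q). Qed.
Lemma mpw1 m n (A B : 'M[R]_(m, n)) :
  mpw 1 (A - B) <-> map_mx (residue R) A = map_mx (residue R) B.
Proof.
split=> [AB|AB p q].
  by apply/matrixP => p q; have /pw1 := AB p q; rewrite !mxE rmorphB /= => /subr0_eq.
apply/pw1; have := congr1 (fun C : 'M_(m, n) => C p q) AB.
by rewrite !mxE rmorphB /= => ->; rewrite subrr.
Qed.
Lemma mpw_eq0 m n (A : 'M[R]_(m, n)) : (forall j, mpw j A) -> A = 0.
Proof. by move=> Aj; apply/matrixP => p q; rewrite mxE; apply: pw_eq0 => j; apply: Aj. Qed.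

Lemma mpw_lim m n (u : nat -> 'M[R]_(m, n)) : (forall j, mpw j (u j.+1 - u j)) ->
  exists A, forall j, mpw j (A - u j).
Proof.
move=> uP.
have lim (pq : 'I_m * 'I_n) : exists x, forall j, pw j (x - u j pq.1 pq.2).
  by apply: pw_lim => j; have := uP j pq.1 pq.2; rewrite !mxE.
have [x xE] := choice lim; exists (\matrix_(p, q) x (p, q)) => j p q.
by have := xE (p, q) j; rewrite !mxE.
Qed.
End MatrixFiltration.

Lemma conj1_eq (k : fieldType) (L : falgType k) (R : clnAlg k) n (r s : rep L R n) :
  (forall a, r a = s a) -> conj1 r s.
Proof. by move=> rs; exists 1%:M; rewrite map_mx1; split=> // a; rewrite mul1mx mulmx1. Qed.

Section ConjRep.
Variables (k : fieldType) (L : falgType k) (R : comAlgType k) (n : nat) (r : rep L R n).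
Variables (g h : 'M[R]_n).
Hypotheses (gh : g *m h = 1%:M) (hg : h *m g = 1%:M).
Lemma conj_rep_lin c a b :
  g *m r (c *: a + b) *m h = (c%:A : R) *: (g *m r a *m h) + g *m r b *m h.
Proof. by rewrite rep_lin mulmxDr mulmxDl -scalemxAr -scalemxAl. Qed.
Lemma conj_rep1 : g *m r 1 *m h = 1%:M.
Proof. by rewrite rep1 mulmx1. Qed.
Lemma conj_repM a b : g *m r (a * b) *m h = (g *m r a *m h) *m (g *m r b *m h).
Proof. by rewrite repM !mulmxA -[_ *m h *m g]mulmxA hg mulmx1. Qed.
Definition conj_rep : rep L R n := Rep conj_rep_lin conj_rep1 conj_repM.
Lemma conj_repE a : g *m r a = conj_rep a *m g.
Proof. by rewrite /= -[RHS]mulmxA hg mulmx1. Qed.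
End ConjRep.

Section Slice.
Variables (k : fieldType) (L : falgType k) (n : nat) (r0 : rep L k^o n).
Local Notation N := (\dim {:L}).
Local Notation e i := ((vbasis {:L})`_i).
Local Notation co := (coord (vbasis {:L})).

Variable w : 'I_N -> 'I_n -> 'I_n -> 'M[k^o]_n.
Hypothesis wP : forall c : 'M[k^o]_n,
  let alpha (i : 'I_N) := r0 (e i) *m c - c *m r0 (e i) in
  let c' := \sum_i \sum_p \sum_q alpha i p q *: w i p q in
  forall i : 'I_N, r0 (e i) *m c' - c' *m r0 (e i) = alpha i.

Section Operators.
Variable R : comAlgType k.
Local Notation iota := (map_mx (unit_lrmorphism R)).

(* Up to sign [Dop] is the differential at [r0] of conjugation; by [wP] the map
   [Wop] is a generalized inverse, so that [Wop \o Dop] is a projection with the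
   commutant of [r0] as its kernel. *)
Definition Dop (c : 'M[R]_n) (i : 'I_N) : 'M[R]_n :=
  iota (r0 (e i)) *m c - c *m iota (r0 (e i)).
Definition Wop (alpha : 'I_N -> 'M[R]_n) : 'M[R]_n :=
  \sum_i \sum_p \sum_q alpha i p q *: iota (w i p q).

Lemma Dop_lin a x y i : Dop (a *: x + y) i = a *: Dop x i + Dop y i.
Proof.
by rewrite /Dop mulmxDr mulmxDl -scalemxAr -scalemxAl opprD addrACA scalerBr.
Qed.
Lemma Wop_lin a alpha beta :
  Wop (fun i => a *: alpha i + beta i) = a *: Wop alpha + Wop beta.
Proof.
rewrite /Wop scaler_sumr -big_split; apply: eq_bigr => i _.
rewrite scaler_sumr -big_split; apply: eq_bigr => p _.
rewrite scaler_sumr -big_split; apply: eq_bigr => q _.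
by rewrite !mxE scalerDl scalerA.
Qed.
Lemma Wop_eq alpha beta : (forall i, alpha i = beta i) -> Wop alpha = Wop beta.
Proof. by move=> ab; rewrite /Wop; under eq_bigr do rewrite ab. Qed.
Lemma Dop0 i : Dop 0 i = 0.
Proof. by rewrite /Dop mulmx0 mul0mx subrr. Qed.
Lemma Wop0 : Wop (fun=> 0) = 0.
Proof.
rewrite /Wop big1 // => i _; rewrite big1 // => p _; rewrite big1 // => q _.
by rewrite mxE scale0r.
Qed.
Lemma DopB (x y : 'M[R]_n) i : Dop (x - y) i = Dop x i - Dop y i.
Proof. by rewrite addrC -scaleN1r Dop_lin scaleN1r addrC. Qed.
Lemma WopB (alpha beta : 'I_N -> 'M[R]_n) :
  Wop (fun i => alpha i - beta i) = Wop alpha - Wop beta.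
Proof.
rewrite [RHS]addrC -scaleN1r -Wop_lin; apply: Wop_eq => i.
by rewrite scaleN1r addrC.
Qed.

End Operators.

Lemma unit_lrmorphismE (R S : comAlgType k) (f : {lrmorphism R -> S}) m p (A : 'M[k^o]_(m, p)) :
  map_mx f (map_mx (unit_lrmorphism R) A) = map_mx (unit_lrmorphism S) A.
Proof. by apply/matrixP => i j; rewrite !mxE; apply: rmorph_alg. Qed.

Lemma unit_self m p (A : 'M[k^o]_(m, p)) : map_mx (unit_lrmorphism k^o) A = A.
Proof. by apply/matrixP => i j; rewrite !mxE; apply: regular_algE. Qed.

Lemma Dop_map (R S : comAlgType k) (f : {lrmorphism R -> S}) c i :
  map_mx f (Dop c i) = Dop (map_mx f c) i.
Proof. by rewrite /Dop map_mxB !map_mxM !unit_lrmorphismE. Qed.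

Lemma Wop_map (R S : comAlgType k) (f : {lrmorphism R -> S}) alpha :
  map_mx f (Wop alpha) = Wop (fun i => map_mx f (alpha i)).
Proof.
rewrite /Wop map_mx_sum; apply: eq_bigr => i _; rewrite map_mx_sum; apply: eq_bigr => p _.
rewrite map_mx_sum; apply: eq_bigr => q _.
by rewrite map_mxZ unit_lrmorphismE mxE.
Qed.

(** Both sides are R-linear in [c], so matrix units suffice; these come from k, where the identity
    is [wP]. *)
Lemma DWD (R : comAlgType k) (c : 'M[R]_n) i : Dop (Wop (Dop c)) i = Dop c i.
Proof.
have base (c0 : 'M[k^o]_n) : Dop (Wop (Dop c0)) i = Dop c0 i.
  have DE (x : 'M[k^o]_n) j : Dop x j = r0 (e j) *m x - x *m r0 (e j).
    by rewrite /Dop unit_self.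
  have := wP c0 i; rewrite /= -!DE => <-; congr (Dop _ i).
  apply: eq_bigr => j _; apply: eq_bigr => p _; apply: eq_bigr => q _.
  by rewrite DE unit_self.
pose E (x : 'M[R]_n) := Dop (Wop (Dop x)) i - Dop x i.
have E_lin : linear E.
  move=> a x y; rewrite /E -(Wop_eq (alpha := fun j => a *: Dop x j + Dop y j)).
    by rewrite Wop_lin !Dop_lin opprD addrACA -scalerBr.
  by move=> j; rewrite Dop_lin.
apply/subr0_eq; rewrite -/(E c) -[E]/(make_linear E_lin : _ -> _) [c]matrix_sum_delta.
rewrite linear_sum big1 // => p _; rewrite linear_sum big1 // => q _.
rewrite linearZ_LR /= /E; have -> : delta_mx p q = map_mx (unit_lrmorphism R) (delta_mx p q).
  by rewrite map_delta_mx.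
rewrite -(Wop_eq (alpha := fun j => map_mx (unit_lrmorphism R) (Dop (delta_mx p q) j))).
  by rewrite -Wop_map -!Dop_map base subrr scaler0.
by move=> j; rewrite Dop_map.
Qed.

Definition deviation (R : comAlgType k) (r : rep L R n) (i : 'I_N) : 'M[R]_n :=
  r (e i) - map_mx (unit_lrmorphism R) (r0 (e i)).

(** By [DWD], D W is a projection onto the image of D, the tangent directions of conjugation at
    [r0]. The slice asks this component of the deviation to vanish; the equations are linear with
    coefficients in k. *)
Definition in_slice (R : comAlgType k) (r : rep L R n) : Prop :=
  forall i, Dop (Wop (deviation r)) i = 0.

Section Filtered.
Variable R : clnAlg k.
Local Notation iota := (map_mx (unit_lrmorphism R)).

Lemma mpw_Dop j (c : 'M[R]_n) i : mpw j c -> mpw j (Dop c i).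
Proof. by move=> cj; apply: mpwB; [apply: mpwMl | apply: mpwMr]. Qed.

Lemma mpw_Wop j (alpha : 'I_N -> 'M[R]_n) : (forall i, mpw j (alpha i)) -> mpw j (Wop alpha).
Proof.
move=> aj p q; rewrite summxE; apply: pw_sum => i _; rewrite summxE; apply: pw_sum => s _.
rewrite summxE; apply: pw_sum => t _; rewrite mxE mulrC; apply: pwMl; exact: aj.
Qed.

Lemma lift_deviation (r : rep L R n) i : is_lift r0 r -> mpw 1 (deviation r i).
Proof. by move=> rl; apply/mpw1; rewrite rl res_const. Qed.

(* If [(1 + c) r = s (1 + c)], the difference below is [s - r + Dop c]. *)
Lemma commutation_expand j (r s : rep L R n) (c : 'M[R]_n) (i : 'I_N) :
  is_lift r0 r -> is_lift r0 s -> mpw j c ->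
  mpw j.+1 (c *m r (e i) - s (e i) *m c + Dop c i).
Proof.
move=> rl sl cj.
have -> : c *m r (e i) - s (e i) *m c + Dop c i =
    c *m deviation r i - deviation s i *m c.
  rewrite /Dop /deviation mulmxBr mulmxBl opprB.
  rewrite -!addrA; congr (_ + _); rewrite addrCA [RHS]addrCA; congr (_ + _).
  by rewrite addrC.
apply: mpwB; first by rewrite -addn1; apply: mpwM => //; apply: lift_deviation.
by rewrite -add1n; apply: mpwM => //; apply: lift_deviation.
Qed.
End Filtered.

End Slice.

Section SliceTheorem.
Variables (k : fieldType) (L : falgType k) (n : nat) (r0 : rep L k^o n).
Local Notation N := (\dim {:L}).
Local Notation e i := ((vbasis {:L})`_i).
Local Notation co := (coord (vbasis {:L})).

Variable w : 'I_N -> 'I_n -> 'I_n -> 'M[k^o]_n.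
Hypothesis wP : forall c : 'M[k^o]_n,
  let alpha (i : 'I_N) := r0 (e i) *m c - c *m r0 (e i) in
  let c' := \sum_i \sum_p \sum_q alpha i p q *: w i p q in
  forall i : 'I_N, r0 (e i) *m c' - c' *m r0 (e i) = alpha i.
Local Notation D := (Dop r0).
Local Notation W := (Wop w).
Local Notation dev := (deviation r0).
Local Notation slice := (in_slice r0 w).

Section Existence.
Variables (R : clnAlg k) (r : rep L R n).
Hypothesis rl : is_lift r0 r.
Local Notation res := (map_mx (residue R)).

Let approx j (G : 'M[R]_n) : Prop := res G = 1%:M /\
  exists s : rep L R n, [/\ is_lift r0 s, forall a, G *m r a = s a *m G
    & forall i, mpw j (D (W (dev s)) i)].

(** Conjugation by 1 + c changes the deviation by - D c, up to an error one order higher. Here D c =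
    D W dev s, so the D W component cancels and only the error survives. *)
Lemma approx_step j G : approx j.+1 G -> exists2 G', approx j.+2 G' & mpw j.+1 (G' - G).
Proof.
(* Not W (dev s): only D (W (dev s)) is known to have order j + 1. By [DWD] the map D takes the same
   value on both. *)
move=> [G1 [s [sl sE sj]]]; pose c := W (D (W (dev s))).
have cj : mpw j.+1 c by apply: mpw_Wop.
have Dc i : D c i = D (W (dev s)) i by apply: DWD.
have g1 : res (1%:M + c) = 1%:M.
  rewrite map_mxD map_mx1; apply: (addrI (- 1%:M)); rewrite addKr addNr.
  have /mpw1 : mpw 1 (c - 0) by rewrite subr0; apply: mpw_le cj.
  by rewrite map_mx0.
have [h [gh hg h1]] := mx_inverse_res1 g1.
pose t := conj_rep s gh hg.
have tE a : (1%:M + c) *m s a = t a *m (1%:M + c) by exact: conj_repE.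
have tl : is_lift r0 t.
  by move=> a; rewrite /= !map_mxM g1 h1 sl mul1mx mulmx1.
exists ((1%:M + c) *m G); last first.
  by rewrite mulmxDl mul1mx addrAC subrr add0r; apply: mpwMr.
split; first by rewrite map_mxM g1 G1 mul1mx.
exists t; split=> // [a|i]; first by rewrite -mulmxA sE mulmxA tE mulmxA.
pose delta i := dev t i - (dev s i - D c i).
have deltaj l : mpw j.+2 (delta l).
  have -> : delta l = c *m s (e l) - t (e l) *m c + D c l.
    have E : c *m s (e l) - t (e l) *m c = t (e l) - s (e l).
      have := tE (e l); rewrite mulmxDl mulmxDr mul1mx mulmx1 => E.
      by rewrite -[c *m s (e l)](addKr (s (e l))) E addrA addrK addrC.
    by rewrite /delta /deviation opprB addrCA opprB subrKA E addrC.
  exact: commutation_expand.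
suff -> : D (W (dev t)) i = D (W delta) i by apply/mpw_Dop/mpw_Wop.
rewrite /delta WopB WopB !DopB -Dc.
by rewrite (DWD wP) subrr subr0.
Qed.

Lemma slice_exists : exists s : rep L R n, [/\ is_lift r0 s, slice s & conj1 r s].
Proof.
have base : approx 1 1%:M.
  split; first by rewrite map_mx1.
  exists r; split=> // [a|i]; first by rewrite mul1mx mulmx1.
  by apply/mpw_Dop/mpw_Wop => l; apply: lift_deviation.
have step j G : exists G', approx j.+1 G -> approx j.+2 G' /\ mpw j.+1 (G' - G).
  case: (pselect (approx j.+1 G)) => [/approx_step [G' G'a G'G]|nG]; first by exists G'.
  by exists 0 => /nG.
have [next nextP] := choice (fun jG => step jG.1 jG.2).
pose fix u j : 'M[R]_n := if j is i.+1 then next (i, u i) else 1%:M.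
have ua j : approx j.+1 (u j).
  by elim: j => [|j IHj] //=; have [] := nextP (j, u j) IHj.
have [|G GE] := @mpw_lim k R n n u.
  by move=> j; have [_] := nextP (j, u j) (ua j); apply: mpw_le.
have G1 : res G = 1%:M.
  by have [u1 _] := ua 1%N; rewrite -u1; apply/mpw1/GE.
have [H [GH HG H1]] := mx_inverse_res1 G1.
pose s := conj_rep r GH HG.
have sE a : G *m r a = s a *m G by exact: conj_repE.
have sl : is_lift r0 s by move=> a; rewrite /= !map_mxM G1 H1 rl mul1mx mulmx1.
exists s; split=> //; last by exists G.
move=> i; apply: mpw_eq0 => j; have [_ [t [tl tE tj]]] := ua j.
(* [s] and [t] are conjugates of [r] by [G] and [u j], which agree modulo m^j. Hence D W dev s lies
   in every m^j. *)
have st l : mpw j (s (e l) - t (e l)).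
  have -> : s (e l) - t (e l) = ((G - u j) *m r (e l) - t (e l) *m (G - u j)) *m H.
    have -> : (G - u j) *m r (e l) - t (e l) *m (G - u j) = (s (e l) - t (e l)) *m G.
      by rewrite mulmxBl mulmxBr tE opprB addrA subrK sE -mulmxBl.
    by rewrite -mulmxA GH mulmx1.
  by apply/mpwMr/mpwB; [apply: mpwMr | apply: mpwMl].
have -> : D (W (dev s)) i = D (W (fun l => s (e l) - t (e l))) i + D (W (dev t)) i.
  rewrite -[LHS](subrK (D (W (dev t)) i)) -DopB -WopB; congr (D _ i + _).
  by apply: Wop_eq => l; rewrite /deviation opprB subrKA.
by apply: mpwD; [apply/mpw_Dop/mpw_Wop | apply: mpw_le (tj i)].
Qed.
End Existence.

Section Uniqueness.
Hypothesis r0_lift : endo_lifting r0.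
Variables (R : clnAlg k) (r s : rep L R n).
Hypotheses (rl : is_lift r0 r) (sl : is_lift r0 s) (r_slice : slice r) (s_slice : slice s).
Local Notation res := (map_mx (residue R)).

(* [Phi] reduces to the identity, hence is bijective, and the solution of
   [Phi x = 1] provides [h] and [c]. *)
Lemma slice_complement g : res g = 1%:M -> exists h c,
  [/\ intertwiner r r h, g *m h = 1%:M + c & W (D c) = c].
Proof.
move=> g1; pose T p q : 'M[k^o]_n := delta_mx p q - W (D (delta_mx p q)).
have TE p q : intertwiner r0 r0 (T p q).
  have D0 (i : 'I_N) : T p q *m r0 (e i) = r0 (e i) *m T p q.
    apply/esym/subr0_eq; have := DopB r0 (delta_mx p q : 'M[k^o]_n) (W (D (delta_mx p q))) i.
    by rewrite (DWD wP) subrr {1}/Dop !unit_self.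
  move=> a; rewrite (rep_coord r0 a) mulmx_sumr mulmx_suml; apply: eq_bigr => i _.
  by rewrite -scalemxAr -scalemxAl D0.
have lift pq : exists t, intertwiner r r t /\ res t = T pq.1 pq.2.
  by have [t tE t1] := r0_lift rl (TE pq.1 pq.2); exists t.
have [t tP] := choice lift.
(* An R-linear map into the endomorphisms of [r], lifting the projection 1 - W D onto the commutant
   of [r0]; lifts of its values on matrix units suffice. *)
pose tau (x : 'M[R]_n) := \sum_p \sum_q x p q *: t (p, q).
have tauE x : intertwiner r r (tau x).
  move=> a; rewrite /tau mulmx_suml mulmx_sumr; apply: eq_bigr => p _.
  rewrite mulmx_suml mulmx_sumr; apply: eq_bigr => q _.
  by rewrite -scalemxAl -scalemxAr (tP (p, q)).1.
pose Phi (x : 'M[R]_n) := g *m tau x + W (D x).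
have tau_lin a x y : tau (a *: x + y) = a *: tau x + tau y.
  rewrite /tau scaler_sumr -big_split; apply: eq_bigr => p _.
  rewrite scaler_sumr -big_split; apply: eq_bigr => q _.
  by rewrite !mxE scalerDl scalerA.
have Phi_lin : linear Phi.
  move=> a x y; rewrite /Phi tau_lin mulmxDr -scalemxAr.
  rewrite -(Wop_eq w (alpha := fun i => a *: D x i + D y i)).
    by rewrite Wop_lin addrACA scalerDr.
  by move=> i; rewrite Dop_lin.
have Phi1 p q : res (Phi (delta_mx p q)) = delta_mx p q.
  rewrite map_mxD map_mxM g1 mul1mx Wop_map.
  rewrite -(Wop_eq w (alpha := D (delta_mx p q : 'M[k^o]_n))); last first.
    by move=> i; rewrite Dop_map map_delta_mx.
  have -> : tau (delta_mx p q) = t (p, q).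
    rewrite /tau (bigD1 p) //= (bigD1 q) //= mxE !eqxx scale1r.
    rewrite [X in _ + X]big1 ?addr0 => [|i ip]; last first.
      by rewrite big1 // => j _; rewrite mxE (negPf ip) scale0r.
    by rewrite big1 ?addr0 // => j jq; rewrite mxE (negPf jq) andbF scale0r.
  by rewrite (tP (p, q)).2 /T subrK.
pose A := lin_mx (make_linear Phi_lin).
have A1 : res A = 1%:M.
  apply/row_matrixP => i; case/mxvec_indexP: i => p q.
  rewrite -map_row rowE -mxvec_delta mul_vec_lin map_mxvec /= Phi1 row1 mxvec_delta //.
have [B [_ BA B1]] := mx_inverse_res1 A1.
pose x := vec_mx (mxvec 1%:M *m B).
have Phix : Phi x = 1%:M.
  apply: (can_inj mxvecK); rewrite -[Phi x]/(make_linear Phi_lin x) -mul_vec_lin.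
  by rewrite vec_mxK -mulmxA BA mulmx1.
exists (tau x), (- W (D x)); split=> //; first by rewrite -Phix addrK.
transitivity (W (fun i => 0 - D x i)); last by rewrite WopB Wop0 sub0r.
apply: Wop_eq => i.
by rewrite -[- W _]sub0r DopB Dop0 (DWD wP).
Qed.

(** [slice_complement] replaces the conjugation by 1 + c with c = W D c. On the slice D W kills both
    deviations, so D c equals D W of the expansion error, one order higher than c. Thus c lies in
    every power of m. *)
Lemma slice_unique : conj1 r s -> forall a, r a = s a.
Proof.
move=> [g [g1 gE]]; have [h [c [hE ghc cE]]] := slice_complement g1.
have comm a : (1%:M + c) *m r a = s a *m (1%:M + c).
  by rewrite -ghc -mulmxA hE mulmxA gE mulmxA.
suff c0 : c = 0 by move=> a; have := comm a; rewrite c0 addr0 mul1mx mulmx1.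
apply: mpw_eq0; elim=> [|j IHj]; first exact: mpw0.
pose delta i := D c i - (dev r i - dev s i).
have deltaj i : mpw j.+1 (delta i).
  have -> : delta i = c *m r (e i) - s (e i) *m c + D c i.
    have E : c *m r (e i) - s (e i) *m c = s (e i) - r (e i).
      have := comm (e i); rewrite mulmxDl mulmxDr mul1mx mulmx1 => E.
      by rewrite -[c *m r (e i)](addKr (r (e i))) E addrA addrK addrC.
    by rewrite E /delta /deviation opprB opprB subrKA addrC.
  exact: commutation_expand.
have Dc i : D c i = D (W delta) i.
  have -> : W delta = W (D c) - (W (dev r) - W (dev s)) by rewrite -!WopB.
  by rewrite !DopB (DWD wP) r_slice s_slice !subr0.
by rewrite -cE (Wop_eq w Dc); apply/mpw_Wop => i; apply/mpw_Dop/mpw_Wop.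
Qed.

End Uniqueness.

Section Universal.
Hypothesis r0_lift : endo_lifting r0.

Section Point.
Variables (R : comAlgType k) (x : 'I_N * 'I_n * 'I_n -> R).
Definition point_dev (i : 'I_N) : 'M[R]_n := \matrix_(p, q) x (i, p, q).
Definition point_fun (a : L) : 'M[R]_n :=
  map_mx (unit_lrmorphism R) (r0 a) + \sum_i ((co i a)%:A : R) *: point_dev i.

Lemma point_lin c a b : point_fun (c *: a + b) = (c%:A : R) *: point_fun a + point_fun b.
Proof.
rewrite /point_fun scalerDr addrACA; congr (_ + _).
  by rewrite rep_lin map_mxD map_mxZ; congr (_ *: _ + _); rewrite regular_algE.
rewrite scaler_sumr -big_split; apply: eq_bigr => i _.
by rewrite linearP scalerDl scalerA -scalerAl mul1r scalerA scalerDl.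
Qed.

(** Multiplicativity is imposed for all pairs in L rather than on a basis: [universal_solution]
    accepts any family of equations. *)
Definition point_eqn (t : L * L + unit + 'I_N) : 'M[R]_n :=
  match t with
  | inl (inl (a, b)) => point_fun (a * b) - point_fun a *m point_fun b
  | inl (inr tt) => point_fun 1 - 1%:M
  | inr i => D (W point_dev) i
  end.

Lemma point_basis (i : 'I_N) : point_fun (e i) = map_mx (unit_lrmorphism R) (r0 (e i)) + point_dev i.
Proof.
congr (_ + _); rewrite (bigD1 i) //= (coord_free i i (basis_free (vbasisP _))) eqxx !scale1r.
rewrite big1 ?addr0 // => j ji.
by rewrite (coord_free i j (basis_free (vbasisP _))) eq_sym (negPf ji) !scale0r.
Qed.

Hypothesis x_sol : forall t, point_eqn t = 0.
Lemma point1 : point_fun 1 = 1%:M.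
Proof. exact/subr0_eq/(x_sol (inl (inr tt))). Qed.
Lemma pointM a b : point_fun (a * b) = point_fun a *m point_fun b.
Proof. exact/subr0_eq/(x_sol (inl (inl (a, b)))). Qed.
Definition point_rep : rep L R n := Rep point_lin point1 pointM.
Lemma point_slice : slice point_rep.
Proof.
move=> i; rewrite -[RHS](x_sol (inr i)) /=; congr (D _ i); apply: Wop_eq => j.
by rewrite /deviation /= point_basis addrC addKr.
Qed.
End Point.

Lemma point_fun_map (R S : comAlgType k) (f : {lrmorphism R -> S}) x a :
  map_mx f (point_fun x a) = point_fun (f \o x) a.
Proof.
rewrite map_mxD unit_lrmorphismE map_mx_sum; congr (_ + _); apply: eq_bigr => i _.
by rewrite map_mxZ lrmorphism_alg; congr (_ *: _); apply/matrixP => p q; rewrite !mxE.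
Qed.

Lemma point_eqn_map (R S : comAlgType k) (f : {lrmorphism R -> S}) x t :
  map_mx f (point_eqn x t) = point_eqn (f \o x) t.
Proof.
case: t => [[[a b]|[]]|i] /=.
- by rewrite map_mxB map_mxM !point_fun_map.
- by rewrite map_mxB point_fun_map map_mx1.
- rewrite Dop_map Wop_map; congr (D _ i); apply: Wop_eq => j.
  by apply/matrixP => p q; rewrite !mxE.
Qed.

Lemma point_fun0 a : point_fun (fun=> 0 : k^o) a = r0 a.
Proof.
rewrite /point_fun unit_self big1 ?addr0 // => i _.
by rewrite (_ : point_dev _ i = 0) ?scaler0 //; apply/matrixP => p q; rewrite !mxE.
Qed.

Lemma point_eqn0 t : point_eqn (fun=> 0 : k^o) t = 0.
Proof.
case: t => [[[a b]|[]]|i] /=.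
- by rewrite !point_fun0 repM subrr.
- by rewrite point_fun0 rep1 subrr.
- rewrite -[RHS](@Dop0 k L n r0 k^o i) -[in RHS](@Wop0 k L n w k^o); congr (D _ i).
  apply: Wop_eq => j.
  by apply/matrixP => p q; rewrite !mxE.
Qed.

Lemma slice_point (R : comAlgType k) (r : rep L R n) : slice r ->
  let x (j : 'I_N * 'I_n * 'I_n) := dev r j.1.1 j.1.2 j.2 in
  (forall t, point_eqn x t = 0) /\ forall a, point_fun x a = r a.
Proof.
move=> r_slice x.
have devE i : point_dev x i = dev r i by apply/matrixP => p q; rewrite mxE.
have xr a : point_fun x a = r a.
  rewrite /point_fun (rep_coord r a) (rep_coord r0 a) map_mx_sum -big_split.
  apply: eq_bigr => i _; rewrite devE map_mxZ regular_algE.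
  transitivity (((co i a)%:A : R) *: (map_mx (unit_lrmorphism R) (r0 (e i)) + dev r i)).
    exact: esym (scalerDr _ _ _).
  congr (_ *: _).
  by rewrite /deviation addrC subrK.
split=> // -[[[a b]|[]]|i] /=.
- by rewrite !xr repM subrr.
- by rewrite xr rep1 subrr.
- by rewrite -[RHS](r_slice i); congr (D _ i); apply: Wop_eq => j; rewrite devE.
Qed.

Lemma universal_slice : exists (R : clnAlg k) (u : rep L R n),
  [/\ is_lift r0 u, slice u
    & forall (S : clnAlg k) (s : rep L S n), is_lift r0 s -> slice s ->
      exists! f : clnHom R S, forall a, map_mx f (u a) = s a].
Proof.
pose eqn (R : clnAlg k) (x : 'I_N * 'I_n * 'I_n -> R) (t : (L * L + unit + 'I_N) * 'I_n * 'I_n) :=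
  point_eqn x t.1.1 t.1.2 t.2.
have [|R x x0|R [x [x0 xE x_univ]]] := @universal_solution k _ _ eqn.
- by move=> R S f x t; rewrite /eqn -(point_eqn_map f) mxE.
- move=> t; rewrite /eqn; have := point_eqn_map (residue R) x t.1.1.
  have -> : residue R \o x = fun=> 0 by apply/funext => j; apply: x0.
  rewrite point_eqn0 => /(congr1 (fun A : 'M_n => A t.1.2 t.2)).
  by rewrite !mxE.
have x_sol t : point_eqn x t = 0.
  by apply/matrixP => p q; rewrite mxE; apply: (xE (t, p, q)).
exists R, (point_rep x_sol); split=> [a||S s sl s_slice].
- rewrite /= point_fun_map; have -> : residue R \o x = fun=> 0 by apply/funext => j; apply: x0.
  exact: point_fun0.
- exact: point_slice.
pose y (j : 'I_N * 'I_n * 'I_n) := dev s j.1.1 j.1.2 j.2.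
have [y_sol yE] := slice_point s_slice.
have [|t|f [fE f_uniq]] := x_univ S y.
- by move=> j; apply/pw1; apply: lift_deviation.
- by rewrite /eqn y_sol mxE.
exists f; split=> [a|g gE].
  rewrite /= point_fun_map -yE; congr (point_fun _ a); apply/funext => j; exact: fE.
apply: f_uniq => -[[i p] q]; have := gE (e i).
rewrite /= point_basis map_mxD unit_lrmorphismE.
move=> /(congr1 (fun A => A - map_mx (unit_lrmorphism S) (r0 (e i)))).
rewrite addrC addKr => /(congr1 (fun A : 'M_n => A p q)).
by rewrite !mxE /y !mxE /= => ->.
Qed.

End Universal.
End SliceTheorem.

Lemma universal_deformation (k : fieldType) (L : falgType k) (V : lmodType L) n (F : frame V n) :
  endo_lifting F -> exists R : clnAlg k, universal_deformation_ring V R.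
Proof.
move=> F_lift; have [w wP] := commutator_pinv (fun i : 'I_(\dim {:L}) => F (vbasis {:L})`_i).
have [R [u [ul u_slice u_univ]]] := @universal_slice k L n F w.
exists R; apply: (@nat_iso_of_rel k (deformation_functor V) (hom_functor R)
  (fun S x f => x = deformation_of (rep_lifting (is_lift_map f ul)))).
- move=> S x; have [r [rl ->]] := deformation_rep F x.
  have [s [sl s_slice rs]] := slice_exists wP rl.
  have [f [fE _]] := u_univ S s sl s_slice; exists f; apply/deformation_rep_eq.
  by apply: conj1_trans rs (conj1_eq _) => a; rewrite /= fE.
- by move=> S f; exists (deformation_of (rep_lifting (is_lift_map f ul))).
- move=> S x f g -> /deformation_rep_eq fg.
  (* The slice equations have constant coefficients, so they survive base change; conjugate
     pullbacks of [u] are then equal. *)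
  have map_slice (h : clnHom R S) : in_slice F w (map_rep h u).
    move=> i; have := congr1 (map_mx h) (u_slice i); rewrite map_mx0 Dop_map Wop_map => <-.
    congr (Dop _ _ i); apply: Wop_eq => j.
    by rewrite /deviation map_mxB unit_lrmorphismE.
  have E := slice_unique wP F_lift (is_lift_map f ul) (is_lift_map g ul)
    (map_slice f) (map_slice g) fg.
  have [h [_ h_uniq]] := u_univ S (map_rep f u) (is_lift_map f ul) (map_slice f).
  by rewrite -(h_uniq f) // -(h_uniq g) // => a; rewrite /= -[LHS]E.
- by move=> S x y f -> ->.
- move=> S T f x g ->; rewrite [LHS]deformation_rep_map; apply/deformation_rep_eq.
  by apply: conj1_eq => a; apply/matrixP => p q; rewrite !mxE.
Qed.

(** * Projective summands and syzygies *)

Section Adapt.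
Variables (k : fieldType) (L : falgType k) (R : clnAlg k).
Local Notation res := (map_mx (residue R)).

Lemma is_lift_conj1 m (s0 : rep L k^o m) (s t : rep L R m) :
  is_lift s0 s -> conj1 s t -> is_lift s0 t.
Proof.
move=> sl [g [g1 gE]] a; have := congr1 (map_mx (residue R)) (gE a).
by rewrite !map_mxM g1 mul1mx mulmx1 sl.
Qed.

(** The matrix [g] has residue 1 and satisfies g J = I. Conjugating by its inverse turns the
    intertwiner [I], equal to [J] only modulo m, into [J] itself. *)
Lemma adapt_sub m p (r : rep L R p) (s : rep L R m) (I J : 'M[R]_(m, p)) (J' : 'M[R]_(p, m)) :
  intertwiner r s I -> res I = res J -> J' *m J = 1%:M ->
  exists2 t : rep L R m, conj1 s t & intertwiner r t J.
Proof.
move=> IE IJ J'J; pose g := 1%:M + (I - J) *m J'.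
have g1 : res g = 1%:M by rewrite map_mxD map_mx1 map_mxM map_mxB IJ subrr mul0mx addr0.
have gJ : g *m J = I by rewrite mulmxDl mul1mx -mulmxA J'J mulmx1 addrC subrK.
have [h [gh hg h1]] := mx_inverse_res1 g1.
exists (conj_rep s hg gh); first by exists h; split=> // a; exact: conj_repE.
move=> a /=; rewrite -!mulmxA gJ -IE -gJ !mulmxA hg mul1mx //.
Qed.

(** Dual to [adapt_sub], now with K g = Q. The matrix [g] is kept visible so that its effect on a
    normalization made earlier can be computed. *)
Lemma adapt_quot m p (r : rep L R p) (s : rep L R m) (Q K : 'M[R]_(p, m)) (K' : 'M[R]_(m, p)) :
  intertwiner s r Q -> res Q = res K -> K *m K' = 1%:M ->
  let g := 1%:M + K' *m (Q - K) in
  exists t : rep L R m, [/\ conj1 s t, intertwiner s t g & intertwiner t r K].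
Proof.
move=> QE QK KK' g.
have g1 : res g = 1%:M by rewrite map_mxD map_mx1 map_mxM map_mxB QK subrr mulmx0 addr0.
have Kg : K *m g = Q by rewrite mulmxDr mulmx1 mulmxA KK' mul1mx addrC subrK.
have [h [gh hg h1]] := mx_inverse_res1 g1.
exists (conj_rep s gh hg); split=> [|a|a]; first by exists g; split=> // a; exact: conj_repE.
  exact: conj_repE.
by rewrite /= !mulmxA Kg QE -[Q in LHS]Kg -!mulmxA gh mulmx1.
Qed.
End Adapt.

Section Blocks.
Variables (k : fieldType) (L : falgType k) (R : comAlgType k) (m n : nat).

Definition incl1 : 'M[R]_(m + n, m) := col_mx 1%:M 0.
Definition incl2 : 'M[R]_(m + n, n) := col_mx 0 1%:M.
Definition proj1 : 'M[R]_(m, m + n) := row_mx 1%:M 0.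
Definition proj2 : 'M[R]_(n, m + n) := row_mx 0 1%:M.

Lemma proj1_incl1 : proj1 *m incl1 = 1%:M.
Proof. by rewrite mul_row_col mulmx1 mul0mx addr0. Qed.
Lemma proj2_incl2 : proj2 *m incl2 = 1%:M.
Proof. by rewrite mul_row_col mulmx1 mul0mx add0r. Qed.
Lemma mul_proj2 (A : 'M[R]_(m + n)) : proj2 *m A = dsubmx A.
Proof. by rewrite -{1}[A]vsubmxK mul_row_col mul1mx mul0mx add0r. Qed.
Lemma incl1_mul p (A : 'M[R]_(m, p)) : incl1 *m A = col_mx A 0.
Proof. by rewrite mul_col_mx mul1mx mul0mx. Qed.
Lemma incl2_mul p (A : 'M[R]_(n, p)) : incl2 *m A = col_mx 0 A.
Proof. by rewrite mul_col_mx mul1mx mul0mx. Qed.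
Lemma mul_proj2r p (A : 'M[R]_(p, n)) : A *m proj2 = row_mx 0 A.
Proof. by rewrite mul_mx_row mulmx1 mulmx0. Qed.

Lemma triangular_blocks (A : 'M[R]_(m + n)) : dlsubmx A = 0 ->
  A *m incl1 = incl1 *m ulsubmx A /\ proj2 *m A = drsubmx A *m proj2.
Proof.
move=> A0; have E : A = block_mx (ulsubmx A) (ursubmx A) 0 (drsubmx A) by rewrite -A0 submxK.
split; rewrite {1}E.
  by rewrite mul_block_col !mulmx1 !mulmx0 !addr0 incl1_mul.
by rewrite mul_row_block !mul1mx !mul0mx !add0r mul_proj2r.
Qed.

Lemma incl1_blocks (A : 'M[R]_(m + n)) B :
  A *m incl1 = incl1 *m B -> dlsubmx A = 0 /\ ulsubmx A = B.
Proof.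
rewrite -{1}[A]submxK mul_block_col !mulmx1 !mulmx0 !addr0 incl1_mul.
by move=> /eq_col_mx [-> ->].
Qed.

Lemma proj2_blocks (A : 'M[R]_(m + n)) B :
  proj2 *m A = B *m proj2 -> dlsubmx A = 0 /\ drsubmx A = B.
Proof.
rewrite -{1}[A]submxK mul_row_block !mul1mx !mul0mx !add0r mul_proj2r.
by move=> /eq_row_mx [-> ->].
Qed.

Lemma triangular_rep (t : rep L R (m + n)) : (forall a, dlsubmx (t a) = 0) ->
  exists (r : rep L R m) (s : rep L R n),
    [/\ forall a, r a = ulsubmx (t a), forall a, s a = drsubmx (t a),
        intertwiner r t incl1 & intertwiner t s proj2].
Proof.
move=> t0.
have tM a b : ulsubmx (t (a * b)) = ulsubmx (t a) *m ulsubmx (t b) /\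
    drsubmx (t (a * b)) = drsubmx (t a) *m drsubmx (t b).
  have E c : t c = block_mx (ulsubmx (t c)) (ursubmx (t c)) 0 (drsubmx (t c)).
    by rewrite -(t0 c) submxK.
  have -> : t (a * b) = block_mx (ulsubmx (t a) *m ulsubmx (t b))
      (ulsubmx (t a) *m ursubmx (t b) + ursubmx (t a) *m drsubmx (t b))
      0 (drsubmx (t a) *m drsubmx (t b)).
    by rewrite repM {1}(E a) {1}(E b) mulmx_block !mulmx0 !mul0mx !addr0 add0r.
  by rewrite block_mxKul block_mxKdr.
have t1 : ulsubmx (t 1) = 1%:M /\ drsubmx (t 1) = 1%:M.
  by rewrite rep1 scalar_mx_block block_mxKul block_mxKdr.
have tl c a b : ulsubmx (t (c *: a + b)) = (c%:A : R) *: ulsubmx (t a) + ulsubmx (t b).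
  by rewrite rep_lin; apply/matrixP => i j; rewrite !mxE.
have tr c a b : drsubmx (t (c *: a + b)) = (c%:A : R) *: drsubmx (t a) + drsubmx (t b).
  by rewrite rep_lin; apply/matrixP => i j; rewrite !mxE.
exists (Rep tl t1.1 (fun a b => (tM a b).1)), (Rep tr t1.2 (fun a b => (tM a b).2)).
split=> // a; first exact: esym (triangular_blocks (t0 a)).1.
exact: (triangular_blocks (t0 a)).2.
Qed.

End Blocks.

Section MapBlocks.
Variables (k : fieldType) (R S : comAlgType k) (f : {lrmorphism R -> S}) (m n : nat).
Lemma map_incl1 : map_mx f (incl1 R m n) = incl1 S m n.
Proof. by rewrite map_col_mx map_mx1 map_mx0. Qed.
Lemma map_incl2 : map_mx f (incl2 R m n) = incl2 S m n.
Proof. by rewrite map_col_mx map_mx1 map_mx0. Qed.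
Lemma map_proj2 : map_mx f (proj2 R m n) = proj2 S m n.
Proof. by rewrite map_row_mx map_mx1 map_mx0. Qed.
End MapBlocks.

Section Sums.
Variables (k : fieldType) (L : falgType k).

Section SumRep.
Variables (R : comAlgType k) (n p : nat) (r : rep L R n) (s : rep L R p).
Let sum a := block_mx (r a) 0 0 (s a).
Lemma sum_rep_lin c a b : sum (c *: a + b) = (c%:A : R) *: sum a + sum b.
Proof. by rewrite /sum !rep_lin scale_block_mx add_block_mx !scaler0 !addr0. Qed.
Lemma sum_rep1 : sum 1 = 1%:M.
Proof. by rewrite /sum !rep1 -scalar_mx_block. Qed.
Lemma sum_repM a b : sum (a * b) = sum a *m sum b.
Proof. by rewrite /sum mulmx_block !repM !mulmx0 !mul0mx !addr0 add0r. Qed.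
Definition sum_rep : rep L R (n + p) := Rep sum_rep_lin sum_rep1 sum_repM.
End SumRep.

Lemma frame_sum (V W : lmodType L) n p (F : frame V n) (G : frame W p) :
  exists H : frame (V * W)%type (n + p), fr_rep H = sum_rep F G.
Proof.
pose m (x : V * W) := col_mx (fr_map F x.1) (fr_map G x.2).
pose w (y : 'cV[k^o]_(n + p)) : V * W := (fr_inv F (usubmx y), fr_inv G (dsubmx y)).
have mK : cancel m w by case=> x y; rewrite /w /m col_mxKu col_mxKd !fr_mapK.
have wK : cancel w m by move=> y; rewrite /m /w /= !fr_invK vsubmxK.
have mB : zmod_morphism m.
  by move=> x y; rewrite /m /= !raddfB /= opp_col_mx add_col_mx.
have mZ (c : k) (x : V * W) : m ((c%:A : L) *: x) = (c : k^o) *: m x.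
  by rewrite /m /= !fr_mapZ scale_col_mx.
have [H HE] := make_frame mK wK mB mZ; exists H; apply: rep_ext => a.
apply: mulmx_col_inj => y; rewrite -[y]wK -!HE -fr_act !HE /m /= !fr_act.
by rewrite mul_block_col !mul0mx addr0 add0r.
Qed.

Lemma map_sum_rep (R S : comAlgType k) (f : {lrmorphism R -> S}) n p (r : rep L R n)
    (s : rep L R p) a : map_rep f (sum_rep r s) a = sum_rep (map_rep f r) (map_rep f s) a.
Proof. by rewrite /= map_block_mx !map_mx0. Qed.

Section SumIntertwiners.
Variables (R : comAlgType k) (n p : nat) (r : rep L R n) (s : rep L R p).
Lemma sum_incl2 : intertwiner s (sum_rep r s) (incl2 R n p).
Proof. by move=> a; rewrite incl2_mul /= mul_block_col !mulmx0 !mul0mx mulmx1 !add0r. Qed.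
Lemma sum_proj2 : intertwiner (sum_rep r s) s (proj2 R n p).
Proof. by move=> a; rewrite mul_proj2r /= mul_row_block !mulmx0 !mul0mx mul1mx !add0r. Qed.
End SumIntertwiners.

(** A lift of V (+) P becomes block diagonal in two conjugations: the inclusion of P lifts because P
    is projective and is straightened first, then the projection onto P, which lifts because P is
    injective. *)
Lemma sum_projective_iso (V P : lmodType L) n p (F : frame V n) (G : frame P p) u v :
  proj_data G u -> inj_data G v ->
  naturally_isomorphic (deformation_functor V) (deformation_functor (V * P)%type).
Proof.
move=> uP vP; have [H HE] := frame_sum F G.
have cl R := const_rep_lift R G.
have uR R := proj_data_map (unit_lrmorphism R) uP.
have vR R := inj_data_map (unit_lrmorphism R) vP.
apply: (deformation_correspondence (F := F) (G := H)
  (T := fun R r s => conj1 (sum_rep r (const_rep R G)) s)); rewrite ?HE.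
- move=> R r rl; exists (sum_rep r (const_rep R G)); last exact: conj1_refl.
  by move=> a; rewrite map_block_mx !map_mx0 rl cl.
- move=> R s sl; pose J := incl2 R n p; pose K := proj2 R n p.
  pose I := proj_avg (fun i => map_mx (unit_lrmorphism R) (u i)) s J.
  have IE : intertwiner (const_rep R G) s I by exact: proj_avg_intertwiner (uR R).
  have I1 : map_mx (residue R) I = map_mx (residue R) J.
    rewrite map_incl2; apply: proj_intertwiner_lift (cl R) sl (uR R) _ _ (map_incl2 _ _ _).
    exact: sum_incl2.
  have [t st tJ] := adapt_sub IE I1 (proj2_incl2 R n p).
  have tl := is_lift_conj1 sl st.
  pose Q := inj_avg (fun i => map_mx (unit_lrmorphism R) (v i)) t K.
  have QE : intertwiner t (const_rep R G) Q by exact: inj_avg_intertwiner (vR R).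
  have Q1 : map_mx (residue R) Q = map_mx (residue R) K.
    rewrite map_proj2; apply: inj_intertwiner_lift (cl R) tl (vR R) _ _ (map_proj2 _ _ _).
    exact: sum_proj2.
  have QJ1 : map_mx (residue R) (Q *m J) = 1%:M.
    by rewrite map_mxM Q1 -map_mxM proj2_incl2 map_mx1.
  (* [Q *m J] is an automorphism of the lift of P. Dividing by it makes [y *m Q] an exact retraction
     of [J], so that the second conjugation fixes [J] and preserves the first normalization. *)
  have [y [QJy yQJ y1]] := mx_inverse_res1 QJ1.
  have QJE : intertwiner (const_rep R G) (const_rep R G) (Q *m J).
    by move=> a; rewrite -mulmxA tJ mulmxA QE mulmxA.
  have yE := intertwiner_inv QJE QJy yQJ.
  have yQE : intertwiner t (const_rep R G) (y *m Q).
    by move=> a; rewrite -mulmxA QE mulmxA yE mulmxA.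
  have yQ1 : map_mx (residue R) (y *m Q) = map_mx (residue R) K by rewrite map_mxM y1 mul1mx.
  have [t' [tt' gE t'K]] := adapt_quot yQE yQ1 (proj2_incl2 R n p).
  have [g {}gE gJ] : exists2 g, intertwiner t t' g & g *m J = J.
    exists (1%:M + J *m (y *m Q - K)) => //.
    by rewrite mulmxDl mul1mx -mulmxA mulmxBl -mulmxA yQJ proj2_incl2 subrr mulmx0 addr0.
  have t'J a : t' a *m J = J *m const_rep R G a.
    by rewrite -{1}gJ mulmxA -gE -mulmxA -tJ mulmxA gJ.
  have t'0 a : dlsubmx (t' a) = 0.
    have := t'K a; rewrite mul_proj2 mul_proj2r => E.
    by rewrite /dlsubmx E row_mxKl.
  have [r [_ [rE _ _ _]]] := triangular_rep t'0.
  have t'E a : t' a = sum_rep r (const_rep R G) a.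
    have := t'J a; rewrite incl2_mul.
    have {1}-> : t' a = block_mx (ulsubmx (t' a)) (ursubmx (t' a)) 0 (drsubmx (t' a)).
      by rewrite -(t'0 a) submxK.
    rewrite mul_block_col !mulmx0 !mulmx1 !add0r => /eq_col_mx [u0 d0].
    by rewrite -[LHS]submxK t'0 u0 d0 -rE.
  have t'l := is_lift_conj1 tl tt'.
  exists r; first by move=> a; rewrite rE map_ulsubmx t'l block_mxKul.
  apply: conj1_trans (conj1_eq (fun a => esym (t'E a))) _.
  exact/conj1_sym/conj1_trans/tt'.
- move=> R r r' s s' _ _ _ _ rs rs'; split=> [[g [g1 gE]]|ss'].
    apply: conj1_trans (conj1_trans (conj1_sym rs) _) rs'.
    exists (block_mx g 0 0 1%:M); split=> [|a].
      by rewrite map_block_mx !map_mx0 map_mx1 g1 -scalar_mx_block.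
    by rewrite /= !mulmx_block !mulmx0 !mul0mx mulmx1 mul1mx gE !addr0 !add0r.
  have [g [g1 gE]] := conj1_trans (conj1_trans rs ss') (conj1_sym rs').
  (* Both representations are block diagonal, so the corner of [g] is an intertwiner by itself: the
     lift of P cancels. *)
  exists (ulsubmx g); split=> [|a].
    by rewrite map_ulsubmx g1 scalar_mx_block block_mxKul.
  have := gE a; rewrite -[g]submxK /= !mulmx_block !mulmx0 !mul0mx !addr0.
  by move=> /eq_block_mx [E _ _ _]; rewrite block_mxKul.
- move=> R S f r s /(conj1_map f); apply: conj1_trans.
  apply: conj1_eq => a; rewrite map_sum_rep /=; congr block_mx.
  by rewrite unit_lrmorphismE.
Qed.

End Sums.

Section Syzygy.
Variables (k : fieldType) (L : falgType k).

(** The basis of P consists of a basis of W followed by preimages of a basis of V, so that [i] and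
    [p] become the standard block matrices. *)
Lemma extension_frame (V W P : lmodType L) n m (F : frame V n) (G : frame W m)
    (p : {linear P -> V}) (i : {linear W -> P}) :
  surjective p -> injective i -> (forall x, p x = 0 <-> exists w, i w = x) ->
  exists H : frame P (m + n),
    intertwiner G H (incl1 k^o m n) /\ intertwiner H F (proj2 k^o m n).
Proof.
move=> p_surj i_inj p_ker.
have [y yE] := choice (fun j : 'I_n => p_surj (fr_inv F (delta_mx j 0))).
pose sec (z : 'cV[k^o]_n) : P := \sum_j (((z j 0 : k)%:A : L) *: y j).
have secB : zmod_morphism sec.
  by move=> a b; rewrite /sec -sumrB; apply: eq_bigr => j _; rewrite !mxE !scalerBl.
have secZ (c : k) z : sec ((c : k^o) *: z) = (c%:A : L) *: sec z.
  rewrite /sec scaler_sumr; apply: eq_bigr => j _.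
  by rewrite mxE scalerA mulr_algl scalerA.
have sec0 : sec 0 = 0 by have := secB 0 0; rewrite !subrr.
have p_sec z : p (sec z) = fr_inv F z.
  rewrite linear_sum [in RHS](cV_sum z) fr_inv_sum; apply: eq_bigr => j _.
  by rewrite linearZ yE; apply: esym (fr_invZ _ _ _).
have pi0 w : p (i w) = 0 by apply/p_ker; exists w.
have part x : exists w, i w = x - sec (fr_map F (p x)).
  by apply/p_ker; rewrite linearB p_sec fr_mapK subrr.
have [q qE] := choice part.
pose f x := col_mx (fr_map G (q x)) (fr_map F (p x)).
pose g (z : 'cV[k^o]_(m + n)) := i (fr_inv G (usubmx z)) + sec (dsubmx z).
have fK : cancel f g by move=> x; rewrite /f /g col_mxKu col_mxKd fr_mapK qE subrK.
have gK : cancel g f.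
  move=> z; have pg : fr_map F (p (g z)) = dsubmx z by rewrite linearD pi0 add0r p_sec fr_invK.
  rewrite /f pg -[RHS]vsubmxK; congr col_mx; apply: (can_inj (fr_invK G)).
  by apply: i_inj; rewrite fr_mapK qE pg /g addrK.
have qB : zmod_morphism q.
  move=> a b; apply: i_inj; rewrite linearB !qE linearB raddfB secB.
  by rewrite !opprD !opprK addrACA.
have qZ (c : k) x : q ((c%:A : L) *: x) = (c%:A : L) *: q x.
  by apply: i_inj; rewrite linearZ_LR !qE linearZ_LR fr_mapZ secZ scalerBr.
have fB : zmod_morphism f.
  by move=> a b; rewrite /f qB linearB !raddfB opp_col_mx add_col_mx.
have fZ (c : k) x : f ((c%:A : L) *: x) = (c : k^o) *: f x.
  by rewrite /f qZ linearZ !fr_mapZ scale_col_mx.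
have [H HE] := make_frame fK gK fB fZ; exists H; split=> a.
  apply: mulmx_col_inj => z; rewrite -(fr_invK G z); move: (fr_inv G z) => w.
  have fi v : fr_map H (i v) = incl1 k^o m n *m fr_map G v.
    rewrite HE /f pi0 raddf0 incl1_mul; congr col_mx; congr (fr_map G _).
    by apply: i_inj; rewrite qE pi0 raddf0 sec0 subr0.
  by rewrite -!mulmxA -fr_act -!fi linearZ fr_act.
apply: mulmx_col_inj => z; rewrite -(fr_invK H z); move: (fr_inv H z) => x.
have fp v : proj2 k^o m n *m fr_map H v = fr_map F (p v).
  by rewrite HE mul_row_col mul0mx mul1mx add0r.
by rewrite -!mulmxA -fr_act !fp linearZ fr_act.
Qed.

Lemma syzygy_deformation_iso (V W P : lmodType L) n m (F : frame V n) (G : frame W m)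
    (H : frame P (m + n)) u v :
  proj_data H u -> inj_data H v ->
  intertwiner G H (incl1 k^o m n) -> intertwiner H F (proj2 k^o m n) ->
  naturally_isomorphic (deformation_functor V) (deformation_functor W).
Proof.
move=> uP vP GH HF.
have cl R := const_rep_lift R H.
have uR R := proj_data_map (unit_lrmorphism R) uP.
have vR R := inj_data_map (unit_lrmorphism R) vP.
have GE a : ulsubmx (H a) = G a by case: (incl1_blocks (esym (GH a))).
have FE a : drsubmx (H a) = F a by case: (proj2_blocks (HF a)).
have split (R : clnAlg k) (s : rep L R (m + n)) : is_lift H s -> (forall a, dlsubmx (s a) = 0) ->
    exists (r : rep L R n) (t : rep L R m), [/\ is_lift F r, is_lift G t,
      intertwiner t s (incl1 R m n) & intertwiner s r (proj2 R m n)].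
  move=> sl /triangular_rep [t [r [tE rE tJ rK]]]; exists r, t; split=> // a.
    by rewrite rE map_drsubmx sl FE.
  by rewrite tE map_ulsubmx sl GE.
apply: (deformation_correspondence (F := F) (G := G)
  (T := fun R r t => exists s : rep L R (m + n), [/\ is_lift H s,
     intertwiner t s (incl1 R m n) & intertwiner s r (proj2 R m n)])).
(* P -> V lifts to the lift [r] because P is projective; once it is straightened to [K], its kernel
   is the leading block. *)
- move=> R r rl; pose K := proj2 R m n.
  pose Q := proj_avg (fun i => map_mx (unit_lrmorphism R) (u i)) r K.
  have QE : intertwiner (const_rep R H) r Q by exact: proj_avg_intertwiner (uR R).
  have Q1 : map_mx (residue R) Q = map_mx (residue R) K.
    by rewrite map_proj2; apply: proj_intertwiner_lift (cl R) rl (uR R) HF _ (map_proj2 _ _ _).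
  have [s [cs _ sK]] := adapt_quot QE Q1 (proj2_incl2 R m n).
  have sl := is_lift_conj1 (cl R) cs.
  have s0 a : dlsubmx (s a) = 0.
    by case: (proj2_blocks (sK a)).
  have [r' [t [_ tl tJ _]]] := split R s sl s0.
  by exists t => //; exists s.
(* Dually, W -> P lifts because P is injective, and the cokernel is the trailing block. *)
- move=> R t tl; pose J := incl1 R m n.
  pose I := inj_avg (fun i => map_mx (unit_lrmorphism R) (v i)) t J.
  have IE : intertwiner t (const_rep R H) I by exact: inj_avg_intertwiner (vR R).
  have I1 : map_mx (residue R) I = map_mx (residue R) J.
    by rewrite map_incl1; apply: inj_intertwiner_lift (cl R) tl (vR R) GH _ (map_incl1 _ _ _).
  have [s cs sJ] := adapt_sub IE I1 (proj1_incl1 R m n).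
  have sl := is_lift_conj1 (cl R) cs.
  have s0 a : dlsubmx (s a) = 0.
    by case: (incl1_blocks (esym (sJ a))).
  have [r [t' [rl _ _ rK]]] := split R s sl s0.
  by exists r => //; exists s.
- move=> R r r' t t' rl rl' tl tl' [s [sl tJ rK]] [s' [sl' tJ' rK']].
  split=> [[g [g1 gE]]|[g [g1 gE]]].
    have [u' u'P] := proj_data_lift uP sl.
    (* A matrix with residue 1 that covers [g] but is not L-linear. Averaging keeps both properties,
       because [proj2] is an intertwiner and g *m proj2 is one already; the averaged map then
       restricts to the kernels. *)
    pose T := block_mx 1%:M 0 0 g : 'M[R]_(m + n).
    have T1 : map_mx (residue R) T = 1%:M.
      by rewrite map_block_mx !map_mx0 map_mx1 g1 -scalar_mx_block.
    pose h := proj_avg u' s' T.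
    have hE : intertwiner s s' h by exact: proj_avg_intertwiner u'P.
    have h1 : map_mx (residue R) h = 1%:M.
      apply: proj_intertwiner_lift sl sl' u'P _ _ T1.
      by move=> a; rewrite mul1mx mulmx1.
    have Kh : proj2 R m n *m h = g *m proj2 R m n.
      rewrite (proj_avg_comp _ _ rK').
      have -> : proj2 R m n *m T = g *m proj2 R m n.
        by rewrite mul_proj2r mul_row_block !mul0mx !mulmx0 mul1mx !add0r.
      by apply: proj_avg_id u'P _ => a; rewrite -mulmxA rK mulmxA gE mulmxA.
    have [h0 _] := proj2_blocks Kh.
    have [hJ _] := triangular_blocks h0.
    exists (ulsubmx h); split=> [|a]; first by rewrite map_ulsubmx h1 scalar_mx_block block_mxKul.
    have : incl1 R m n *m (ulsubmx h *m t a) = incl1 R m n *m (t' a *m ulsubmx h).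
      by rewrite !mulmxA tJ' -hJ -[h *m _ *m t a]mulmxA tJ mulmxA hE -[s' a *m h *m _]mulmxA hJ mulmxA.
    move/(congr1 (mulmx (proj1 R m n))).
    by rewrite !(mulmxA (proj1 R m n)) proj1_incl1 !mul1mx.
  have [v' v'P] := inj_data_lift uP vP sl'.
  (* Dually, a matrix extending [g] along the inclusions; its average passes to the quotients. *)
  pose T := block_mx g 0 0 1%:M : 'M[R]_(m + n).
  have T1 : map_mx (residue R) T = 1%:M.
    by rewrite map_block_mx !map_mx0 map_mx1 g1 -scalar_mx_block.
  pose h := inj_avg v' s T.
  have hE : intertwiner s s' h by exact: inj_avg_intertwiner v'P.
  have h1 : map_mx (residue R) h = 1%:M.
    apply: inj_intertwiner_lift sl' sl v'P _ _ T1.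
    by move=> a; rewrite mul1mx mulmx1.
  have hJ : h *m incl1 R m n = incl1 R m n *m g.
    rewrite (inj_avg_comp _ _ tJ).
    have -> : T *m incl1 R m n = incl1 R m n *m g.
      by rewrite incl1_mul mul_block_col !mul0mx !mulmx0 mulmx1 !addr0.
    by apply: inj_avg_id v'P _ => a; rewrite -mulmxA gE mulmxA tJ' mulmxA.
  have [h0 _] := incl1_blocks hJ.
  have [_ Kh] := triangular_blocks h0.
  exists (drsubmx h); split=> [|a]; first by rewrite map_drsubmx h1 scalar_mx_block block_mxKdr.
  have : (drsubmx h *m r a) *m proj2 R m n = (r' a *m drsubmx h) *m proj2 R m n.
    by rewrite -mulmxA -rK mulmxA -Kh -mulmxA hE mulmxA rK' -mulmxA Kh mulmxA.
  move/(congr1 (mulmx^~ (incl2 R m n))).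
  by rewrite -[_ *m r a *m _ *m _]mulmxA -[_ *m drsubmx h *m _ *m _]mulmxA proj2_incl2 !mulmx1.
- move=> R S f r t [s [sl tJ rK]]; exists (map_rep f s); split.
  + exact: is_lift_map.
  + by move=> a; rewrite -(map_incl1 f) -!map_mxM tJ.
  + by move=> a; rewrite -(map_proj2 f) -!map_mxM rK.
Qed.

End Syzygy.

(** * Stable endomorphism rings of sums and syzygies *)

Section Factorizations.
Variable A : pzRingType.

Lemma factor_through_surjection (P V M : lmodType A) (p : {linear P -> V}) (f : {linear P -> M}) :
  surjective p -> (forall x, p x = 0 -> f x = 0) ->
  exists g : {linear V -> M}, forall x, g (p x) = f x.
Proof.
move=> p_surj f0; have [s sE] := choice p_surj.
have f_eq x y : p x = p y -> f x = f y.
  by move=> xy; apply/subr0_eq; rewrite -linearB; apply: f0; rewrite linearB xy subrr.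
have g_lin : linear (fun v => f (s v)).
  by move=> a u v; rewrite -linearP; apply: f_eq; rewrite linearP !sE.
by exists (make_linear g_lin) => x; apply: f_eq; rewrite sE.
Qed.

Lemma factor_through_injection (W P M : lmodType A) (i : {linear W -> P}) (f : {linear M -> P}) :
  injective i -> (forall x, exists w, i w = f x) ->
  exists g : {linear M -> W}, forall x, i (g x) = f x.
Proof.
move=> i_inj /choice [g gE].
have g_lin : linear g by move=> a x y; apply: i_inj; rewrite linearP !gE linearP.
by exists (make_linear g_lin).
Qed.

Lemma projective_cover_fg (P V : lmodType A) (p : {linear P -> V}) :
  projective_cover p -> finitely_generated V -> finitely_generated P.
Proof.
move=> [_ p_surj p_sup] [n [v v_span]]; have [y yE] := choice (fun j => p_surj (v j)).
exists n, y; apply: p_sup => [|x].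
  split=> [|_ _ [c ->] [d ->]|a _ [c ->]].
  - by exists (fun=> 0); rewrite big1 // => i _; rewrite scale0r.
  - by exists (fun i => c i + d i); rewrite -big_split; apply: eq_bigr => i _; rewrite scalerDl.
  - by exists (fun i => a * c i); rewrite scaler_sumr; apply: eq_bigr => i _; rewrite scalerA.
have [c cE] := v_span (p x); exists (\sum_i c i *: y i); first by exists c.
rewrite linearB cE linear_sum; apply/eqP; rewrite subr_eq0; apply/eqP/eq_bigr => i _.
by rewrite linearZ yE.
Qed.
End Factorizations.

Section StableModules.
Variables (k : fieldType) (L : falgType k).

Lemma stable_scalar_prod (V P : lmodType L) :
  projective P -> stable_endo_is_scalar V -> stable_endo_is_scalar (V * P)%type.
Proof.
move=> P_proj /stable_scalarP [V_scalar V1]; apply/stable_scalarP.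
have i1_lin : linear (fun v : V => (v, 0) : V * P).
  by move=> a x y; congr pair; rewrite /= scaler0 addr0.
have i2_lin : linear (fun x : P => (0, x) : V * P).
  by move=> a x y; congr pair; rewrite /= scaler0 addr0.
pose i1 := make_linear i1_lin; pose i2 := make_linear i2_lin.
have p1_lin : linear (fun x : V * P => x.1) by [].
have p2_lin : linear (fun x : V * P => x.2) by [].
pose p1 := make_linear p1_lin; pose p2 := make_linear p2_lin.
split=> [f|[Q [g [h [Q_proj one_hg]]]]]; last first.
  apply: V1; exists Q, (g \o i1), (p1 \o h); split=> // v.
  by rewrite /= -one_hg.
pose ff : {linear (V * P)%type -> (V * P)%type} := f.
have [c [Q [g [h [Q_proj fE]]]]] := V_scalar (endo_of (p1 \o (ff \o i1))).
(* f - c is the sum of three maps: its V-to-V component, which factors through Q, and the V-to-P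
   component and the restriction to P, which both factor through P. *)
have r_lin : linear (fun x : P => ff (0, x) - (c%:A : L) *: ((0, x) : V * P)).
  move=> a x y; have -> : (0, a *: x + y) = a *: i2 x + i2 y by rewrite -linearP.
  rewrite linearP scalerDr opprD addrACA scalerBr; congr (_ - _ + _).
  by rewrite !scalerA mulr_algl mulr_algr.
exists c.
have f1 : factors_through_projective (endo_of (i1 \o (h \o (g \o p1)))).
  by exists Q, (g \o p1), (i1 \o h).
have f2 : factors_through_projective (endo_of (i2 \o (p2 \o (ff \o (i1 \o p1))))).
  by exists P, (p2 \o (ff \o (i1 \o p1))), i2.
have f3 : factors_through_projective (endo_of (make_linear r_lin \o p2)).
  by exists P, p2, (make_linear r_lin).
have := fprojD (fprojD f1 f2) f3; congr factors_through_projective.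
apply: endoP => -[v x]; rewrite !endoD endoN endoZ endo1.
rewrite /endo_fun /= -fE endoD endoN endoZ endo1 /endo_fun /=.
transitivity (ff (v, 0) + ff (0, x) - (c%:A : L) *: ((v, x) : (V * P)%type)); last first.
  congr (_ - _); rewrite -linearD; congr (ff _).
  by congr pair; rewrite /= ?addr0 ?add0r.
case: (ff (v, 0)) => a b; case: (ff (0, x)) => a' b'.
congr pair; rewrite /= ?scaler0; first by rewrite subr0 addr0 addrAC.
by rewrite add0r addrA.
Qed.

(** Endomorphisms of W extend to the injective module P and so induce endomorphisms of V, where they
    are scalar up to a map through a projective. *)
Lemma stable_scalar_syzygy (V W P : lmodType L) (p : {linear P -> V}) (i : {linear W -> P}) :
  self_injective L -> finitely_generated V -> finitely_generated W ->
  finitely_generated P -> projective P -> surjective p -> injective i ->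
  (forall x, p x = 0 <-> exists w, i w = x) ->
  stable_endo_is_scalar V -> stable_endo_is_scalar W.
Proof.
move=> L_inj V_fg W_fg P_fg P_proj p_surj i_inj p_ker /stable_scalarP [V_scalar V1].
have pi0 w : p (i w) = 0 by apply/p_ker; exists w.
have P_inj := fg_projective_injective L_inj P_fg P_proj.
apply/stable_scalarP; split=> [f|/(fproj_column W_fg) [m [g [h one_hg]]]].
  pose ff : {linear W -> W} := f.
  have [e eE] := P_inj _ _ i (i \o ff) i_inj.
  have [|v vE] := @factor_through_surjection _ _ _ _ p (p \o e) p_surj.
    by move=> _ /p_ker [w <-]; rewrite /= eE /= pi0.
  have [c /(fproj_column V_fg) [m [g [h vgh]]]] := V_scalar v.
  have [h' h'E] := @cV_projective L m _ _ p h p_surj.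
  (* After composition with p this map is (v - c - h g) p = 0, so it takes values in W; on W it
     restricts to f - c because p i = 0. Thus f - c factors through P. *)
  have d_lin : linear (fun x => e x - (c%:A : L) *: x - h' (g (p x))).
    move=> a x y; rewrite !linearP /= !scalerBr !scalerDr !opprD.
    rewrite [(c%:A : L) *: (a *: x)]scalerA mulr_algl -mulr_algr -scalerA.
    by rewrite [RHS]addrACA [X in _ = X + _]addrACA scalerN.
  have [|d dE] := @factor_through_injection _ _ _ _ i (make_linear d_lin) i_inj.
    move=> x; apply/p_ker; rewrite /= !linearB linearZ h'E -vgh endoD endoN endoZ endo1.
    by rewrite /endo_fun vE /= subrr.
  exists c, P, i, d; split=> // w; apply: i_inj.
  by rewrite endoD endoN endoZ endo1 linearB linearZ dE /= eE /= pi0 (raddf0 g) (raddf0 h') subr0.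
have E_inj := fg_projective_injective L_inj (@cV_finitely_generated L m) (@cV_projective L m).
have [g' g'E] := E_inj _ _ i g i_inj.
(* i h g' projects P onto W. Its complement factors through p and gives a splitting of p, so the
   identity of V would factor through P. *)
have [|j jE] := @factor_through_surjection _ _ _ _ p (idfun \- (i \o (h \o g'))) p_surj.
  by move=> _ /p_ker [w <-]; rewrite /= g'E -one_hg subrr.
apply: V1; exists P, j, p; split=> // v; have [x <-] := p_surj v.
by rewrite jE /= linearB pi0 subr0.
Qed.

End StableModules.

Lemma universal_ring_iso (k : fieldType) (L : falgType k) (V W : lmodType L) (R S : clnAlg k) :
  naturally_isomorphic (deformation_functor V) (deformation_functor W) ->
  universal_deformation_ring V R -> universal_deformation_ring W S -> cln_iso R S.
Proof.
move=> VW VR WS; apply: hom_functor_iso.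
exact: nat_iso_trans (nat_iso_sym VR) (nat_iso_trans VW WS).
Qed.

Theorem theorem2p6 (k : fieldType) (L : falgType k) (V : lmodType L)
    (L_selfinj : self_injective L)
    (V_fg : finitely_generated V)
    (V_stable : stable_endo_is_scalar V) :
  [/\ naturally_isomorphic (deformation_functor V) (weak_deformation_functor V),

      exists R : clnAlg k, universal_deformation_ring V R,

      forall P : lmodType L, finitely_generated P -> projective P ->
        [/\ stable_endo_is_scalar (V * P)%type,
            exists R' : clnAlg k, universal_deformation_ring (V * P)%type R'
          & forall R R' : clnAlg k,
              universal_deformation_ring V R ->
              universal_deformation_ring (V * P)%type R' -> cln_iso R R']

    & frobenius L ->
      forall W : lmodType L, is_syzygy V W ->
        [/\ stable_endo_is_scalar W,
            exists R' : clnAlg k, universal_deformation_ring W R'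
          & forall R R' : clnAlg k,
              universal_deformation_ring V R ->
              universal_deformation_ring W R' -> cln_iso R R']].
Proof.
have [n [F]] := fg_frame V_fg.
have universal (U : lmodType L) : finitely_generated U -> stable_endo_is_scalar U ->
    exists R : clnAlg k, universal_deformation_ring U R.
  move=> /fg_frame [m [G]] U_stable.
  exact: (universal_deformation (stable_endo_lifting (F := G) L_selfinj U_stable)).
split.
- exact: (weak_deformation_iso (stable_endo_lifting (F := F) L_selfinj V_stable)).
- exact: universal.
- move=> P P_fg P_proj; have VP_stable := stable_scalar_prod P_proj V_stable.
  have [m [G]] := fg_frame P_fg.
  have [u uP] := proj_data_exists G P_proj.
  have [v vP] := inj_data_exists G (fg_projective_injective L_selfinj P_fg P_proj).
  split=> // [|R R']; last exact: universal_ring_iso (sum_projective_iso F uP vP).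
  have [H _] := frame_sum F G; exact: universal (frame_fg H) VP_stable.
move=> _ W [P [p [i [p_cover i_inj p_ker]]]].
have [P_proj p_surj _] := p_cover; have P_fg := projective_cover_fg p_cover V_fg.
(* W is finite dimensional as a submodule of P, hence finitely generated. *)
have [l [E]] := fg_frame P_fg; have [m [G]] := sub_frame E i_inj.
have W_fg := frame_fg G.
have W_stable := stable_scalar_syzygy L_selfinj V_fg W_fg P_fg P_proj p_surj i_inj p_ker V_stable.
have [H [GH HF]] := extension_frame F G p_surj i_inj p_ker.
have [u uP] := proj_data_exists H P_proj.
have [v vP] := inj_data_exists H (fg_projective_injective L_selfinj P_fg P_proj).
split=> // [|R R']; first exact: universal.
exact: universal_ring_iso (syzygy_deformation_iso uP vP GH HF).
Qed.
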